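(* For any frequency $\lambda$, every $1\le p\le p_0(\lambda)$ and $p\le q\le\infty$, we have $$S_p(\lambda)\le\frac{p_0(\lambda)L(\lambda)}{2p}\quad\text{and}\quad T_{q,p}(\lambda)\le\frac{p_0(\lambda)L(\lambda)}2\Big(\frac1p-\frac1q\Big).$$ Moreover, assume that $p_0(\lambda)>1$. Given $1\le p<p_0(\lambda)$, the following are equivalent: (i) $S_p(\lambda)=\frac{p_0(\lambda)L(\lambda)}{2p}$; (ii) $S_r(\lambda)=\frac{p_0(\lambda)L(\lambda)}{2r}$ for every $p\le r\le p_0(\lambda)$; (iii) $T_{q,p}(\lambda)=\frac{p_0(\lambda)L(\lambda)}2\big(\frac1p-\frac1q\big)$ for some $p<q\le\infty$; (iv) $T_{q,r}(\lambda)=\frac{p_0(\lambda)L(\lambda)}2\big(\frac1r-\frac1q\big)$ for every $p\le r<p_0(\lambda)$ and $r<q\le\infty$. In particular, if $S_1(\lambda)=L(\lambda)$, then $p_0(\lambda)=2$ and all the strips involved are known.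
   Context: A frequency is a strictly increasing sequence $\lambda=(\lambda_n)_{n\ge1}$ of non-negative real numbers tending to $\infty$. A $\lambda$-Dirichlet series is a formal series $D=\sum a_ne^{-\lambda_ns}$ with complex coefficients; it is a $\lambda$-Dirichlet polynomial if only finitely many $a_n$ are non-zero. For $1\le p<\infty$, $\mathcal{H}_p(\lambda)$ is the completion of the space of $\lambda$-Dirichlet polynomials under $$\|D\|_p=\lim_{T\to\infty}\Big(\frac1{2T}\int_{-T}^T\Big|\sum_n a_ne^{-\lambda_nit}\Big|^pdt\Big)^{1/p}.$$ Equivalently, and also for $p=\infty$: let $(G,\beta)$ be a $\lambda$-Dirichlet group, i.e. $G$ is a compact abelian group (with normalized Haar measure) and $\beta:(\mathbb{R},+)\to G$ is a continuous homomorphism with dense range such that for every $n$ there is a character $h_{\lambda_n}\in\widehat G$ with $h_{\lambda_n}(\beta(t))=e^{-i\lambda_nt}$ for all $t$; such a pair always exists. Then for $1\le p\le\infty$, $\mathcal{H}_p(\lambda)$ consists of all $\lambda$-Dirichlet series $\sum\widehat f(h_{\lambda_n})e^{-\lambda_ns}$ with $f\in L_p(G)$ and $\operatorname{supp}\widehat f\subseteq\{h_{\lambda_n}:n\ge1\}$, with norm $\|f\|_p$; this does not depend on the chosen group. For $\sigma\in\mathbb{R}$, $\tau_\sigma D=D_\sigma=\sum a_ne^{-\lambda_n\sigma}e^{-\lambda_ns}$ for $D=\sum a_ne^{-\lambda_ns}$. $L(\lambda)=\limsup_{n\to\infty}\frac{\log n}{\lambda_n}\in[0,\infty]$. Let $\sigma_a(D)=\inf\{\sigma\in\mathbb{R}: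 D\text{ converges absolutely on }[\operatorname{Re}s>\sigma]\}$ and $\sigma_p(D)=\inf\{\sigma\in\mathbb{R}: D_\sigma\in\mathcal{H}_p(\lambda)\}$. Then $$S_p(\lambda)=\sup_D\big(\sigma_a(D)-\sigma_p(D)\big)=\sup_{D\in\mathcal{H}_p(\lambda)}\sigma_a(D),$$ $$T_{q,p}(\lambda)=\sup_D\big(\sigma_q(D)-\sigma_p(D)\big)=\inf\{\sigma>0:\tau_\sigma:\mathcal{H}_p(\lambda)\to\mathcal{H}_q(\lambda)\text{ is bounded}\},$$ where $D$ in the suprema $\sup_D$ ranges over all $\lambda$-Dirichlet series and $\infty-\infty$ is understood to be $0$. The numbers $S_p(\lambda)$ and $T_{q,p}(\lambda)$ are the widths of the strips referred to in the claim. Finally $$p_0(\lambda)=\inf\{1\le p\le2: S_p(\lambda)=L(\lambda)/2\}$$ (the set is non-empty since $S_2(\lambda)=L(\lambda)/2$, and the infimum is attained). Here $1/\infty=0$.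
   Formalization: The closing claim (if S_1(λ)=L(λ), then p_0(λ)=2 and all strips are known) is stated under p_0(λ)>1 or 0<L(λ)<∞; without this it fails, since L(λ)=0 (e.g. λ_n=n) or L(λ)=∞ gives S_1(λ)=L(λ) but p_0(λ)=1. *)

(* Defs.v *)
From HB Require Import structures.
From mathcomp Require Import all_boot all_order all_algebra.
From mathcomp Require Import complex.
From mathcomp Require Import all_classical all_reals all_analysis.

Set Implicit Arguments.
Unset Strict Implicit.
Unset Printing Implicit Defensive.

Import Order.TTheory GRing.Theory Num.Theory ComplexField.
Import numFieldNormedType.Exports.

Local Open Scope classical_set_scope.
Local Open Scope ring_scope.
Local Open Scope complex_scope.

(* [R[i]] is the type of complex numbers over [R], [Normc.normc] the modulus
   with values in [R], and [(R[i])^o] carries the usual topology.  [Re] and [Im]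
   below are the [R]-valued projections of [R[i]], not the ones of
   [numClosedFieldType]. *)
Notation Re := complex.Re.
Notation Im := complex.Im.

Definition cexp (R : realType) (z : R[i]) : R[i] :=
  (expR (Re z))%:C * (cos (Im z) +i* sin (Im z)).

(* A topological group with its Borel sigma-algebra.  Measurable types must be
   pointed; the base point 0 plays no further role. *)
Definition pointed_group (G : topologicalZmodType) : Type := G.
HB.instance Definition _ (G : topologicalZmodType) :=
  Choice.on (pointed_group G).
HB.instance Definition _ (G : topologicalZmodType) :=
  isPointed.Build (pointed_group G) (0 : G).

Notation borel G :=
  (g_sigma_algebraType (@open G : set (set (pointed_group G)))).

(* Normalized Haar measure of a compact abelian group. Regularity is part of
   the definition, because on a non-metrizable group the Borel sigma-algebra
   may be larger than the Baire one. *)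
Record is_haar (R : realType) (G : topologicalZmodType)
    (mu : probability (borel G) R) : Prop := IsHaar {
  haar_invariant : forall (g : G) (A : set (borel G)), measurable A ->
    mu [set x : G | A (g + x)] = mu A;
  haar_regular : forall A : set (borel G), measurable A ->
    mu A = ereal_sup [set mu K | K in [set K : set G | compact K /\ K `<=` A]]
}.

Record is_character (R : realType) (G : topologicalZmodType)
    (chi : G -> R[i]) : Prop := IsCharacter {
  character_continuous : continuous (chi : G -> (R[i])^o);
  characterD : forall x y, chi (x + y) = chi x * chi y;
  character_unimodular : forall x, Normc.normc (chi x) = 1
}.

(* A frequency. The index is shifted by one: [lam n] is lambda_{n+1}. *)
Record is_frequency (R : realType) (lam : nat -> R) : Prop := IsFrequency {
  frequency_ge0 : forall n, 0 <= lam n;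
  frequency_increasing : forall m n, (m < n)%N -> lam m < lam n;
  frequency_cvgy : lam @ \oo --> +oo
}.

(* A lambda-Dirichlet group, together with its Haar measure and the characters
   h_{lambda_n}, which are unique since beta has dense range. *)
Record dirichlet_group (R : realType) (lam : nat -> R) := DirichletGroup {
  dgroup :> topologicalZmodType;
  dgroup_hausdorff : hausdorff_space dgroup;
  dgroup_compact : compact [set: dgroup];
  dhaar : probability (borel dgroup) R;
  dhaarP : is_haar dhaar;
  dbeta : R -> dgroup;
  dbetaD : forall s t, dbeta (s + t) = dbeta s + dbeta t;
  dbeta_continuous : continuous dbeta;
  dbeta_dense : dense (range dbeta);
  dchar : nat -> dgroup -> R[i];
  dcharP : forall n, is_character (dchar n);
  dchar_beta : forall n t, dchar n (dbeta t) = cexp (0 -i* (lam n * t))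
}.

Arguments dhaar {R lam} G : rename.
Arguments dchar {R lam} G n x : rename.

Section dirichlet_series.
Context (R : realType) (lam : nat -> R).

(* The lambda-Dirichlet series sum a_n e^{- lambda_n s} is represented by its
   coefficient sequence a : nat -> R[i]. *)

Definition abs_cvg_at (a : nat -> R[i]) (s : R[i]) :=
  cvgn (series (fun n => Normc.normc (a n * cexp (- (lam n)%:C * s)))).

Definition sigma_a (a : nat -> R[i]) : \bar R :=
  ereal_inf [set sigma%:E | sigma in
    [set sigma : R | forall s : R[i], sigma < Re s -> abs_cvg_at a s]].

Definition translate (sigma : R) (a : nat -> R[i]) : nat -> R[i] :=
  fun n => a n * (expR (- (lam n * sigma)))%:C.

Definition freqL : \bar R :=
  limn_esup (fun n : nat => (ln (n.+1%:R : R) / lam n)%:E).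

End dirichlet_series.

Section Lp.
Context (R : realType) (G : topologicalZmodType) (mu : probability (borel G) R).

Definition in_Lp (p : \bar R) (f : G -> R[i]) : Prop :=
  [/\ measurable_fun setT (fun x : borel G => Re (f x)),
      measurable_fun setT (fun x : borel G => Im (f x)) &
      (Lnorm mu p (fun x => (Normc.normc (f x))%:E) < +oo)%E].

Definition fourier (f chi : G -> R[i]) : R[i] :=
  (\int[mu]_x Re (f x * conjc (chi x))) +i* (\int[mu]_x Im (f x * conjc (chi x))).

End Lp.

Section strips.
Context (R : realType) (lam : nat -> R) (G : dirichlet_group lam).

Definition in_Hp (p : \bar R) (a : nat -> R[i]) : Prop :=
  exists f : G -> R[i],
    [/\ in_Lp (dhaar G) p f,
        forall chi : G -> R[i], is_character chi ->
          fourier (dhaar G) f chi != 0 -> exists n, chi = dchar G n &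
        forall n, a n = fourier (dhaar G) f (dchar G n)].

Definition sigma_H (p : \bar R) (a : nat -> R[i]) : \bar R :=
  ereal_inf [set sigma%:E | sigma in
    [set sigma : R | in_Hp p (translate lam sigma a)]].

(* Subtraction of extended reals with oo - oo = 0 (and (-oo) - (-oo) = 0),
   whereas the library has +oo - +oo = -oo. *)
Definition esub0 (x y : \bar R) : \bar R := if x == y then 0%E else (x - y)%E.

Definition widthS (p : \bar R) : \bar R :=
  ereal_sup [set esub0 (sigma_a lam a) (sigma_H p a) | a in [set: nat -> R[i]]].

Definition widthT (q p : \bar R) : \bar R :=
  ereal_sup [set esub0 (sigma_H q a) (sigma_H p a) | a in [set: nat -> R[i]]].

Definition p0 : R :=
  inf [set p : R | 1 <= p <= 2 /\ widthS p%:E = (freqL lam / 2%:E)%E].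

End strips.

(* Main.v *)
(* Let f_1 in L_p(G) and f_2 in L_q(G) have the coefficients a_n e^{-s_j lambda_n},
   j = 1, 2, let s_1 < sigma < s_2, and put
     Q_s = sum_n a_n e^{-sigma lambda_n} e^{-(lambda_n - s)^2 / 2} h_{lambda_n}.
   Completing the square makes Q_s a multiple, of size e^{-(sigma - s_j) s}, of a
   Gaussian multiplier applied to f_j, and Gaussian multipliers are contractions,
   being limits of averages of translations along beta.  For
   1/r = theta/p + (1 - theta)/q, Hoelder's inequality bounds |Q_s|_r by a constant
   times e^{-eps s}, eps = sigma - theta s_1 - (1 - theta) s_2, and monotonicity of
   the norms bounds it by a constant times e^{(s_2 - sigma) s}.  If eps > 0, the
   integral of Q_s over s in R is therefore a function in L_r(G) with coefficients
   proportional to a_n e^{-sigma lambda_n}.  Hence the abscissa sigma_r is a convex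
   function of 1/r.
   Together with sigma_p <= sigma_oo <= sigma_a, S_2 = L/2 and S_1 <= L, convexity
   gives the claims by elementary algebra.  If L = oo, then p_0 = 1 and all claims
   are trivial. *)

(* The Gaussian factor has two purposes: it makes Q_s absolutely convergent as soon as L < oo, and
   its integral over s does not depend on lambda_n, so that integration restores the coefficients.
   Partial sums need not be bounded on L_p, so contraction is proved for polynomials and carried to
   f by Fejer means. The group is an arbitrary compact one; hence the kernels are normalised squares
   |sum of characters|^2, taken over boxes of powers of the h_n, and are controlled by orthogonality
   alone. The closing algebra rests on one consequence of convexity: interpolation between p and oo,
   with sigma_oo <= sigma_a, shows that p S_p is non-decreasing. Hence the infimum p_0 is attained
   and p S_p <= p_0 S_{p_0} = p_0 L/2 for p <= p_0; the same interpolation gives T_{q,p} <= (1 -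
   p/q) S_p and with it the second bound. In the equivalences, equality at one place is passed on by
   the triangle inequality S_r <= T_{m,r} + S_m or by convexity once more. *)
Require Import Defs.
From HB Require Import structures.
From mathcomp Require Import all_boot all_order all_algebra.
From mathcomp Require Import complex ring lra.
From mathcomp Require Import all_classical all_reals all_analysis.
From mathcomp Require Import measurable_realfun ess_sup_inf.

Set Implicit Arguments.
Unset Strict Implicit.
Unset Printing Implicit Defensive.

Import Order.TTheory GRing.Theory Num.Theory ComplexField.
Import numFieldNormedType.Exports.

Local Open Scope classical_set_scope.
Local Open Scope ring_scope.
Local Open Scope complex_scope.
Local Notation normc := Normc.normc.
Local Notation Re := complex.Re.
Local Notation Im := complex.Im.

(** * Complex-valued functions *)

Section complex_numbers.
Context {R : realType}.
Implicit Types z w : R[i].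

Lemma cReD z w : Re (z + w) = Re z + Re w. Proof. by case: z => a b; case: w => c d. Qed.
Lemma cImD z w : Im (z + w) = Im z + Im w. Proof. by case: z => a b; case: w => c d. Qed.
Lemma cReM z w : Re (z * w) = Re z * Re w - Im z * Im w.
Proof. by case: z => a b; case: w => c d. Qed.
Lemma cImM z w : Im (z * w) = Re z * Im w + Im z * Re w.
Proof. by case: z => a b; case: w => c d. Qed.
Lemma Re_realM (x : R) z : Re (x%:C * z) = x * Re z.
Proof. by case: z => a b /=; rewrite mul0r subr0. Qed.
Lemma Im_realM (x : R) z : Im (x%:C * z) = x * Im z.
Proof. by case: z => a b /=; rewrite mul0r addr0. Qed.
Lemma cReN z : Re (- z) = - Re z. Proof. by case: z. Qed.
Lemma cImN z : Im (- z) = - Im z. Proof. by case: z. Qed.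
Lemma Re_conjc z : Re (conjc z) = Re z. Proof. by case: z. Qed.
Lemma Im_conjc z : Im (conjc z) = - Im z. Proof. by case: z. Qed.

Lemma complex_eq z w : Re z = Re w -> Im z = Im w -> z = w.
Proof. by case: z => a b; case: w => c d /= -> ->. Qed.

Lemma normc_sqrt z : normc z = Num.sqrt (Re z ^+ 2 + Im z ^+ 2).
Proof. by case: z. Qed.

Lemma normc_ge0 z : 0 <= normc z.
Proof. by rewrite normc_sqrt sqrtr_ge0. Qed.

Lemma normc_sqr z : normc z ^+ 2 = Re z ^+ 2 + Im z ^+ 2.
Proof. by rewrite normc_sqrt sqr_sqrtr// addr_ge0// sqr_ge0. Qed.

Lemma normc_le (z : R[i]) (M : R) : 0 <= M -> Re z ^+ 2 + Im z ^+ 2 <= M ^+ 2 ->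
  normc z <= M.
Proof.
move=> M0 h; rewrite -(@ler_pXn2r _ 2)// ?nnegrE ?normc_ge0//.
by rewrite normc_sqr.
Qed.

Lemma normc_Re z : `|Re z| <= normc z.
Proof.
rewrite -(@ler_pXn2r _ 2)// ?nnegrE ?normc_ge0// normc_sqr.
by rewrite real_normK ?num_real// lerDl sqr_ge0.
Qed.

Lemma normc_Im z : `|Im z| <= normc z.
Proof.
rewrite -(@ler_pXn2r _ 2)// ?nnegrE ?normc_ge0// normc_sqr.
by rewrite real_normK ?num_real// lerDr sqr_ge0.
Qed.

Lemma normc_ReIm z : normc z <= `|Re z| + `|Im z|.
Proof.
apply: normc_le; first by rewrite addr_ge0.
rewrite sqrrD !real_normK ?num_real//.
by rewrite lerD2r lerDl mulrn_wge0// mulr_ge0.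
Qed.

Lemma normc_conjc z : normc (conjc z) = normc z.
Proof. by rewrite !normc_sqrt Re_conjc Im_conjc sqrrN. Qed.

Lemma normc_real (x : R) : normc x%:C = `|x|.
Proof. by rewrite normc_sqrt /= expr0n addr0 sqrtr_sqr. Qed.

Lemma normc_realM (x : R) z : normc (x%:C * z) = `|x| * normc z.
Proof. by rewrite Normc.normcM normc_real. Qed.

Lemma normcD z w : normc (z + w) <= normc z + normc w.
Proof. exact: le_normcD. Qed.

Lemma normcN z : normc (- z) = normc z.
Proof. by case: z => a b; rewrite !normc_sqrt /= !sqrrN. Qed.

Lemma normc_sum (I : Type) (r : seq I) (P : pred I) (F : I -> R[i]) :
  normc (\sum_(i <- r | P i) F i) <= \sum_(i <- r | P i) normc (F i).
Proof.
elim/big_rec2: _ => [|i y x _ h]; first by rewrite Normc.normc0.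
by rewrite (le_trans (normcD _ _))// lerD2l.
Qed.

Lemma normc_eq0 z : (normc z == 0) = (z == 0).
Proof.
apply/eqP/eqP => [/Normc.eq0_normc//|->]; exact: Normc.normc0.
Qed.

Lemma normcX z n : normc (z ^+ n) = normc z ^+ n.
Proof.
by elim: n => [|n ih]; rewrite ?expr0 ?Normc.normc1// !exprS Normc.normcM ih.
Qed.

(** For unimodular z, |1 - z|^2 = 2 - 2 Re z. The right-hand side is spelled as in [sub_pair_count],
    where it is split into Fourier coefficients. *)
Lemma Re_mul_gap (b : R) z : normc z = 1 ->
  Re (b%:C * (normc (1 - z) ^+ 2)%:C) =
  Re (2%:C * (b%:C * 1 + (- 1) * (b%:C * conjc z))).
Proof.
move=> z1; have := normc_sqr z; rewrite z1 expr1n.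
rewrite normc_sqr; case: z {z1} => u v /= uv.
transitivity (b * (1 - 2 * u + (u ^+ 2 + v ^+ 2))); first by ring.
by rewrite -uv; ring.
Qed.

Lemma mulc_conj z : z * conjc z = (normc z ^+ 2)%:C.
Proof.
apply: complex_eq; rewrite ?cReM ?cImM Re_conjc Im_conjc /= ?normc_sqr; ring.
Qed.

Lemma Re_sum (I : Type) (r : seq I) (P : pred I) (F : I -> R[i]) :
  Re (\sum_(i <- r | P i) F i) = \sum_(i <- r | P i) Re (F i).
Proof. by elim/big_rec2: _ => [//|i y x _ <-]; rewrite cReD. Qed.

Lemma Im_sum (I : Type) (r : seq I) (P : pred I) (F : I -> R[i]) :
  Im (\sum_(i <- r | P i) F i) = \sum_(i <- r | P i) Im (F i).
Proof. by elim/big_rec2: _ => [//|i y x _ <-]; rewrite cImD. Qed.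

End complex_numbers.

Section complex_integral.
Context d (T : measurableType d) (R : realType) (mu : {measure set T -> \bar R}).
Implicit Types f g : T -> R[i].

Definition cmeas (f : T -> R[i]) : Prop :=
  measurable_fun setT (fun x => Re (f x)) /\
  measurable_fun setT (fun x => Im (f x)).

Lemma cmeas_cst c : cmeas (fun=> c).
Proof. by split; exact: measurable_cst. Qed.

Lemma cmeasD f g : cmeas f -> cmeas g -> cmeas (fun x => f x + g x).
Proof.
move=> [f1 f2] [g1 g2]; split.
  by under eq_fun do rewrite cReD; exact: measurable_funD.
by under eq_fun do rewrite cImD; exact: measurable_funD.
Qed.

Lemma cmeasM f g : cmeas f -> cmeas g -> cmeas (fun x => f x * g x).
Proof.
move=> [f1 f2] [g1 g2]; split.
  under eq_fun do rewrite cReM; apply: measurable_funB; exact: measurable_funM.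
under eq_fun do rewrite cImM; apply: measurable_funD; exact: measurable_funM.
Qed.

Lemma cmeas_conjc f : cmeas f -> cmeas (fun x => conjc (f x)).
Proof.
move=> [f1 f2]; split; first by under eq_fun do rewrite Re_conjc.
by under eq_fun do rewrite Im_conjc; apply: measurableT_comp.
Qed.

Lemma cmeas_real (h : T -> R) : measurable_fun setT h -> cmeas (fun x => (h x)%:C).
Proof. by move=> mh; split => //=; exact: measurable_cst. Qed.

Lemma cmeas_sum (I : Type) (r : seq I) (F : I -> T -> R[i]) :
  (forall i, cmeas (F i)) -> cmeas (fun x => \sum_(i <- r) F i x).
Proof.
move=> h; elim: r => [|i r ih].
  by under eq_fun do rewrite big_nil; exact: cmeas_cst.
by under eq_fun do rewrite big_cons; exact: cmeasD.
Qed.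

Lemma measurable_normc f : cmeas f -> measurable_fun setT (fun x => normc (f x)).
Proof.
move=> [f1 f2]; under eq_fun do rewrite normc_sqrt.
apply: (measurableT_comp (f := @Num.sqrt R)).
  by apply: continuous_measurable_fun; exact: sqrt_continuous.
by apply: measurable_funD; apply: measurable_funX.
Qed.

(** Componentwise, so that [fourier mu f chi] is convertible to the [cint] of the product of [f] and
    [conjc chi]. *)
Definition cint (f : T -> R[i]) : R[i] :=
  (\int[mu]_x Re (f x)) +i* (\int[mu]_x Im (f x)).

Definition cintegrable (f : T -> R[i]) : Prop :=
  cmeas f /\ (\int[mu]_x (normc (f x))%:E < +oo)%E.

Lemma cintegrable_normc f : cintegrable f ->
  mu.-integrable setT (EFin \o (fun x => normc (f x))).
Proof.
move=> [mf foo]; apply/integrableP; split.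
  by apply/measurable_EFinP; exact: measurable_normc.
under eq_integral do rewrite /= ger0_norm ?normc_ge0//.
exact: foo.
Qed.

Lemma cintegrable_Re f : cintegrable f ->
  mu.-integrable setT (EFin \o (fun x => Re (f x))).
Proof.
move=> fi; have [[mf _] _] := fi.
apply: (le_integrable _ _ _ (cintegrable_normc fi)) => //.
  exact/measurable_EFinP.
by move=> x _ /=; rewrite lee_fin (ger0_norm (normc_ge0 _)) normc_Re.
Qed.

Lemma cintegrable_Im f : cintegrable f ->
  mu.-integrable setT (EFin \o (fun x => Im (f x))).
Proof.
move=> fi; have [[_ mf] _] := fi.
apply: (le_integrable _ _ _ (cintegrable_normc fi)) => //.
  exact/measurable_EFinP.
by move=> x _ /=; rewrite lee_fin (ger0_norm (normc_ge0 _)) normc_Im.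
Qed.

Lemma le_cintegrable f g : cmeas f -> cintegrable g ->
  (forall x, normc (f x) <= normc (g x)) -> cintegrable f.
Proof.
move=> mf [mg goo] fg; split=> //; apply: le_lt_trans goo.
apply: ge0_le_integral => //.
- by move=> x _; rewrite lee_fin normc_ge0.
- by apply/measurable_EFinP; exact: measurable_normc.
- by apply/measurable_EFinP; exact: measurable_normc.
- by move=> x _; rewrite lee_fin.
Qed.

Lemma cintegrableD f g : cintegrable f -> cintegrable g ->
  cintegrable (fun x => f x + g x).
Proof.
move=> fi gi; have [mf foo] := fi; have [mg goo] := gi.
split; first exact: cmeasD.
apply: (@le_lt_trans _ _ (\int[mu]_x ((normc (f x))%:E + (normc (g x))%:E))%E).
  apply: ge0_le_integral => //.
  - by move=> x _; rewrite lee_fin normc_ge0.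
  - by apply/measurable_EFinP; apply: measurable_normc; exact: cmeasD.
  - by apply: emeasurable_funD; apply/measurable_EFinP; exact: measurable_normc.
  - by move=> x _; rewrite -EFinD lee_fin normcD.
rewrite ge0_integralD//; first exact: lte_add_pinfty.
- by move=> x _; rewrite lee_fin normc_ge0.
- by apply/measurable_EFinP; exact: measurable_normc.
- by move=> x _; rewrite lee_fin normc_ge0.
- by apply/measurable_EFinP; exact: measurable_normc.
Qed.

Lemma cintegrable_bound f g (M : R) : 0 <= M -> cintegrable f -> cmeas g ->
  (forall x, normc (g x) <= M) -> cintegrable (fun x => g x * f x).
Proof.
move=> M0 fi mg gM; have [mf foo] := fi; split; first exact: cmeasM.
apply: (@le_lt_trans _ _ (\int[mu]_x (M%:E * (normc (f x))%:E))%E).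
  apply: ge0_le_integral => //.
  - by move=> x _; rewrite lee_fin normc_ge0.
  - by apply/measurable_EFinP; apply: measurable_normc; exact: cmeasM.
  - apply/measurable_EFinP; apply: measurable_funM => //.
    exact: measurable_normc.
  - by move=> x _; rewrite -EFinM lee_fin Normc.normcM ler_wpM2r// normc_ge0.
rewrite ge0_integralZl//.
- by rewrite lte_mul_pinfty.
- by apply/measurable_EFinP; exact: measurable_normc.
- by move=> x _; rewrite lee_fin normc_ge0.
Qed.

Lemma cintegrableZ f c : cintegrable f -> cintegrable (fun x => c * f x).
Proof.
move=> fi; apply: (cintegrable_bound (normc_ge0 c)) => //; exact: cmeas_cst.
Qed.

Lemma cintD f g : cintegrable f -> cintegrable g ->
  cint (fun x => f x + g x) = cint f + cint g.
Proof.
move=> fi gi; apply: complex_eq; rewrite ?cReD ?cImD /=.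
  under eq_Rintegral do rewrite cReD.
  by rewrite RintegralD//; exact: cintegrable_Re.
under eq_Rintegral do rewrite cImD.
by rewrite RintegralD//; exact: cintegrable_Im.
Qed.

Lemma integrableZ_EFin (h : T -> R) (r : R) : mu.-integrable setT (EFin \o h) ->
  mu.-integrable setT (EFin \o (fun x => r * h x)).
Proof. by move=> hi; rewrite (_ : _ \o _ = (fun x => r%:E * (EFin \o h) x)%E)//; exact: integrableZl. Qed.

Lemma cintZ f c : cintegrable f -> cint (fun x => c * f x) = c * cint f.
Proof.
move=> fi; have fR := cintegrable_Re fi; have fI := cintegrable_Im fi.
apply: complex_eq; rewrite ?cReM ?cImM /=.
  under eq_Rintegral do rewrite cReM.
  rewrite RintegralB//; [|exact: integrableZ_EFin..].
  by rewrite !RintegralZl.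
under eq_Rintegral do rewrite cImM.
rewrite RintegralD//; [|exact: integrableZ_EFin..].
by rewrite !RintegralZl.
Qed.

Lemma eq_cint f g : f =1 g -> cint f = cint g.
Proof. by move=> /funext ->. Qed.

Lemma cint0 : cint (fun=> 0) = 0.
Proof. by rewrite /cint /= Rintegral_cst// mul0r. Qed.

Lemma cintegrable0 : cintegrable (fun=> 0).
Proof.
split; first exact: cmeas_cst.
under eq_integral do rewrite Normc.normc0.
by rewrite integral0.
Qed.

Lemma cintegrable_sum (I : Type) (r : seq I) (F : I -> T -> R[i]) :
  (forall i, cintegrable (F i)) -> cintegrable (fun x => \sum_(i <- r) F i x).
Proof.
move=> h; elim: r => [|i r ih].
  by under eq_fun do rewrite big_nil; exact: cintegrable0.
by under eq_fun do rewrite big_cons; exact: cintegrableD.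
Qed.

Lemma cint_sum (I : Type) (r : seq I) (F : I -> T -> R[i]) :
  (forall i, cintegrable (F i)) ->
  cint (fun x => \sum_(i <- r) F i x) = \sum_(i <- r) cint (F i).
Proof.
move=> h; elim: r => [|i r ih].
  by under eq_cint do rewrite big_nil; rewrite big_nil cint0.
under eq_cint do rewrite big_cons.
by rewrite big_cons cintD ?ih//; exact: cintegrable_sum.
Qed.

(** Rotate by the unimodular [c] with c z = |z|: then |z| is the integral of Re (c f), and Re (c f)
    <= |f|. *)
Lemma normc_cint f : cintegrable f ->
  ((normc (cint f))%:E <= \int[mu]_x (normc (f x))%:E)%E.
Proof.
move=> fi; have ni := cintegrable_normc fi; set z := cint f.
have [z0|z0] := eqVneq z 0.
  by rewrite z0 Normc.normc0; apply: integral_ge0 => x _; rewrite lee_fin normc_ge0.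
pose c := (normc z)^-1%:C * conjc z.
have nz : normc z != 0 by rewrite normc_eq0.
have nc : normc c = 1.
  rewrite /c normc_realM normc_conjc ger0_norm ?invr_ge0 ?normc_ge0//.
  by rewrite mulVf.
have cz : c * z = (normc z)%:C.
  rewrite /c -mulrA (mulrC _ z) mulc_conj -rmorphM/=.
  by rewrite expr2 mulrA mulVf// mul1r.
have /(congr1 (@complex.Re R)) := cintZ c fi; rewrite -/z cz /= => <-.
have ci := cintegrableZ c fi.
apply: (@le_trans _ _ `|\int[mu]_x (Re (c * f x))%:E|%E).
  rewrite -EFin_normr_Rintegral//; last exact: cintegrable_Re.
  by rewrite lee_fin ler_norm.
apply: (le_trans (le_abse_integral mu measurableT _)).
  by apply/measurable_EFinP; exact: ci.1.1.
apply: ge0_le_integral => //.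
- by apply: measurableT_comp => //; apply/measurable_EFinP; exact: ci.1.1.
- by apply/measurable_EFinP; apply: measurable_normc; exact: fi.1.
- move=> x _; rewrite lee_fin; apply: le_trans (normc_Re _) _.
  by rewrite Normc.normcM nc mul1r.
Qed.

End complex_integral.

(** * Characters and Haar measure *)

Section characters.
Context {R : realType}.

Lemma normE (z : R[i]) : `|z| = (normc z)%:C.
Proof. by rewrite normc_def normc_sqrt. Qed.

Lemma continuous_complexP (T : topologicalType) (f : T -> R[i]) :
  continuous (f : T -> (R[i])^o) <->
  continuous (fun x => Re (f x)) /\ continuous (fun x => Im (f x)).
Proof.
split=> [cf|[c1 c2]].
  by split=> x; apply/cvgrPdist_lt => e e0;
    have /cvgrPdist_lt/(_ e%:C) := cf x; rewrite ltcR => /(_ e0);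
    apply: filterS => y; rewrite normE ltcR; apply: le_lt_trans;
    [have := normc_Re (f x - f y)|have := normc_Im (f x - f y)];
    rewrite ?cReD ?cImD; case: (f y).
move=> x; apply/cvgrPdist_lt => e e0.
(* The radius lives in [R[i]]; positivity there forces its imaginary part to vanish. *)
have eE : e = (Re e)%:C.
  by apply: complex_eq => //=; move: e0; rewrite ltcE => /andP[/eqP].
have e0' : 0 < Re e / 2 by rewrite divr_gt0//; rewrite eE ltcR in e0.
have /cvgrPdist_lt/(_ _ e0') h1 := c1 x.
have /cvgrPdist_lt/(_ _ e0') h2 := c2 x.
near=> y; rewrite normE eE ltcR.
apply: le_lt_trans (normc_ReIm _) _.
rewrite [ltRHS](splitr (Re e)); apply: ltrD.
  rewrite cReD (_ : Re (- f y) = - Re (f y)); last by case: (f y).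
  by near: y.
rewrite cImD (_ : Im (- f y) = - Im (f y)); last by case: (f y).
by near: y.
Unshelve. all: by end_near. Qed.

Context (G : topologicalZmodType).
Implicit Types chi psi : G -> R[i].

Lemma character_cst1 : is_character (fun _ : G => 1 : R[i]).
Proof.
split=> [||x]; last by rewrite Normc.normc1.
- by move=> x; exact: cvg_cst.
- by move=> x y; rewrite mulr1.
Qed.

Lemma character_mul chi psi : is_character chi -> is_character psi ->
  is_character (fun x => chi x * psi x).
Proof.
move=> h1 h2; split.
- have /continuous_complexP[a1 a2] := character_continuous h1.
  have /continuous_complexP[b1 b2] := character_continuous h2.
  apply/continuous_complexP; split=> x.
    under eq_fun do rewrite cReM.
    by apply: cvgB; apply: cvgM; [exact: a1|exact: b1|exact: a2|exact: b2].
  under eq_fun do rewrite cImM.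
  by apply: cvgD; apply: cvgM; [exact: a1|exact: b2|exact: a2|exact: b1].
- by move=> x y; rewrite (characterD h1) (characterD h2) mulrACA.
- move=> x; rewrite Normc.normcM (character_unimodular h1).
  by rewrite (character_unimodular h2) mulr1.
Qed.

Lemma character_conj chi : is_character chi ->
  is_character (fun x => conjc (chi x)).
Proof.
move=> h; split.
- have /continuous_complexP[a1 a2] := character_continuous h.
  apply/continuous_complexP; split=> x.
    by under eq_fun do rewrite Re_conjc; exact: a1.
  by under eq_fun do rewrite Im_conjc; apply: cvgN; exact: a2.
- by move=> x y; rewrite (characterD h) rmorphM.
- by move=> x; rewrite normc_conjc (character_unimodular h).
Qed.

Lemma character_exp chi n : is_character chi -> is_character (fun x => chi x ^+ n).
Proof.
move=> h; elim: n => [|n ih]; first exact: character_cst1.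
by under eq_fun do rewrite exprS; exact: character_mul.
Qed.

End characters.

Section borel_group.
Context {R : realType} (G : topologicalZmodType).

Lemma continuous_borel (f : G -> R) : continuous f ->
  measurable_fun setT (f : borel G -> R).
Proof.
move=> /continuousP cf; apply: (measurability _ (RGenOpens.measurableE R)).
move=> _ [_ [a [b ->] <-]]; rewrite setTI; apply: sub_sigma_algebra.
exact/cf/interval_open.
Qed.

Lemma cmeas_character (chi : G -> R[i]) : is_character chi ->
  cmeas (chi : borel G -> R[i]).
Proof.
move=> h; have /continuous_complexP[a1 a2] := character_continuous h.
by split; exact: continuous_borel.
Qed.

Definition gshift (g : G) (x : borel G) : borel G := (g + (x : G))%R.

Lemma measurable_shift g : measurable_fun setT (gshift g).
Proof.
have cs : continuous (fun x : G => g + x).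
  move=> x; apply: (@continuous_comp _ _ _ (fun x : G => (g, x)) (fun z => z.1 + z.2)).
    by apply: cvg_pair; [exact: cvg_cst|exact: cvg_id].
  exact: add_continuous.
apply: (@measurability _ _ (borel G) (borel G) setT (gshift g) (@open G) erefl).
move=> _ [B oB <-]; rewrite setTI; apply: sub_sigma_algebra.
by move/continuousP : cs; apply.
Qed.

HB.instance Definition _ g := @isMeasurableFun.Build _ _ _ _ (gshift g) (measurable_shift g).

Context (mu : probability (borel G) R) (hmu : is_haar mu).

Lemma haar_pushforward g (A : set (borel G)) : measurable A ->
  pushforward mu (gshift g) A = mu A.
Proof. by move=> mA; rewrite /pushforward -[RHS](haar_invariant hmu g mA). Qed.

Lemma ge0_integral_shift g (f : borel G -> \bar R) :
  measurable_fun setT f -> (forall x, 0 <= f x)%E ->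
  (\int[mu]_x f (gshift g x) = \int[mu]_x f x)%E.
Proof.
move=> mf f0.
rewrite -[LHS](@ge0_integral_pushforward _ _ _ _ _ (gshift g) (measurable_shift g) mu setT f)//.
by apply: eq_measure_integral => A mA _; exact: haar_pushforward.
Qed.

Lemma cmeas_shift g (f : borel G -> R[i]) : cmeas f -> cmeas (f \o gshift g).
Proof.
by move=> [f1 f2]; split; [apply: (measurableT_comp f1)|apply: (measurableT_comp f2)];
  exact: measurable_shift.
Qed.

Lemma Rintegral_shift g (f : borel G -> R) : mu.-integrable setT (EFin \o f) ->
  \int[mu]_x f (gshift g x) = \int[mu]_x f x.
Proof.
move=> fi; rewrite /Rintegral; congr fine.
have hi : mu.-integrable setT ((EFin \o f) \o gshift g).
  have /integrableP[mf foo] := fi; apply/integrableP; split.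
    by apply: measurableT_comp => //; exact: measurable_shift.
  have := @ge0_integral_shift g (fun x => `|(EFin \o f) x|%E).
  by move=> /= ->//; exact: (measurableT_comp (@abse_measurable _ _) mf).
have mf : measurable_fun setT (EFin \o f) by exact: measurable_int fi.
have := integral_pushforward (measurable_shift g) mf hi measurableT.
rewrite preimage_setT => <-.
by apply: eq_measure_integral => A mA _; rewrite /= -[RHS](haar_pushforward g mA).
Qed.

Lemma cint_shift g (f : borel G -> R[i]) : cintegrable mu f ->
  cint mu (f \o gshift g) = cint mu f.
Proof.
move=> fi; apply: complex_eq => /=.
  exact: (Rintegral_shift g (f := fun x => Re (f x)) (cintegrable_Re fi)).
exact: (Rintegral_shift g (f := fun x => Im (f x)) (cintegrable_Im fi)).
Qed.

Lemma cintegrable_bounded (f : borel G -> R[i]) (M : R) : cmeas f ->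
  (forall x, normc (f x) <= M) -> cintegrable mu f.
Proof.
move=> mf fM; split=> //.
apply: (@le_lt_trans _ _ (\int[mu]_x M%:E)%E).
  apply: ge0_le_integral => //.
  - by move=> x _; rewrite lee_fin normc_ge0.
  - by apply/measurable_EFinP; exact: measurable_normc.
  - by move=> x _; rewrite lee_fin.
rewrite integral_cst// [X in (_ * X)%E](_ : _ = 1%E) ?mule1 ?ltry//.
exact: probability_setT.
Qed.

Lemma cintegrable_character (chi : G -> R[i]) : is_character chi ->
  cintegrable mu chi.
Proof.
move=> h; apply: (cintegrable_bounded (M := 1)); first exact: cmeas_character.
by move=> x; rewrite (character_unimodular h).
Qed.

(** Invariance under translation by [g] turns the integral I into chi(g) I, so I = 0 if some chi(g)
    differs from 1. *)
Lemma cint_character (chi : G -> R[i]) : is_character chi ->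
  cint mu chi = (`[< chi = fun=> 1 >])%:R.
Proof.
move=> h; have [->|ne] := asboolP.
  rewrite /cint /= !Rintegral_cst// [X in fine X](_ : _ = 1%E) ?mul0r ?mulr1//.
  exact: probability_setT.
have [g gne] : exists g, chi g != 1.
  apply: contrapT => /forallNP e; apply: ne; apply/funext => x.
  by apply/eqP; apply: contrapT => /negP; exact: e.
have := cint_shift g (cintegrable_character h).
rewrite (_ : chi \o _ = fun x => chi g * chi x); last first.
  by apply/funext => x; exact: (characterD h).
rewrite cintZ; last exact: cintegrable_character.
move/eqP; rewrite -subr_eq0 -[X in _ - X]mul1r -mulrBl mulf_eq0 subr_eq0.
by rewrite (negbTE gne) => /eqP.
Qed.

Lemma cint_character_mul (chi psi : G -> R[i]) : is_character chi ->
  is_character psi ->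
  cint mu (fun x => chi x * conjc (psi x)) = (`[< chi = psi >])%:R.
Proof.
move=> h1 h2; rewrite cint_character; last first.
  by apply: character_mul => //; exact: character_conj.
congr (nat_of_bool _)%:R; apply: asbool_equiv_eq; split=> [e|->].
  apply/funext => x; have /(congr1 (fun f => f x * psi x)) := e.
  rewrite mul1r -mulrA (mulrC (conjc _)) mulc_conj.
  by rewrite (character_unimodular h2) expr1n mulr1.
apply/funext => x; rewrite mulc_conj.
by rewrite (character_unimodular h2) expr1n.
Qed.
End borel_group.

(** * Balls of L_p and their interpolation *)

Section power_inequalities.
Context {R : realType}.
Implicit Types (u v a b p : R).

Lemma weighted_amgm u v a b : 0 <= u -> 0 <= v -> 0 < a -> 0 < b ->
  a + b = 1 -> u `^ a * v `^ b <= a * u + b * v.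
Proof.
move=> u0 v0 a0 b0 ab.
have := @conjugate_powR _ (u `^ a) (v `^ b) a^-1 b^-1.
rewrite !powR_ge0 !invr_gt0 !invrK a0 b0 ab => /(_ isT isT isT isT erefl).
rewrite -!powRrM !mulfV ?gt_eqF// !powRr1//.
by rewrite (mulrC u) (mulrC v).
Qed.

(** The graph of t^p lies above its tangent at [A]; this is that inequality solved for [g]. *)
Lemma powR_tangent g A p : 0 <= g -> 0 < A -> 1 <= p ->
  g <= A / p * A `^ (- p) * g `^ p + A * (1 - p^-1).
Proof.
move=> g0 A0; rewrite le_eqVlt => /predU1P[<-|p1].
  rewrite invr1 subrr mulr0 addr0 mulr1 powRN !powRr1 ?(ltW A0)//.
  by rewrite mulfV ?gt_eqF// mul1r.
have p0 : 0 < p by exact: lt_trans p1.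
have := @weighted_amgm ((g / A) `^ p) 1 p^-1 (1 - p^-1).
rewrite powR_ge0 invr_gt0 p0 subr_gt0 invf_lt1// p1 subrKC ler01.
move=> /(_ isT isT isT isT erefl).
rewrite -powRrM mulfV ?gt_eqF// powRr1 ?divr_ge0 ?(ltW A0)//.
rewrite powR1 !mulr1 ler_pdivrMr// => h; apply: (le_trans h).
rewrite powRM ?invr_ge0 ?(ltW A0)// -(powR_inv1 (ltW A0)) -powRrM mulN1r.
by rewrite le_eqVlt; apply/orP; left; apply/eqP; ring.
Qed.
End power_inequalities.

(** * Jensen's inequality for powers *)

Section jensen.
Context d (T : measurableType d) (R : realType) (mu : {measure set T -> \bar R}).

Lemma ge0_le_integralT (f g : T -> R) :
  (forall x, 0 <= f x) -> measurable_fun setT f -> measurable_fun setT g ->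
  (forall x, f x <= g x) ->
  (\int[mu]_x (f x)%:E <= \int[mu]_x (g x)%:E)%E.
Proof.
move=> f0 mf mg fg; apply: ge0_le_integral => //.
- by move=> x _; rewrite lee_fin.
- exact/measurable_EFinP.
- exact/measurable_EFinP.
- by move=> x _; rewrite lee_fin.
Qed.

Lemma measurable_powRl (g : T -> R) (p : R) : measurable_fun setT g ->
  measurable_fun setT (fun x => g x `^ p).
Proof. by move=> mg; apply: (measurableT_comp (measurable_powR p)). Qed.

Lemma ge0_integral_lincomb (f g : T -> R) (a b : R) : 0 <= a -> 0 <= b ->
  (forall x, 0 <= f x) -> (forall x, 0 <= g x) ->
  measurable_fun setT f -> measurable_fun setT g ->
  (\int[mu]_x (a * f x + b * g x)%:E =
   a%:E * \int[mu]_x (f x)%:E + b%:E * \int[mu]_x (g x)%:E)%E.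
Proof.
move=> a0 b0 f0 g0 mf mg; rewrite -!ge0_integralZl//; first 1 last.
- exact/measurable_EFinP.
- by move=> x _; rewrite lee_fin.
- exact/measurable_EFinP.
- by move=> x _; rewrite lee_fin.
rewrite -ge0_integralD//.
- by move=> x _; rewrite -EFinM lee_fin mulr_ge0.
- by apply/measurable_EFinP; exact: measurable_funM.
- by move=> x _; rewrite -EFinM lee_fin mulr_ge0.
- by apply/measurable_EFinP; exact: measurable_funM.
Qed.

(** The tangent inequality at [A] is integrated against [w]. Mass at most one suffices for [w]
    because the constant term A (1 - 1/p) is non-negative. *)
Lemma jensen_powR (g w : T -> R) (p A : R) :
  measurable_fun setT g -> measurable_fun setT w ->
  (forall x, 0 <= g x) -> (forall x, 0 <= w x) -> 1 <= p -> 0 <= A ->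
  (\int[mu]_x (w x)%:E <= 1)%E ->
  (\int[mu]_x (g x `^ p * w x)%:E <= (A `^ p)%:E)%E ->
  (\int[mu]_x (g x * w x)%:E <= A%:E)%E.
Proof.
move=> mg mw g0 w0 p1 A0 w1 hA.
have p0 : 0 < p by exact: lt_le_trans p1.
(* The tangent point has to be positive, so [A] is replaced by A + e. *)
suff main B : 0 < B -> (\int[mu]_x (g x `^ p * w x)%:E <= (B `^ p)%:E)%E ->
    (\int[mu]_x (g x * w x)%:E <= B%:E)%E.
  apply/lee_addgt0Pr => e e0; rewrite -EFinD; apply: main.
    by rewrite ltr_wpDl.
  apply: (le_trans hA); rewrite lee_fin ge0_ler_powR ?nnegrE ?(ltW p0)//.
    by rewrite addr_ge0// ltW.
  by rewrite lerDl ltW.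
move=> {hA} B0 hB; pose c := B / p * B `^ (- p).
have c0 : 0 <= c by rewrite mulr_ge0 ?divr_ge0 ?powR_ge0 ?ltW.
have b0 : 0 <= B * (1 - p^-1).
  by rewrite mulr_ge0 ?(ltW B0)// subr_ge0 invf_le1.
apply: (@le_trans _ _ (\int[mu]_x (c * (g x `^ p * w x) + B * (1 - p^-1) * w x)%:E)%E).
  apply: ge0_le_integralT => [x|||x]; first by rewrite mulr_ge0.
  - exact: measurable_funM.
  - apply: measurable_funD; apply: measurable_funM => //.
    by apply: measurable_funM => //; exact: measurable_powRl.
  - rewrite mulrA -mulrDl ler_wpM2r//; exact: powR_tangent.
rewrite ge0_integral_lincomb//; last first.
- by apply: measurable_funM => //; exact: measurable_powRl.
- by move=> x; rewrite mulr_ge0// powR_ge0.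
apply: (@le_trans _ _ (c%:E * (B `^ p)%:E + (B * (1 - p^-1))%:E * 1)%E).
  by apply: leeD; apply: lee_wpmul2l; rewrite ?lee_fin.
rewrite mule1 -EFinM -EFinD lee_fin /c -(mulrA (B / p)) -powRD; last first.
  by rewrite (gt_eqF B0) implybT.
by rewrite addNr powRr0 mulr1 mulrBr mulr1 subrKC.
Qed.

End jensen.

Section Lball.
Context d (T : measurableType d) (R : realType) (mu : probability T R).
Implicit Types (f g : T -> R[i]) (p : \bar R) (M : R).

(* A predicate rather than a real-valued norm, which would need a junk value
   outside L_p. *)
Definition Lball (p : \bar R) (M : R) (f : T -> R[i]) : Prop :=
  cmeas f /\ (Lnorm mu p (fun x => (normc (f x))%:E) <= M%:E)%E.

Lemma Lnorm_finP (p M : R) f : 1 <= p -> 0 <= M ->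
  (Lnorm mu p%:E (fun x => (normc (f x))%:E) <= M%:E)%E <->
  (\int[mu]_x (normc (f x) `^ p)%:E <= (M `^ p)%:E)%E.
Proof.
move=> p1 M0; have p0 : 0 < p by exact: lt_le_trans p1.
have pn0 : p != 0 by rewrite gt_eqF.
rewrite unlock.
under eq_integral do rewrite /= (ger0_norm (normc_ge0 _)).
set I := (\int[mu]_x _)%E.
have I0 : (0 <= I)%E by apply: integral_ge0 => x _; rewrite lee_fin powR_ge0.
have Iin : I \in `[0, +oo]%E by rewrite in_itv/= I0 leey.
split=> h.
  have /= := @gt0_ler_poweR R p (ltW p0) (poweR I p^-1) M%:E.
  rewrite !in_itv/= poweR_ge0 !leey lee_fin M0 => /(_ isT isT h).
  by rewrite -poweRrM mulVf// poweRe1.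
have /= := @gt0_ler_poweR R p^-1 (ltW _) I (M `^ p)%:E.
rewrite !in_itv/= I0 !leey lee_fin powR_ge0 invr_gt0 => /(_ p0 isT isT h).
by rewrite -powRrM mulfV// powRr1.
Qed.

Lemma Lnorm_inftyP M f : 
  (Lnorm mu +oo (fun x => (normc (f x))%:E) <= M%:E)%E <->
  {ae mu, forall x, normc (f x) <= M}.
Proof.
rewrite unlock (_ : (0 < mu setT)%E); last by rewrite probability_setT lte01.
split=> [/ess_supP|h].
  by apply: filterS => x /=; rewrite lee_fin (ger0_norm (normc_ge0 _)).
by apply/ess_supP; apply: filterS h => x /=; rewrite lee_fin (ger0_norm (normc_ge0 _)).
Qed.

Lemma Lball_bounded p M f : (1 <= p)%E -> 0 <= M -> cmeas f ->
  (forall x, normc (f x) <= M) -> Lball p M f.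
Proof.
move=> p1 M0 mf fM; split=> //; case: p p1 => [p| |//]; rewrite ?lee_fin => p1.
  have p0 : 0 < p by exact: lt_le_trans p1.
  apply/Lnorm_finP => //.
  apply: (@le_trans _ _ (\int[mu]_x (M `^ p)%:E)%E).
    apply: ge0_le_integralT => [x|||x]; first exact: powR_ge0.
    - by apply: measurable_powRl; exact: measurable_normc.
    - exact: measurable_cst.
    - by rewrite ge0_ler_powR ?nnegrE ?normc_ge0// ltW.
  rewrite integral_cst// [X in (_ * X)%E](_ : _ = 1%E) ?mule1//.
  exact: probability_setT.
by apply/Lnorm_inftyP; exact: aeW.
Qed.

Lemma LballS p M M' f : M <= M' -> Lball p M f -> Lball p M' f.
Proof. by move=> MM [mf h]; split=> //; apply: (le_trans h); rewrite lee_fin. Qed.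

Lemma Lball_norm p M f g : cmeas g -> (forall x, normc (g x) = normc (f x)) ->
  Lball p M f -> Lball p M g.
Proof. by move=> mg fg [mf h]; split=> //; under eq_Lnorm do rewrite fg. Qed.

Lemma Lball_scale p M f (c : R[i]) : (1 <= p)%E -> 0 <= M ->
  Lball p M f -> Lball p (normc c * M) (fun x => c * f x).
Proof.
move=> p1 M0 [mf h]; split; first by apply: cmeasM => //; exact: cmeas_cst.
case: p p1 h => [p| |//]; rewrite ?lee_fin => p1.
  have p0 : 0 < p by exact: lt_le_trans p1.
  move=> /(Lnorm_finP _ p1 M0) h; apply/Lnorm_finP => //.
    by rewrite mulr_ge0// normc_ge0.
  under eq_integral do rewrite Normc.normcM powRM ?normc_ge0// EFinM.
  rewrite ge0_integralZl//; first last.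
  - by rewrite lee_fin powR_ge0.
  - by move=> x _; rewrite lee_fin powR_ge0.
  - by apply/measurable_EFinP; apply: measurable_powRl; exact: measurable_normc.
  by rewrite powRM ?normc_ge0// EFinM lee_wpmul2l// lee_fin powR_ge0.
move=> /Lnorm_inftyP h; apply/Lnorm_inftyP; apply: filterS h => x h.
by rewrite Normc.normcM ler_wpM2l// normc_ge0.
Qed.

Lemma powR_half (p a b : R) : 1 <= p -> 0 <= a -> 0 <= b ->
  (2^-1 * (a + b)) `^ p <= 2^-1 * (a `^ p) + 2^-1 * (b `^ p).
Proof.
move=> p1 a0 b0.
have h0 : (0 : R) <= 2^-1 by [].
have h1 : (2^-1 : R) <= 1 by rewrite invf_le1// ler1n.
have := @convex_powR R p p1 (Itv01 h0 h1) a b.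
rewrite !inE/= !in_itv/= a0 b0 => /(_ isT isT).
have e : unstable.onem (2^-1 : R) = 2^-1 by rewrite /unstable.onem; lra.
rewrite convRE/= e => h; apply: (le_trans _ h).
rewrite le_eqVlt; apply/orP; left; apply/eqP; congr (_ `^ _).
transitivity (2^-1 * a + unstable.onem 2^-1 * b); first by rewrite e mulrDr.
by [].
Qed.

(** The midpoint case of Minkowski's inequality is what a cosine multiplier, an average of two
    translates, requires. *)
Lemma Lball_half p M f g : (1 <= p)%E -> 0 <= M ->
  Lball p M f -> Lball p M g -> Lball p M (fun x => (2^-1)%:C * (f x + g x)).
Proof.
move=> p1 M0 [mf hf] [mg hg]; split.
  by apply: cmeasM; [exact: cmeas_cst|exact: cmeasD].
have hn x : normc ((2^-1)%:C * (f x + g x)) <= 2^-1 * (normc (f x) + normc (g x)).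
  by rewrite normc_realM ger0_norm// ler_wpM2l// normcD.
case: p p1 hf hg => [p| |//]; rewrite ?lee_fin => p1.
  have p0 : 0 < p by exact: lt_le_trans p1.
  move=> /(Lnorm_finP _ p1 M0) hf /(Lnorm_finP _ p1 M0) hg; apply/Lnorm_finP => //.
  apply: (@le_trans _ _ (\int[mu]_x (2^-1 * normc (f x) `^ p + 2^-1 * normc (g x) `^ p)%:E)%E).
    apply: ge0_le_integralT => [x|||x]; first exact: powR_ge0.
    - apply: measurable_powRl; apply: measurable_normc.
      by apply: cmeasM; [exact: cmeas_cst|exact: cmeasD].
    - by apply: measurable_funD; apply: measurable_funM => //;
       apply: measurable_powRl; exact: measurable_normc.
    - apply: (le_trans _ (powR_half p1 (normc_ge0 _) (normc_ge0 _))).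
      rewrite ge0_ler_powR ?nnegrE ?normc_ge0 ?(ltW p0)//.
      by rewrite mulr_ge0// addr_ge0// normc_ge0.
  rewrite ge0_integral_lincomb//; first last.
  - by apply: measurable_powRl; exact: measurable_normc.
  - by apply: measurable_powRl; exact: measurable_normc.
  - by move=> x; exact: powR_ge0.
  - by move=> x; exact: powR_ge0.
  apply: (@le_trans _ _ ((2^-1)%:E * (M `^ p)%:E + (2^-1)%:E * (M `^ p)%:E)%E).
    by apply: leeD; apply: lee_wpmul2l; rewrite ?lee_fin.
  by rewrite -EFinM -EFinD lee_fin -mulrDl -{1 2}[2^-1]div1r -splitr mul1r.
move=> /Lnorm_inftyP hf /Lnorm_inftyP hg; apply/Lnorm_inftyP.
apply: filterS2 hf hg => x hf hg; apply: (le_trans (hn x)).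
by rewrite ler_pdivrMl// mulrDl mul1r lerD.
Qed.

Lemma cvg_powR (u : nat -> R) (a p : R) : 0 < p -> (forall k, 0 <= u k) ->
  u k @[k --> \oo] --> a -> u k `^ p @[k --> \oo] --> a `^ p.
Proof.
move=> p0 u0 ua.
have : 0 <= a by apply: (cvgr_to_ge ua); exact: nearW.
rewrite le_eqVlt => /predU1P[a0|a0].
  rewrite -a0 powR0 ?gt_eqF//; rewrite -a0 in ua.
  apply/cvgrPdist_lt => e e0.
  have e1 : 0 < e `^ p^-1 by exact: powR_gt0.
  have /cvgrPdist_lt/(_ _ e1) := ua.
  apply: filterS => k; rewrite !sub0r !normrN !ger0_norm ?powR_ge0// => h.
  have := gt0_ltr_powR p0 (_ : u k \in Num.nneg) (_ : e `^ p^-1 \in Num.nneg) h.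
  by rewrite -powRrM mulVf ?gt_eqF// (powRr1 (ltW e0)); apply; rewrite nnegrE ?powR_ge0.
apply: (cvg_comp u (fun y => y `^ p) ua).
suff: {for a, continuous (fun y : R => y `^ p)} by [].
apply: differentiable_continuous; apply/derivable1_diffP.
by apply: derivable_powR; rewrite in_itv/= andbT.
Qed.

(** Fatou's lemma for finite [p]; for [p = +oo] the countably many exceptional null sets are
    united. *)
Lemma Lball_lim p M (F : nat -> T -> R[i]) f : (1 <= p)%E -> 0 <= M -> cmeas f ->
  (forall k, Lball p M (F k)) ->
  (forall x, normc (F k x) @[k --> \oo] --> normc (f x)) ->
  Lball p M f.
Proof.
move=> p1 M0 mf hF hlim; split=> //.
case: p p1 hF => [p| |//]; rewrite ?lee_fin => p1 hF.
  have p0 : 0 < p by exact: lt_le_trans p1.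
  apply/Lnorm_finP => //.
  have mF k : measurable_fun setT (fun x => (normc (F k x) `^ p)%:E).
    by apply/measurable_EFinP; apply: measurable_powRl; apply: measurable_normc; case: (hF k).
  have F0 k x : setT x -> (0 <= (normc (F k x) `^ p)%:E)%E by rewrite lee_fin powR_ge0.
  have := fatou mu measurableT mF F0.
  have cvp x : (normc (F k x) `^ p)%:E @[k --> \oo] --> (normc (f x) `^ p)%:E.
    apply: cvg_EFin; first exact: nearW.
    by apply: cvg_powR => // k; exact: normc_ge0.
  under eq_integral do rewrite (cvg_limn_einf_sup (cvp _)).1.
  move=> h; apply: (le_trans h); rewrite limn_einf_lim.
  apply: lime_le; first exact: is_cvg_einfs.
  apply: nearW => n; apply: (@le_trans _ _ ((\int[mu]_x (normc (F n x) `^ p)%:E)%E)).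
    by apply: ereal_inf_lbound; exists n => /=.
  by apply/Lnorm_finP => //; case: (hF n).
apply/Lnorm_inftyP.
have : {ae mu, forall x, forall k, normc (F k x) <= M}.
  by apply: ae_foralln => k; apply/Lnorm_inftyP; case: (hF k).
apply: filterS => x h; apply: (cvgr_to_le (hlim x)); exact: nearW.
Qed.

Lemma ae_integral_bound (h : T -> R) (M : R) : 0 <= M -> measurable_fun setT h ->
  (forall x, 0 <= h x) -> {ae mu, forall x, h x <= M} ->
  (\int[mu]_x (h x)%:E <= M%:E)%E.
Proof.
move=> M0 mh h0 hM; apply: (@le_trans _ _ (\int[mu]_x M%:E)%E).
  apply: ae_ge0_le_integral => //.
  - by move=> x _; rewrite lee_fin.
  - exact/measurable_EFinP.
  - by apply: filterS hM => x hx _; rewrite lee_fin.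
rewrite integral_cst// [X in (_ * X)%E](_ : _ = 1%E) ?mule1//.
exact: probability_setT.
Qed.

(** Jensen's inequality with exponent q/p and weight 1; total mass one keeps the radius
    unchanged. *)
Lemma Lball_le p q M f : (1 <= p)%E -> (p <= q)%E -> 0 <= M ->
  Lball q M f -> Lball p M f.
Proof.
move=> p1 pq M0 [mf hf]; split=> //; have mn := measurable_normc mf.
case: p p1 pq => [p| |//]; last by rewrite leye_eq => _ /eqP q_oo; rewrite -q_oo.
rewrite lee_fin => p1; have p0 : 0 < p by exact: lt_le_trans p1.
case: q hf => [q| |//]; last first.
  move=> /Lnorm_inftyP hf _; apply/Lnorm_finP => //.
  apply: ae_integral_bound; first exact: powR_ge0.
  - exact: measurable_powRl.
  - by move=> x; exact: powR_ge0.
  - by apply: filterS hf => x h; rewrite ge0_ler_powR ?nnegrE ?normc_ge0// ltW.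
move=> + pq; rewrite lee_fin in pq; have q1 : 1 <= q by exact: le_trans pq.
move=> /(Lnorm_finP _ q1 M0) hf; apply/Lnorm_finP => //.
have -> : (\int[mu]_x (normc (f x) `^ p)%:E =
    \int[mu]_x (normc (f x) `^ p * cst 1 x)%:E)%E.
  by apply: eq_integral => x _; rewrite /= mulr1.
apply: (@jensen_powR _ _ _ _ _ _ (q / p)) => //.
- exact: measurable_powRl.
- by move=> x; exact: powR_ge0.
- by rewrite ler_pdivlMr// mul1r.
- exact: powR_ge0.
- by apply: (@ae_integral_bound (cst 1)) => //; exact: aeW.
rewrite -powRrM mulrCA mulfV ?gt_eqF// mulr1; apply: le_trans hf.
rewrite le_eqVlt; apply/orP; left; apply/eqP; apply: eq_integral => x _.
by rewrite /= mulr1 -powRrM mulrCA mulfV ?mulr1// gt_eqF.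
Qed.

(** Lyapunov's inequality. For finite q, the weighted AM-GM inequality is applied pointwise to
    (|f|/A)^p and (|f|/B)^q and then integrated; the weights [a] and [b] below add up to one by the
    relation between p, q and r. For q = oo, |f|^r <= B^(r-p) |f|^p almost everywhere. The real [qi]
    stands for 1/q, which is 0 at q = oo. *)
Lemma Lball_interp (p r : R) (q : \bar R) (qi th A B : R) f :
  1 <= p -> p < r -> (r%:E < q)%E -> (q^-1 = qi%:E)%E ->
  0 < th < 1 -> r^-1 = th * p^-1 + (1 - th) * qi ->
  0 < A -> 0 < B -> Lball p%:E A f -> Lball q B f ->
  Lball r%:E (A `^ th * B `^ (1 - th)) f.
Proof.
move=> p1 pr rq qiE /andP[th0 th1] rE A0 B0 [mf hA] [_ hB]; split=> //.
have p0 : 0 < p by exact: lt_le_trans p1.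
have r0 : 0 < r by exact: lt_trans pr.
have r1 : 1 <= r by exact/ltW/(le_lt_trans p1).
have K0 : 0 <= A `^ th * B `^ (1 - th) by rewrite mulr_ge0// powR_ge0.
have th1' : 0 < 1 - th by rewrite subr_gt0.
have mn := measurable_normc mf.
move: hA => /(Lnorm_finP _ p1 (ltW A0)) hA; apply/Lnorm_finP => //.
set K := _ * _ in K0 *.
case: q rq qiE hB => [q| |//]; last first.
  move=> _ qi0 /Lnorm_inftyP hB; rewrite invey in qi0; case: qi0 => qi0.
  rewrite -qi0 mulr0 addr0 in rE.
  have thE : th * r = p.
    by apply: (mulIf (lt0r_neq0 (_ : 0 < p^-1))); rewrite ?invr_gt0// mulrAC -rE mulVf ?mulfV ?gt_eqF.
  have th'E : (1 - th) * r = r - p by rewrite mulrBl mul1r thE.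
  have KE : K `^ r = A `^ p * B `^ (r - p).
    by rewrite powRM ?powR_ge0// -!powRrM thE th'E.
  (* The summand [0 * 0] brings the integrand into the form of [ge0_integral_lincomb]. *)
  apply: (@le_trans _ _ (\int[mu]_x (B `^ (r - p) * normc (f x) `^ p + 0 * 0)%:E)%E).
    apply: ae_ge0_le_integral => //.
    - by move=> x _; rewrite lee_fin powR_ge0.
    - by apply/measurable_EFinP; exact: measurable_powRl.
    - by move=> x _; rewrite lee_fin mulr0 addr0 mulr_ge0 ?powR_ge0.
    - apply/measurable_EFinP; apply: measurable_funD => //.
      by apply: measurable_funM => //; exact: measurable_powRl.
    - apply: filterS hB => x h _; rewrite lee_fin mulr0 addr0.
      have -> : normc (f x) `^ r = normc (f x) `^ (r - p) * normc (f x) `^ p.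
        by rewrite -powRD subrK// (gt_eqF r0).
      rewrite ler_wpM2r ?powR_ge0//.
      by rewrite ge0_ler_powR ?nnegrE ?normc_ge0 ?subr_ge0 ?(ltW B0) ?(ltW pr).
  rewrite (ge0_integral_lincomb mu (f := fun x => normc (f x) `^ p) (g := cst 0))//.
  - rewrite mul0e adde0 KE mulrC EFinM lee_wpmul2l// lee_fin; exact: powR_ge0.
  - exact: powR_ge0.
  - by move=> x; exact: powR_ge0.
  - exact: measurable_powRl.
move=> rq qE hB; rewrite lte_fin in rq.
have q0 : 0 < q by exact: lt_trans rq.
have q1 : 1 <= q by exact/ltW/(le_lt_trans r1).
rewrite inver (gt_eqF q0) in qE; case: qE => qE.
move: hB => /(Lnorm_finP _ q1 (ltW B0)) hB.
pose a := r * th / p; pose b := r * (1 - th) / q.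
have a0 : 0 < a by rewrite divr_gt0// mulr_gt0.
have b0 : 0 < b by rewrite divr_gt0// mulr_gt0.
have ab : a + b = 1.
  by rewrite /a /b -!mulrA -mulrDr qE -rE mulfV// gt_eqF.
have pa : p * a = th * r by rewrite /a mulrCA mulfV ?gt_eqF// mulr1 mulrC.
have qb : q * b = (1 - th) * r by rewrite /b mulrCA mulfV ?gt_eqF// mulr1 mulrC.
clearbody a b.
have pw (x : R) : 0 <= x -> x `^ r <=
    K `^ r * a * A `^ (- p) * x `^ p + K `^ r * b * B `^ (- q) * x `^ q.
  move=> x0.
  have := @weighted_amgm _ ((x / A) `^ p) ((x / B) `^ q) a b.
  rewrite !powR_ge0 => /(_ isT isT a0 b0 ab).
  move=> /(ler_wpM2l (powR_ge0 K r)).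
  rewrite -!powRrM pa qb /K !(powRM _ x0) ?invr_ge0 ?(ltW A0) ?(ltW B0)//.
  rewrite powRM ?powR_ge0// -!(powR_inv1 (ltW A0)) -!(powR_inv1 (ltW B0)) -!powRrM !mulN1r.
  rewrite (_ : A `^ (th * r) * B `^ ((1 - th) * r) *
    (x `^ (th * r) * A `^ (- (th * r)) * (x `^ ((1 - th) * r) * B `^ (- ((1 - th) * r)))) = x `^ r).
    by move=> h; apply: (le_trans h); rewrite le_eqVlt; apply/orP; left; apply/eqP; ring.
  rewrite (_ : x `^ r = x `^ (th * r) * x `^ ((1 - th) * r)); last first.
    rewrite -powRD; first by rewrite -mulrDl subrKC mul1r.
    by rewrite -mulrDl subrKC mul1r (gt_eqF r0).
  rewrite !powRN; field.
  by rewrite !gt_eqF ?powR_gt0.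
have cA : 0 <= K `^ r * a * A `^ (- p).
  by apply: mulr_ge0; [apply: mulr_ge0; [exact: powR_ge0|exact: ltW]|exact: powR_ge0].
have cB : 0 <= K `^ r * b * B `^ (- q).
  by apply: mulr_ge0; [apply: mulr_ge0; [exact: powR_ge0|exact: ltW]|exact: powR_ge0].
apply: (@le_trans _ _ (\int[mu]_x (K `^ r * a * A `^ (- p) * normc (f x) `^ p +
   K `^ r * b * B `^ (- q) * normc (f x) `^ q)%:E)%E).
  apply: ge0_le_integralT => [x|||x]; first exact: powR_ge0.
  - exact: measurable_powRl.
  - by apply: measurable_funD; apply: measurable_funM => //; exact: measurable_powRl.
  - exact/pw/normc_ge0.
rewrite ge0_integral_lincomb//; first last.
- exact: measurable_powRl.
- exact: measurable_powRl.
- by move=> x; exact: powR_ge0.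
- by move=> x; exact: powR_ge0.
apply: (@le_trans _ _ ((K `^ r * a * A `^ (- p))%:E * (A `^ p)%:E +
   (K `^ r * b * B `^ (- q))%:E * (B `^ q)%:E)%E).
  by apply: leeD; apply: lee_wpmul2l; rewrite ?lee_fin.
rewrite -!EFinM -EFinD lee_fin !powRN -!mulrA !mulVf ?gt_eqF ?powR_gt0//.
by rewrite !mulr1 -mulrDr ab mulr1.
Qed.

End Lball.

(** * Gaussian multipliers *)

Section gaussian_limit.
Context {R : realType}.
Implicit Types (v z a b : R).

Lemma norm_exprB a b n : `|a| <= 1 -> `|b| <= 1 ->
  `|a ^+ n - b ^+ n| <= n%:R * `|a - b|.
Proof.
move=> a1 b1; elim: n => [|n ih]; first by rewrite subrr normr0 mul0r.
rewrite !exprS (_ : _ - _ = a * (a ^+ n - b ^+ n) + (a - b) * b ^+ n); last by ring.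
apply: (le_trans (ler_normD _ _)); rewrite -[in leRHS]natr1 [leRHS]mulrDl [in leRHS]mul1r; apply: lerD.
  by rewrite normrM; apply: le_trans ih; rewrite ler_piMl.
by rewrite normrM normrX ler_piMr// exprn_ile1.
Qed.

Lemma norm_expRN_sub z : 0 <= z -> `|1 - z - expR (- z)| <= z ^+ 2.
Proof.
move=> z0; rewrite distrC ger0_norm; last first.
  by rewrite subr_ge0; exact: expR_ge1Dx.
have h : expR (- z) <= (1 + z)^-1.
  by rewrite expRN lef_pV2 ?posrE ?expR_gt0 ?expR_ge1Dx// ltr_pwDl.
apply: (@le_trans _ _ ((1 + z)^-1 - (1 - z))); first by rewrite lerD2r.
have z1 : 0 < 1 + z by rewrite ltr_pwDl.
rewrite -(ler_pM2r z1) mulrBl mulVf ?gt_eqF//.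
rewrite (_ : 1 - _ = z ^+ 2); last by ring.
by rewrite ler_peMr ?sqr_ge0// lerDl.
Qed.

Lemma cvg_half_pow : ((2 ^+ m)^-1 : R) @[m --> \oo] --> 0.
Proof.
under eq_fun do rewrite -exprVn; apply: cvg_expr.
by rewrite ger0_norm// invf_lt1// ltr1n.
Qed.

Lemma cvg_sin_quotient v :
  (2 ^+ m * sin (v / 2 ^+ m) : R) @[m --> \oo] --> v.
Proof.
have [->|v0] := eqVneq v 0.
  by under eq_fun do rewrite mul0r sin0 mulr0; exact: cvg_cst.
have [/cvg_ex[/= l hl] d2] := is_derive_sin (0 : R).
have le : l = 1 by rewrite -cos0 -d2; apply/esym/cvg_lim.
rewrite {}le in hl.
pose u m : R := v / 2 ^+ m.
have un0 m : u m != 0 by rewrite mulf_neq0// invr_neq0// expf_neq0.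
have u0 : u m @[m --> \oo] --> 0.
  by rewrite -[X in _ --> X](mulr0 v); apply: cvgMl_tmp; exact: cvg_half_pow.
have /cvgr_dnbhsP/(_ u (conj un0 u0)) h := hl.
have h1 : ((u m)^-1 * sin (u m) : R) @[m --> \oo] --> (1 : R).
  apply: cvg_trans h; apply: near_eq_cvg; apply: nearW => m /=.
  by rewrite addr0 sin0 subr0 [u m *: 1]mulr1.
have h2 : (v * ((u m)^-1 * sin (u m)) : R) @[m --> \oo] --> v.
  by rewrite -[X in _ --> X]mulr1; exact: cvgMl_tmp.
apply: cvg_trans h2.
apply: near_eq_cvg; apply: nearW => m /=.
by rewrite /u invf_div mulrA mulrCA mulfV// mulr1.
Qed.

(** The central limit theorem for 4^m fair steps of size 2^{-m}. With z = w_m / 4^m one has cos (v /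
    2^m) = 1 - z, and the 4^m-th powers of 1 - z and e^{-z} differ by at most 4^m z^2 = w_m^2 /
    4^m. *)
Lemma cvg_cos_gauss v :
  (cos (v / 2 ^+ m) ^+ (4 ^ m)%N : R) @[m --> \oo] --> expR (- (v ^+ 2 / 2)).
Proof.
(* By the half-angle formula this is 4^m (1 - cos (v / 2^m)); it tends to v^2 / 2. *)
pose w m : R := 2 * (2 ^+ m * sin (v / 2 / 2 ^+ m)) ^+ 2.
have hw : w m @[m --> \oo] --> v ^+ 2 / 2.
  rewrite (_ : v ^+ 2 / 2 = 2 * (v / 2) ^+ 2); last by field.
  apply: cvgMl_tmp; rewrite expr2; under eq_fun do rewrite expr2.
  by apply: cvgM; exact: cvg_sin_quotient.
have he : expR (- w m) @[m --> \oo] --> expR (- (v ^+ 2 / 2)).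
  by apply: continuous_cvg; [exact: continuous_expR|exact: cvgN].
have h4 : ((4 ^+ m)^-1 : R) @[m --> \oo] --> 0.
  under eq_fun do rewrite -exprVn; apply: cvg_expr.
  by rewrite ger0_norm// invf_lt1// ltr1n.
have cosE m : cos (v / 2 ^+ m) = 1 - w m / 4 ^+ m.
  rewrite (_ : v / 2 ^+ m = (v / 2 / 2 ^+ m) *+ 2); last first.
    by rewrite -[RHS]mulr_natr -mulrA (mulrC _^-1) mulrA divfK.
  have -> : (4 ^+ m : R) = (2 ^+ m) ^+ 2 by rewrite -exprM mulnC exprM; congr (_ ^+ m); ring.
  rewrite cos_mulr2n cos2sin2 /w; field.
  by rewrite expf_neq0.
have key m : `|cos (v / 2 ^+ m) ^+ (4 ^ m)%N - expR (- w m)| <= w m ^+ 2 * (4 ^+ m)^-1.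
  have z0 : 0 <= w m / 4 ^+ m by rewrite divr_ge0// mulr_ge0// sqr_ge0.
  have -> : expR (- w m) = expR (- (w m / 4 ^+ m)) ^+ (4 ^ m)%N.
    rewrite -expRM_natl natrX mulrN mulrCA mulfV ?mulr1// expf_neq0//.
  apply: (le_trans (norm_exprB _ _ _)).
  - exact: cos_max.
  - by rewrite ger0_norm ?expR_ge0// expR_le1 oppr_le0.
  - rewrite cosE; apply: (le_trans (ler_wpM2l _ (norm_expRN_sub z0))) => //.
    rewrite natrX le_eqVlt; apply/orP; left; apply/eqP; field.
    by rewrite expf_neq0.
apply/cvgrPdist_le => e e0.
have h0 : (w m * w m * (4 ^+ m)^-1 : R) @[m --> \oo] --> 0.
  rewrite -[X in _ --> X](mulr0 (v ^+ 2 / 2 * (v ^+ 2 / 2))).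
  by apply: cvgM => //; exact: cvgM.
have e2 : 0 < e / 2 by rewrite divr_gt0.
have /cvgrPdist_le/(_ _ e2) h := h0; have /cvgrPdist_le/(_ _ e2) h' := he.
near=> m; rewrite [leRHS](splitr e).
rewrite (_ : expR _ - _ = (expR (- (v ^+ 2 / 2)) - expR (- w m)) + (expR (- w m) - cos (v / 2 ^+ m) ^+ (4 ^ m)%N)); last by ring.
apply: (le_trans (ler_normD _ _)); apply: lerD; first by near: m.
rewrite distrC; apply: (le_trans (key m)).
have : `|0 - w m * w m * (4 ^+ m)^-1| <= e / 2 by near: m.
by rewrite sub0r normrN; apply: le_trans; rewrite expr2 ler_norm.
Unshelve. all: by end_near. Qed.

End gaussian_limit.

Section Lball_shift.
Context (R : realType) (G : topologicalZmodType) (mu : probability (borel G) R).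
Context (hmu : is_haar mu).

Lemma Lball_shift (p : \bar R) (M : R) (f : borel G -> R[i]) g :
  (1 <= p)%E -> 0 <= M -> Lball mu p M f -> Lball mu p M (f \o gshift g).
Proof.
move=> p1 M0 [mf hf]; split; first exact: (cmeas_shift g mf).
have mn := measurable_normc mf.
case: p p1 hf => [p| |//]; rewrite ?lee_fin => p1.
  move=> /(Lnorm_finP _ _ p1 M0) hf; apply/Lnorm_finP => //.
  rewrite /= (ge0_integral_shift hmu g (f := fun x => (normc (f x) `^ p)%:E))//.
  - by apply/measurable_EFinP; exact: measurable_powRl.
  - by move=> x; rewrite lee_fin powR_ge0.
move=> /Lnorm_inftyP [N [mN N0 hN]]; apply/Lnorm_inftyP.
exists (gshift g @^-1` N); split.
- by have := measurable_shift g measurableT mN; rewrite setTI.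
- by rewrite -N0 -(haar_invariant hmu g mN).
- by move=> x hx; apply: hN => h; apply: hx.
Qed.
End Lball_shift.

Section dirichlet_polynomials.
Context (R : realType) (lam : nat -> R) (G : dirichlet_group lam).
Let mu := dhaar G.
Implicit Types (c : nat -> R[i]) (M : nat).

Definition dpoly M c (x : G) : R[i] := \sum_(n < M) c n * dchar G n x.

Lemma cmeas_dpoly M c : cmeas (dpoly M c : borel G -> R[i]).
Proof.
apply: cmeas_sum => n; apply: cmeasM; first exact: cmeas_cst.
exact/cmeas_character/dcharP.
Qed.

Definition cis (t : R) : R[i] := cos t +i* sin t.

Lemma normc_cis t : normc (cis t) = 1.
Proof. by rewrite normc_sqrt /= cos2Dsin2 sqrtr1. Qed.

Lemma dchar_shift_beta n t (x : G) :
  dchar G n (gshift (dbeta G t) x) = cis (- (lam n * t)) * dchar G n x.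
Proof.
rewrite /gshift (characterD (dcharP G n)) dchar_beta /cexp /= expR0.
by congr (_ * _); rewrite -[RHS]mul1r.
Qed.

Lemma dpoly_shift M c t (x : G) : dpoly M c (gshift (dbeta G t) x) =
  dpoly M (fun n => cis (- (lam n * t)) * c n) x.
Proof.
by apply: eq_bigr => n _; rewrite dchar_shift_beta mulrCA mulrA.
Qed.

Lemma cisM s t : cis s * cis t = cis (s + t).
Proof. by apply: complex_eq; rewrite ?cReM ?cImM /= ?cosD ?sinD; ring. Qed.

(* This multiplier averages the translates of the polynomial by beta(hh) and
   beta(-hh), rotated by e^{i s hh} and e^{-i s hh}. *)
Lemma Lball_cos M c (p : \bar R) (A hh s : R) : (1 <= p)%E -> 0 <= A ->
  Lball mu p A (dpoly M c) ->
  Lball mu p A (dpoly M (fun n => (cos ((lam n - s) * hh))%:C * c n)).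
Proof.
move=> p1 A0 hA; have hmu := dhaarP G.
have sh t w : normc w = 1 -> Lball mu p A (fun x => w * dpoly M c (gshift (dbeta G t) x)).
  move=> w1; apply: (Lball_norm (f := dpoly M c \o gshift (dbeta G t))).
  - apply: cmeasM; first exact: cmeas_cst.
    exact: (cmeas_shift (dbeta G t) (cmeas_dpoly M c)).
  - by move=> x; rewrite Normc.normcM w1 mul1r.
  - exact: Lball_shift.
have := Lball_half p1 A0 (sh hh (cis (s * hh)) (normc_cis _))
  (sh (- hh) (cis (- (s * hh))) (normc_cis _)).
move=> h; apply: (eq_ind _ (Lball mu p A) h); apply/funext => x.
rewrite !dpoly_shift /dpoly !mulr_sumr -big_split mulr_sumr /=.
apply: eq_bigr => n _; rewrite !mulrA -!mulrDl !mulrA; congr (_ * _ * _).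
rewrite !cisM; apply: complex_eq; rewrite ?cReM ?cImM /= ?mul0r ?subr0 ?addr0.
  rewrite mulrN opprK (_ : - (s * hh) + lam n * hh = (lam n - s) * hh); last by ring.
  rewrite (_ : s * hh - lam n * hh = - ((lam n - s) * hh)); last by ring.
  by rewrite cosN; field.
rewrite mulrN opprK (_ : - (s * hh) + lam n * hh = (lam n - s) * hh); last by ring.
rewrite (_ : s * hh - lam n * hh = - ((lam n - s) * hh)); last by ring.
by rewrite sinN addNr mulr0.
Qed.

Lemma Lball_cosX M c (p : \bar R) (A hh s : R) k : (1 <= p)%E -> 0 <= A ->
  Lball mu p A (dpoly M c) ->
  Lball mu p A (dpoly M (fun n => (cos ((lam n - s) * hh) ^+ k)%:C * c n)).
Proof.
move=> p1 A0 hA; elim: k => [|k ih].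
  apply: (eq_ind _ (Lball mu p A) hA); apply/funext => x.
  by apply: eq_bigr => n _; rewrite expr0 mul1r.
apply: (eq_ind _ (Lball mu p A) (Lball_cos hh s p1 A0 ih)); apply/funext => x.
by apply: eq_bigr => n _; rewrite mulrA -rmorphM /= -exprS.
Qed.

Lemma cvg_normc_sum M (u : nat -> nat -> R) (v : nat -> R) c (x : G) :
  (forall n, u n k @[k --> \oo] --> v n) ->
  normc (dpoly M (fun n => (u n k)%:C * c n) x) @[k --> \oo] -->
  normc (dpoly M (fun n => (v n)%:C * c n) x).
Proof.
move=> uv.
have key (w : nat -> R) : dpoly M (fun n => (w n)%:C * c n) x =
  (\sum_(n < M) w n * Re (c n * dchar G n x)) +i*
  (\sum_(n < M) w n * Im (c n * dchar G n x)).
  rewrite /dpoly; apply: complex_eq; rewrite ?Re_sum ?Im_sum /=;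
    apply: eq_bigr => n _; rewrite -mulrA.
    by rewrite [LHS]cReM/= mul0r subr0.
  by rewrite [LHS]cImM/= mul0r addr0.
under eq_fun do rewrite key normc_sqrt /=.
rewrite key normc_sqrt /=.
have hs (F : nat -> R) : (\sum_(n < M) u n k * F n) @[k --> \oo] --> \sum_(n < M) v n * F n.
  elim: (M) => [|N ih].
    by under eq_fun do rewrite big_ord0; rewrite big_ord0; exact: cvg_cst.
  under eq_fun do rewrite big_ord_recr /=; rewrite big_ord_recr /=.
  by apply: cvgD => //; apply: cvgMr_tmp; exact: uv.
apply: continuous_cvg; first exact: sqrt_continuous.
by apply: cvgD; rewrite expr2; under eq_fun do rewrite expr2;
  [apply: cvgM; exact: (hs (fun n => Re (c n * dchar G n x)))|
   apply: cvgM; exact: (hs (fun n => Im (c n * dchar G n x)))].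
Qed.

Definition gauss (v : R) : R := expR (- (v ^+ 2 / 2)).

(** The cosine multiplier with step 2^{-k}, iterated 4^k times, stays in the ball and tends to the
    Gaussian at each of the finitely many coefficients, hence pointwise on the group. *)
Lemma Lball_gauss M c (p : \bar R) (A s : R) : (1 <= p)%E -> 0 <= A ->
  Lball mu p A (dpoly M c) ->
  Lball mu p A (dpoly M (fun n => (gauss (lam n - s))%:C * c n)).
Proof.
move=> p1 A0 hA.
apply: (@Lball_lim _ (borel G) _ mu p A (fun k => dpoly M (fun n =>
  (cos ((lam n - s) * (2 ^+ k)^-1) ^+ (4 ^ k))%:C * c n))) => //.
- exact: cmeas_dpoly.
- by move=> k; exact: Lball_cosX.
- by move=> x; apply: cvg_normc_sum => n; exact: cvg_cos_gauss.
Qed.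

End dirichlet_polynomials.
Arguments dpoly {R lam} G M c x.

(** * Fejer kernels *)

Section character_sums.
Context (R : realType) (G : topologicalZmodType) (mu : probability (borel G) R).
Context (hmu : is_haar mu).
Implicit Types (f g V B : borel G -> R[i]) (chi : G -> R[i]) (s : seq (G -> R[i])).

Lemma Re_cint_le f g : cintegrable mu f -> cintegrable mu g ->
  (forall x, Re (f x) <= Re (g x)) -> Re (cint mu f) <= Re (cint mu g).
Proof.
move=> fi gi fg; apply: le_Rintegral => //; first exact: cintegrable_Re.
  exact: cintegrable_Re.
Qed.

(** Lists with repetitions: products and conjugates of sums of characters are again such sums, with
    multiplicities, which the square norms count. *)
Inductive characters : seq (G -> R[i]) -> Prop :=
| characters_nil : characters [::]
| characters_cons chi s : is_character chi -> characters s -> characters (chi :: s).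

Definition charsum s (x : G) : R[i] := \sum_(chi <- s) chi x.

Lemma characters_cat s t : characters s -> characters t -> characters (s ++ t).
Proof. by move=> hs ht; elim: hs => //= chi s' h _ ih; constructor. Qed.

Lemma charsum_mul s t : characters s -> characters t ->
  exists2 u, characters u & charsum u = fun x => charsum s x * charsum t x.
Proof.
move=> hs ht; elim: hs => [|chi s' h _ [u hu uE]].
  exists [::]; first by constructor.
  by apply/funext => x; rewrite /charsum !big_nil mul0r.
have [v hv vE] : exists2 v, characters v & charsum v = fun x => chi x * charsum t x.
  elim: ht => [|psi t' h' _ [v hv vE]].
    exists [::]; first by constructor.
    by apply/funext => x; rewrite /charsum !big_nil mulr0.
  exists ((fun x => chi x * psi x) :: v).
    by constructor => //; exact: character_mul.
  apply/funext => x; have /(congr1 (fun f => f x)) := vE.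
  by rewrite /charsum !big_cons mulrDr => ->.
exists (v ++ u); first exact: characters_cat.
apply/funext => x; rewrite [LHS]/charsum big_cat /= -/(charsum v x) -/(charsum u x).
by rewrite uE vE [in RHS]/charsum big_cons mulrDl.
Qed.

Lemma charsum_conj s : characters s ->
  exists2 u, characters u & charsum u = fun x => conjc (charsum s x).
Proof.
elim=> [|chi s' h _ [u hu uE]].
  exists [::]; first by constructor.
  by apply/funext => x; rewrite /charsum !big_nil conjc0.
exists ((fun x => conjc (chi x)) :: u).
  by constructor => //; exact: character_conj.
apply/funext => x; have /(congr1 (fun f => f x)) := uE.
by rewrite /charsum !big_cons rmorphD/= => ->.
Qed.

Lemma cintegrable_charsum s : characters s -> cintegrable mu (charsum s).
Proof.
elim=> [|chi s' h _ ih].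
  rewrite (_ : charsum _ = fun=> 0); first exact: cintegrable0.
  by apply/funext => x; rewrite /charsum big_nil.
rewrite (_ : charsum _ = fun x => chi x + charsum s' x).
  by apply: cintegrableD => //; exact: cintegrable_character.
by apply/funext => x; rewrite /charsum big_cons.
Qed.

(** The integral counts the occurrences of the trivial character in [s]. *)
Lemma cint_charsum_ge0 s : characters s ->
  Im (cint mu (charsum s)) = 0 /\ 0 <= Re (cint mu (charsum s)).
Proof.
elim=> [|chi s' h hs' [ih1 ih2]].
  rewrite (_ : charsum _ = fun=> 0) ?cint0//.
  by apply/funext => x; rewrite /charsum big_nil.
rewrite (_ : charsum _ = fun x => chi x + charsum s' x); last first.
  by apply/funext => x; rewrite /charsum big_cons.
rewrite cintD; [|exact: cintegrable_character|exact: cintegrable_charsum].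
rewrite cReD cImD ih1 (cint_character hmu h) addr0.
by case: `[< _ >] => /=; split=> //; rewrite addr_ge0.
Qed.

Definition sqnorm (V : borel G -> R[i]) : R := Re (cint mu (fun x => V x * conjc (V x))).

Lemma sqnorm_charsum s : characters s ->
  exists2 u, characters u & charsum u = fun x => charsum s x * conjc (charsum s x).
Proof.
move=> hs; have [v hv vE] := charsum_conj hs.
by have [u hu uE] := charsum_mul hs hv; exists u => //; rewrite uE vE.
Qed.

Lemma charsum_pow chi K : is_character chi ->
  exists2 u, characters u & charsum u = fun x => \sum_(i < K) chi x ^+ i.
Proof.
move=> h; elim: K => [|K [u hu uE]].
  exists [::]; first by constructor.
  by apply/funext => x; rewrite /charsum big_nil big_ord0.
exists ((fun x => chi x ^+ K) :: u).
  by constructor => //; exact: character_exp.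
apply/funext => x; have /(congr1 (fun f => f x)) := uE.
by rewrite /charsum big_cons big_ord_recr /= => ->; rewrite addrC.
Qed.

(* The off-diagonal terms count coincidences between characters, hence are
   non-negative. *)
Lemma sqnorm_pow s chi K : characters s -> is_character chi ->
  K%:R * sqnorm (charsum s) <=
  sqnorm (fun x => charsum s x * \sum_(i < K) chi x ^+ i).
Proof.
move=> hs h; have [v hv vE] := sqnorm_charsum hs.
pose g (i j : nat) (x : borel G) := (charsum s x * conjc (charsum s x)) * (chi x ^+ i * conjc (chi x ^+ j)).
have hg i j : exists2 u, characters u & charsum u = g i j.
  have [w hw wE] : exists2 w, characters w & charsum w = fun x => chi x ^+ i * conjc (chi x ^+ j).
    exists [:: fun x => chi x ^+ i * conjc (chi x ^+ j)].
      constructor; last by constructor.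
      by apply: character_mul; [|apply: character_conj]; exact: character_exp.
    by apply/funext => x; rewrite /charsum big_seq1.
  have [u hu uE] := charsum_mul hv hw; exists u => //.
  by rewrite uE vE wE.
have gi i j : cintegrable mu (g i j).
  by have [u hu <-] := hg i j; exact: cintegrable_charsum.
have g0 i j : 0 <= Re (cint mu (g i j)).
  by have [u hu <-] := hg i j; have [] := cint_charsum_ge0 hu.
have gd i : cint mu (g i i) = cint mu (fun x => charsum s x * conjc (charsum s x)).
  apply: eq_cint => x; rewrite /g (mulc_conj (chi x ^+ i)) normcX (character_unimodular h).
  by rewrite !expr1n mulr1.
have -> : sqnorm (fun x => charsum s x * \sum_(i < K) chi x ^+ i) =
    Re (cint mu (fun x => \sum_(i < K) \sum_(j < K) g i j x)).
  rewrite /sqnorm; congr Re; apply: eq_cint => x.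
  rewrite rmorphM /= mulrACA [X in _ * (_ * X)]rmorph_sum /=.
  rewrite [X in _ * X]mulr_suml [LHS]mulr_sumr.
  by apply: eq_bigr => i _; rewrite [X in _ * X]mulr_sumr [LHS]mulr_sumr.
rewrite cint_sum => [|i]; last exact: cintegrable_sum.
rewrite Re_sum (_ : K%:R * _ = \sum_(i < K) Re (cint mu (g i i))).
  apply: ler_sum => i _; rewrite cint_sum// Re_sum (bigD1 i)//= lerDl.
  by apply: sumr_ge0 => j _; exact: g0.
rewrite /sqnorm; under eq_bigr do rewrite gd.
by rewrite sumr_const card_ord mulr_natl.
Qed.

End character_sums.

Section fejer_convolution.
Context (R : realType) (G : topologicalZmodType) (mu : probability (borel G) R).
Context (hmu : is_haar mu).
Context (m : nat) (chi : 'I_m -> G -> R[i]).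
Context (hchi : forall i, is_character (chi i)).
Implicit Types (f : borel G -> R[i]).

Definition pair_char (i j : 'I_m) (x : G) : R[i] := chi i x * conjc (chi j x).

Lemma pair_charP i j : is_character (pair_char i j).
Proof. by apply: character_mul => //; exact: character_conj. Qed.

(* pair_count psi / pair_count 1 is the Fourier coefficient of the Fejer kernel at
   psi. *)
Definition pair_count (psi : G -> R[i]) : R :=
  \sum_(i < m) \sum_(j < m) (`[< pair_char i j = psi >])%:R.

(** This counts the pairs with chi_i = chi_j; it is the integral of |sum_i chi_i|^2 and normalises
    the kernel. *)
Let Z := pair_count (fun=> 1).
Context (Z0 : 0 < Z).

(* The value at x - y of the Fejer kernel |sum_i chi_i|^2 / Z. *)
Definition fejer (x y : G) : R :=
  Z^-1 * normc (\sum_(i < m) chi i x * conjc (chi i y)) ^+ 2.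

Lemma fejer_ge0 x y : 0 <= fejer x y.
Proof. by rewrite mulr_ge0 ?invr_ge0 ?(ltW Z0) ?sqr_ge0. Qed.

Lemma fejerE x y : (fejer x y)%:C =
  Z^-1%:C * \sum_(i < m) \sum_(j < m) pair_char i j x * conjc (pair_char i j y).
Proof.
rewrite /fejer rmorphM /= -mulc_conj rmorph_sum /= mulr_suml; congr (_ * _).
apply: eq_bigr => i _; rewrite mulr_sumr; apply: eq_bigr => j _.
by rewrite /pair_char !rmorphM /= !conjcK mulrACA.
Qed.

Lemma fejer_bound x y : normc (fejer x y)%:C <= Z^-1 * m%:R ^+ 2.
Proof.
rewrite normc_real ger0_norm ?fejer_ge0// ler_wpM2l ?invr_ge0 ?(ltW Z0)//.
rewrite ler_pXn2r ?nnegrE ?normc_ge0//.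
apply: (le_trans (normc_sum _ _ _)); rewrite -[X in _ <= X%:R]card_ord -sum1_card natr_sum.
apply: ler_sum => i _; rewrite Normc.normcM normc_conjc.
by rewrite !(character_unimodular (hchi i)) mulr1.
Qed.

Lemma cmeas_fejer x : cmeas (fun y : borel G => (fejer x y)%:C).
Proof.
under eq_fun do rewrite fejerE; apply: cmeasM; first exact: cmeas_cst.
apply: cmeas_sum => i; apply: cmeas_sum => j; apply: cmeasM.
  exact: cmeas_cst.
by apply: cmeas_conjc; apply: cmeas_character; exact: pair_charP.
Qed.

Lemma cintegrable_fejer f x : cintegrable mu f ->
  cintegrable mu (fun y => (fejer x y)%:C * f y).
Proof.
move=> fi; apply: (cintegrable_bound (M := Z^-1 * m%:R ^+ 2)) => //.
- by rewrite mulr_ge0 ?invr_ge0 ?(ltW Z0)// exprn_ge0.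
- exact: cmeas_fejer.
- exact: fejer_bound.
Qed.

Lemma cintegrable_fourier f (psi : G -> R[i]) : is_character psi ->
  cintegrable mu f -> cintegrable mu (fun y => conjc (psi y) * f y).
Proof.
move=> h fi; apply: (cintegrable_bound (M := 1)) => //.
- by apply: cmeas_conjc; exact: cmeas_character.
- by move=> x; rewrite normc_conjc (character_unimodular h).
Qed.

Lemma fourierE f (psi : G -> R[i]) :
  fourier mu f psi = cint mu (fun y => conjc (psi y) * f y).
Proof. by apply: eq_cint => x; rewrite mulrC. Qed.

Definition fejer_conv f (x : borel G) : R[i] :=
  cint mu (fun y => (fejer x y)%:C * f y).

(** The kernel is a finite sum of products of a function of x and a function of y. This expansion
    takes the place of Fubini's theorem on G x G, where the Borel sets may exceed the product
    sigma-algebra. *)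
Lemma fejer_convE f x : cintegrable mu f -> fejer_conv f x =
  Z^-1%:C * \sum_(i < m) \sum_(j < m) pair_char i j x * fourier mu f (pair_char i j).
Proof.
move=> fi.
have ci i j c : cintegrable mu (fun y => c * (conjc (pair_char i j y) * f y)).
  by apply: cintegrableZ; apply: cintegrable_fourier => //; exact: pair_charP.
transitivity (cint mu (fun y => \sum_(i < m) \sum_(j < m)
    (Z^-1%:C * pair_char i j x) * (conjc (pair_char i j y) * f y))).
  apply: eq_cint => y; rewrite fejerE -mulrA mulr_suml mulr_sumr.
  apply: eq_bigr => i _; rewrite mulr_suml mulr_sumr.
  by apply: eq_bigr => j _; rewrite !mulrA.
rewrite cint_sum; last by move=> i; exact: cintegrable_sum.
rewrite mulr_sumr; apply: eq_bigr => i _; rewrite cint_sum// mulr_sumr.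
apply: eq_bigr => j _; rewrite cintZ ?fourierE ?mulrA//.
by apply: cintegrable_fourier => //; exact: pair_charP.
Qed.

Lemma fourier_cst1 (psi : G -> R[i]) : is_character psi ->
  fourier mu (fun=> 1) psi = (`[< psi = fun=> 1 >])%:R.
Proof.
move=> h; rewrite [LHS](cint_character_mul hmu (character_cst1 G) h).
congr (nat_of_bool _)%:R; apply: asbool_equiv_eq.
by split=> ->.
Qed.

Lemma pair_countC psi : (pair_count psi)%:C =
  \sum_(i < m) \sum_(j < m) (`[< pair_char i j = psi >])%:R.
Proof.
rewrite /pair_count rmorph_sum; apply: eq_bigr => i _ /=.
by rewrite rmorph_sum; apply: eq_bigr => j _ /=; rewrite rmorph_nat.
Qed.

Lemma fejer_conv1 x : fejer_conv (fun=> 1) x = 1.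
Proof.
rewrite fejer_convE; last exact: (cintegrable_character mu (character_cst1 G)).
rewrite (_ : \sum_(i < m) _ = Z%:C); first by rewrite -rmorphM /= mulVf// gt_eqF.
rewrite pair_countC; apply: eq_bigr => i _; apply: eq_bigr => j _.
rewrite fourier_cst1; last exact: pair_charP.
by have [->|] := asboolP (_ = _); rewrite ?mulr0// mulr1.
Qed.

Lemma cmeas_fejer_conv f : cintegrable mu f -> cmeas (fejer_conv f).
Proof.
move=> fi; have /funext -> := fun x => fejer_convE x fi.
apply: cmeasM; first exact: cmeas_cst.
apply: cmeas_sum => i; apply: cmeas_sum => j; apply: cmeasM; last exact: cmeas_cst.
by apply: cmeas_character; exact: pair_charP.
Qed.

Lemma cintegrable_fejer_conv f : cintegrable mu f ->
  cintegrable mu (fejer_conv f).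
Proof.
move=> fi; have /funext -> := fun x => fejer_convE x fi.
apply: cintegrableZ; apply: cintegrable_sum => i; apply: cintegrable_sum => j.
under eq_fun do rewrite mulrC.
by apply: cintegrableZ; apply: cintegrable_character; exact: pair_charP.
Qed.

(** Only the [Z] pairs with trivial [pair_char i j] survive integration of the expansion, each with
    the integral of [f] as coefficient. *)
Lemma cint_fejer_conv f : cintegrable mu f -> cint mu (fejer_conv f) = cint mu f.
Proof.
move=> fi; rewrite (_ : fejer_conv f = fun x => Z^-1%:C * \sum_(i < m)
    \sum_(j < m) fourier mu f (pair_char i j) * pair_char i j x); last first.
  apply/funext => x; rewrite fejer_convE//; congr (_ * _).
  by apply: eq_bigr => i _; apply: eq_bigr => j _; rewrite mulrC.
have ci i j c : cintegrable mu (fun y => c * pair_char i j y).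
  by apply: cintegrableZ; apply: cintegrable_character; exact: pair_charP.
rewrite cintZ; last by apply: cintegrable_sum => i; exact: cintegrable_sum.
rewrite cint_sum; last by move=> i; exact: cintegrable_sum.
rewrite (_ : \sum_(i < m) _ = Z%:C * cint mu f).
  by rewrite mulrA -rmorphM /= mulVf ?mul1r// gt_eqF.
rewrite pair_countC mulr_suml; apply: eq_bigr => i _.
rewrite cint_sum// mulr_suml; apply: eq_bigr => j _.
rewrite cintZ; last by apply: cintegrable_character; exact: pair_charP.
rewrite (cint_character hmu (pair_charP i j)).
have [e|] := asboolP (_ = _); last by rewrite mulr0 mul0r.
rewrite mulr1 mul1r fourierE; apply: eq_cint => y.
by rewrite e conjc1 mul1r.
Qed.

Lemma normc_fejer_conv f x : cintegrable mu f ->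
  ((normc (fejer_conv f x))%:E <= \int[mu]_y (normc (f y) * fejer x y)%:E)%E.
Proof.
move=> fi; apply: (le_trans (normc_cint (cintegrable_fejer x fi))).
rewrite le_eqVlt; apply/orP; left; apply/eqP; apply: eq_integral => y _.
by rewrite normc_realM ger0_norm ?fejer_ge0// mulrC.
Qed.

Lemma integral_fejer x : (\int[mu]_y (fejer x y)%:E = 1)%E.
Proof.
have fi := cintegrable_fejer x (cintegrable_character mu (character_cst1 G)).
have -> : (\int[mu]_y (fejer x y)%:E =
    \int[mu]_y (Re ((fejer x y)%:C * 1))%:E)%E.
  by apply: eq_integral => y _; rewrite mulr1.
have /(congr1 (@complex.Re R)) /= h := fejer_conv1 x.
rewrite -[LHS]fineK; first by congr EFin.
exact: (integrable_fin_num measurableT (cintegrable_Re fi)).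
Qed.

Lemma measurable_fejer x : measurable_fun setT (fun y : borel G => fejer x y).
Proof. by have [] := cmeas_fejer x. Qed.

(** For each x the kernel is a probability density in y. Jensen's inequality bounds the p-th power
    of the mean by the mean of |f|^p, and the latter has the same integral as |f|^p. *)
Lemma Lball_fejer (p : \bar R) (A : R) f : (1 <= p)%E -> 0 <= A ->
  cintegrable mu f -> Lball mu p A f -> Lball mu p A (fejer_conv f).
Proof.
move=> p1 A0 fi [mf hf]; split; first exact: cmeas_fejer_conv.
have mn := measurable_normc mf.
case: p p1 hf => [p| |//]; rewrite ?lee_fin => p1; last first.
  move=> /Lnorm_inftyP hf; apply/Lnorm_inftyP; apply: aeW => x.
  rewrite -lee_fin; apply: (le_trans (normc_fejer_conv x fi)).
  apply: (@le_trans _ _ (\int[mu]_y (A * fejer x y)%:E)%E).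
    apply: ae_ge0_le_integral => //.
    - by move=> y _; rewrite lee_fin mulr_ge0 ?normc_ge0 ?fejer_ge0.
    - by apply/measurable_EFinP; apply: measurable_funM => //; exact: measurable_fejer.
    - by move=> y _; rewrite lee_fin mulr_ge0 ?fejer_ge0.
    - by apply/measurable_EFinP; apply: measurable_funM => //; exact: measurable_fejer.
    - by apply: filterS hf => y h _; rewrite lee_fin ler_wpM2r ?fejer_ge0.
  under eq_integral do rewrite EFinM.
  rewrite ge0_integralZl//; last 2 first.
  - by apply/measurable_EFinP; exact: measurable_fejer.
  - by move=> y _; rewrite lee_fin fejer_ge0.
  by rewrite integral_fejer mule1.
have p0 : 0 < p by exact: lt_le_trans p1.
move=> /(Lnorm_finP _ _ p1 A0) hf; apply/Lnorm_finP => //.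
pose g (y : borel G) := (normc (f y) `^ p)%:C.
have mg : cmeas g by apply: cmeas_real; exact: measurable_powRl.
have gi : cintegrable mu g.
  split=> //; under eq_integral do rewrite normc_real ger0_norm ?powR_ge0//.
  by apply: (le_lt_trans hf); rewrite ltry.
pose V x := Re (fejer_conv g x).
have VE x : (\int[mu]_y (normc (f y) `^ p * fejer x y)%:E = (V x)%:E)%E.
  have -> : (\int[mu]_y (normc (f y) `^ p * fejer x y)%:E =
      \int[mu]_y (Re ((fejer x y)%:C * g y))%:E)%E.
    by apply: eq_integral => y _; rewrite /= mul0r subr0 mulrC.
  rewrite -[LHS]fineK; first by congr EFin.
  exact: (integrable_fin_num measurableT (cintegrable_Re (cintegrable_fejer x gi))).
have V0 x : 0 <= V x.
  rewrite -lee_fin -VE; apply: integral_ge0 => y _.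
  by rewrite lee_fin mulr_ge0 ?powR_ge0 ?fejer_ge0.
have key x : normc (fejer_conv f x) `^ p <= V x.
  have VVp : V x = (V x `^ p^-1) `^ p by rewrite -powRrM mulVf ?gt_eqF// powRr1.
  rewrite [leRHS]VVp ge0_ler_powR ?nnegrE ?normc_ge0 ?powR_ge0 ?(ltW p0)//.
  rewrite -lee_fin; apply: (le_trans (normc_fejer_conv x fi)).
  apply: (@jensen_powR _ _ _ mu (fun y => normc (f y)) (fejer x) p) => //.
  - exact: measurable_fejer.
  - by move=> y; exact: normc_ge0.
  - by move=> y; exact: fejer_ge0.
  - exact: powR_ge0.
  - by rewrite integral_fejer.
  - by rewrite VE -VVp.
have gci : cintegrable mu (fejer_conv g) by exact: cintegrable_fejer_conv.
apply: (@le_trans _ _ (\int[mu]_x (V x)%:E)%E).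
  apply: ge0_le_integralT => [x|||//]; first exact: powR_ge0.
  - by apply: measurable_powRl; apply: measurable_normc; exact: cmeas_fejer_conv.
  - by have [] := cmeas_fejer_conv gi.
rewrite -[leLHS]fineK; last exact: (integrable_fin_num measurableT (cintegrable_Re gci)).
have /(congr1 (@complex.Re R)) /= := cint_fejer_conv gi.
rewrite /Rintegral /= => -> ; rewrite fineK//.
exact: (integrable_fin_num measurableT (cintegrable_Re gi)).
Qed.

End fejer_convolution.

(** * Fejer kernels adapted to the characters h_n *)

Section fejer_approximation.
Context (R : realType) (lam : nat -> R) (hlam : is_frequency lam)
  (G : dirichlet_group lam).
Let mu := dhaar G.
Let hmu : is_haar mu := dhaarP G.

Lemma lam_inj : injective lam.
Proof.
move=> m n e; apply/eqP; rewrite eqn_leq; apply/andP; split; rewrite leqNgt;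
by apply/negP => /(frequency_increasing hlam); rewrite e ltxx.
Qed.

Lemma dchar_inj m n : dchar G m = dchar G n -> m = n.
Proof.
move=> e; apply: lam_inj; apply/eqP; rewrite -subr_eq0; apply/negPn/negP => d0.
(* At this time the values of the two characters are opposite: equality would give phase difference
   with cosine 1, but the cosine is cos pi. *)
pose t := pi / (lam m - lam n).
have : dchar G m (dbeta G t) = dchar G n (dbeta G t) by rewrite e.
rewrite !dchar_beta /cexp /= expR0 => -[].
rewrite !mul1r !mul0r !subr0 !addr0 !cosN !sinN => h1 [h2].
have : cos (lam m * t - lam n * t) = 1.
  by move/oppr_inj: h2 => h2; rewrite cosB h1 h2 -!expr2 cos2Dsin2.
rewrite -mulrBl /t mulrCA mulfV// mulr1 cospi => /eqP.
by rewrite eq_sym -addr_eq0 => /eqP h; have : (0 : R) < 1 + 1 by []; rewrite h ltxx.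
Qed.

Definition spectrum_in (f : G -> R[i]) : Prop :=
  forall chi : G -> R[i], is_character chi -> fourier mu f chi != 0 ->
    exists n, chi = dchar G n.

Section kernel.
Context (m : nat) (chi : 'I_m -> G -> R[i]).
Context (hchi : forall i, is_character (chi i)).
Let Z := pair_count chi (fun=> 1).
Context (Z0 : 0 < Z).

Lemma pair_count_ge0 psi : 0 <= pair_count chi psi.
Proof. by apply: sumr_ge0 => i _; apply: sumr_ge0 => j _; rewrite ler0n. Qed.

(** Finitely many pairs of characters occur, so indices beyond some [N0] contribute nothing; pairs
    that are not an h_n are removed by the spectrum condition. The freedom in [N] lets
    [fejer_approx] prescribe a minimal length. *)
Lemma fejer_conv_dpoly f : cintegrable mu f -> spectrum_in f ->
  exists N0, forall N, (N0 <= N)%N -> fejer_conv mu chi f =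
    dpoly G N (fun n => (Z^-1 * pair_count chi (dchar G n))%:C * fourier mu f (dchar G n)).
Proof.
move=> fi hf.
have /choice[F hF] : forall ij : 'I_m * 'I_m, exists N0, forall n,
    pair_char chi ij.1 ij.2 = dchar G n -> (n < N0)%N.
  move=> ij; have [[n e]|ne] := pselect (exists n, pair_char chi ij.1 ij.2 = dchar G n).
    by exists n.+1 => k; rewrite e => /dchar_inj ->.
  by exists 0%N => k ek; exfalso; apply: ne; exists k.
exists (\max_(ij : 'I_m * 'I_m) F ij)%N => N hN.
apply/funext => x; rewrite fejer_convE// /dpoly.
under [RHS]eq_bigr => n _ do rewrite rmorphM /= -!mulrA pair_countC.
rewrite -mulr_sumr; congr (_ * _).
under [RHS]eq_bigr => n _ do rewrite mulr_suml.
rewrite [RHS]exchange_big /=; apply: eq_bigr => i _.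
under [RHS]eq_bigr => n _ do rewrite mulr_suml.
rewrite [RHS]exchange_big /=; apply: eq_bigr => j _.
have [[n e]|ne] := pselect (exists n, pair_char chi i j = dchar G n).
  have nN : (n < N)%N.
    by apply: leq_trans hN; apply: leq_trans (hF (i, j) n e) (leq_bigmax (i, j)).
  rewrite (bigD1 (Ordinal nN))//= big1 ?addr0.
    by rewrite e (_ : `[< _ >] = true) ?mul1r 1?mulrC//; apply/asboolP.
  move=> k kn; rewrite (_ : `[< _ >] = false) ?mul0r//.
  apply/asboolPn; rewrite e => /dchar_inj nk; move/eqP: kn; apply.
  by apply/val_inj; rewrite /= nk.
have f0 : fourier mu f (pair_char chi i j) = 0.
  apply: contrapT => /eqP /(hf _ (pair_charP hchi i j))[n e].
  by apply: ne; exists n.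
rewrite f0 mulr0 big1// => n _.
rewrite (_ : `[< _ >] = false) ?mul0r//.
by apply/asboolPn => e; apply: ne; exists n.
Qed.

Let B (x : borel G) : R[i] := \sum_(i < m) chi i x.

Lemma cint_pair_count (psi : G -> R[i]) : is_character psi ->
  cint mu (fun x => B x * conjc (B x) * conjc (psi x)) = (pair_count chi psi)%:C.
Proof.
move=> hpsi.
have ci i j : cintegrable mu (fun y => pair_char chi i j y * conjc (psi y)).
  apply: cintegrable_character; apply: character_mul; first exact: pair_charP.
  exact: character_conj.
transitivity (cint mu (fun x => \sum_(i < m) \sum_(j < m) pair_char chi i j x * conjc (psi x))).
  apply: eq_cint => x; rewrite /B rmorph_sum /= mulr_suml mulr_suml.
  by apply: eq_bigr => i _; rewrite mulr_sumr mulr_suml.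
rewrite cint_sum; last by move=> i; exact: cintegrable_sum.
rewrite pair_countC; apply: eq_bigr => i _.
rewrite cint_sum//; apply: eq_bigr => j _.
by rewrite (cint_character_mul hmu (pair_charP hchi i j) hpsi).
Qed.

Lemma sqnorm_pair_count : sqnorm mu B = Z.
Proof.
transitivity (Re (cint mu (fun x : borel G => B x * conjc (B x) * conjc 1))).
  by congr Re; apply: eq_cint => x; rewrite conjc1 mulr1.
by rewrite (cint_pair_count (character_cst1 G)).
Qed.

Lemma cmeas_B : cmeas B.
Proof. by apply: cmeas_sum => i; exact: cmeas_character. Qed.

Lemma normc_B x : normc (B x) <= m%:R.
Proof.
apply: (le_trans (normc_sum _ _ _)); rewrite -[X in _ <= X%:R]card_ord -sum1_card natr_sum.
by apply: ler_sum => i _; rewrite (character_unimodular (hchi i)).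
Qed.

Lemma cintegrable_BM (g : borel G -> R[i]) (C : R) : 0 <= C -> cmeas g ->
  (forall x, normc (g x) <= C) -> cintegrable mu (fun x => B x * conjc (B x) * g x).
Proof.
move=> C0 mg gC; apply: (cintegrable_bounded mu (M := m%:R * m%:R * C)).
  by apply: cmeasM => //; apply: cmeasM; [|apply: cmeas_conjc]; exact: cmeas_B.
move=> x; rewrite !Normc.normcM normc_conjc.
by rewrite ler_pM ?mulr_ge0 ?normc_ge0// ler_pM ?normc_ge0// normc_B.
Qed.

(** [pair_count chi psi] is the Fourier coefficient of |B|^2 at [psi], and [Z] the one at 1; their
    difference is read off from |1 - psi|^2 = 2 - 2 Re psi. *)
Lemma sub_pair_count (psi : G -> R[i]) : is_character psi ->
  Z - pair_count chi psi =
  2^-1 * Re (cint mu (fun x => B x * conjc (B x) * (normc (1 - psi x) ^+ 2)%:C)).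
Proof.
move=> hpsi; have h1 := character_cst1 (R := R) G.
have ci (phi : G -> R[i]) : is_character phi ->
    cintegrable mu (fun x : borel G => B x * conjc (B x) * conjc (phi x)).
  move=> hphi; apply: (@cintegrable_BM (fun x => conjc (phi x)) 1) => //.
    by apply: cmeas_conjc; exact: cmeas_character.
  by move=> x; rewrite normc_conjc (character_unimodular hphi).
have -> : Re (cint mu (fun x => B x * conjc (B x) * (normc (1 - psi x) ^+ 2)%:C)) =
   Re (cint mu (fun x => 2%:C * (B x * conjc (B x) * conjc 1 +
     (- 1) * (B x * conjc (B x) * conjc (psi x))))).
  apply: eq_Rintegral => x _; rewrite mulc_conj conjc1.
  exact/Re_mul_gap/(character_unimodular hpsi).
rewrite cintZ; last by apply: cintegrableD; [exact: (ci _ h1)|apply: cintegrableZ; exact: ci].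
rewrite cintD; [|exact: (ci _ h1)|apply: cintegrableZ; exact: ci].
rewrite cintZ; last exact: ci.
rewrite (cint_pair_count h1) (cint_pair_count hpsi) -/Z.
rewrite mulN1r -rmorphN -rmorphD -rmorphM /=.
by rewrite mulKf.
Qed.

Lemma pair_count_le (psi : G -> R[i]) : is_character psi -> pair_count chi psi <= Z.
Proof.
move=> hpsi; rewrite -subr_ge0 sub_pair_count// mulr_ge0//.
apply: Rintegral_ge0 => x _; rewrite mulc_conj -rmorphM /=.
by rewrite mulr_ge0// sqr_ge0.
Qed.

(** The geometric sum gives B (1 - psi) = V (1 - psi^K), of modulus at most 2 |V|; the constant is 2
    = 2^2 / 2. *)
Lemma sub_pair_count_le (psi : G -> R[i]) (V : borel G -> R[i]) K :
  is_character psi -> cintegrable mu (fun x => V x * conjc (V x)) ->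
  (forall x, B x = V x * \sum_(i < K) psi x ^+ i) ->
  Z - pair_count chi psi <= 2 * sqnorm mu V.
Proof.
move=> hpsi Vi BE; rewrite sub_pair_count//.
rewrite (_ : 2 * sqnorm mu V = 2^-1 * Re (cint mu (fun x => 4%:C * (V x * conjc (V x))))).
  rewrite ler_pM2l ?invr_gt0//; apply: Re_cint_le.
  - apply: (@cintegrable_BM _ 4) => //.
      apply: cmeas_real; apply: measurable_funX; apply: measurable_normc.
      apply: cmeasD; first exact: cmeas_cst.
      under eq_fun do rewrite -mulN1r.
      by apply: cmeasM; [exact: cmeas_cst|exact: cmeas_character].
    move=> x; rewrite normc_real ger0_norm ?sqr_ge0//.
    rewrite (_ : 4 = 2 ^+ 2) ?ler_pXn2r ?nnegrE ?normc_ge0//; last by ring.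
    apply: (le_trans (normcD _ _)).
    by rewrite Normc.normc1 normcN (character_unimodular hpsi).
  - exact: cintegrableZ.
  move=> x; rewrite !mulc_conj -!rmorphM /= BE Normc.normcM exprMn -mulrA -exprMn.
  rewrite [leRHS]mulrC ler_wpM2l ?sqr_ge0//.
  rewrite -Normc.normcM (_ : _ * _ = 1 - psi x ^+ K); last first.
    by rewrite -[RHS]opprB subrX1 -mulNr opprB mulrC.
  rewrite (_ : 4 = 2 ^+ 2) ?ler_pXn2r ?nnegrE ?normc_ge0//; last by ring.
  apply: (le_trans (normcD _ _)).
  by rewrite Normc.normc1 normcN normcX (character_unimodular hpsi) expr1n.
rewrite cintZ// cReM /= mul0r subr0 mulrA; by congr (_ * _); field.
Qed.

End kernel.

(* The kernel is built from the box of all products of powers h_j^i, i < K, j in r. *)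
Lemma dchar_box K (r : seq nat) : (0 < K)%N ->
  exists2 s, characters s &
    charsum s = (fun x => \prod_(j <- r) \sum_(i < K) dchar G j x ^+ i) /\
    1 <= sqnorm mu (charsum s).
Proof.
move=> K0; elim: r => [|j r [s hs [sE s1]]].
  exists [:: fun=> 1]; first by constructor; [exact: character_cst1|constructor].
  have e : charsum [:: fun=> 1] = (fun=> 1) :> (G -> R[i]).
    by apply/funext => x; rewrite /charsum big_seq1.
  rewrite e; split; first by apply/funext => x; rewrite big_nil.
  rewrite /sqnorm (_ : (fun x => _) = fun=> 1); last first.
    by apply/funext => x; rewrite conjc1 mulr1.
  rewrite (cint_character hmu (character_cst1 G)).
  by rewrite (_ : `[< _ >] = true)//; apply/asboolP.
have [t ht tE] := charsum_pow K (dcharP G j).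
have [u hu uE] := charsum_mul hs ht.
exists u => //; split.
  by apply/funext => x; rewrite uE sE tE big_cons mulrC.
rewrite uE tE.
apply: le_trans (sqnorm_pow hmu K hs (dcharP G j)).
by apply: (le_trans s1); rewrite ler_peMl ?ler1n// (le_trans ler01).
Qed.

Lemma characters_nth (s : seq (G -> R[i])) : characters s ->
  forall i, is_character (nth (fun=> 1) s i : G -> R[i]).
Proof.
elim=> [i|chi s' h _ ih [|i]]//=; first by rewrite nth_nil; exact: character_cst1.
Qed.

(* Write B = V * (1 + h_n + ... + h_n^{K-1}) for the sum of the box of characters.
   Then B (1 - h_n) = V (1 - h_n^K), so the multiplier of the kernel at h_n differs
   from 1 by at most 2/K. *)
Lemma fejer_approx (f : borel G -> R[i]) M (e : R) : 0 < e ->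
  cintegrable mu f -> spectrum_in f ->
  exists (rho : nat -> R) (N : nat),
    [/\ forall n, 0 <= rho n <= 1, forall n, (n < M)%N -> 1 - e <= rho n,
      (M <= N)%N &
      forall (p : \bar R) (A : R), (1 <= p)%E -> 0 <= A -> Lball mu p A f ->
        Lball mu p A (dpoly G N (fun n => (rho n)%:C * fourier mu f (dchar G n)))].
Proof.
move=> e0 fi fs.
have [K [K0 Ke]] : exists K : nat, (0 < K)%N /\ 2 / K%:R <= e.
  exists (Num.bound (2 / e)).+1; split=> //.
  rewrite ler_pdivrMr ?ltr0n// mulrC -ler_pdivrMr//.
  have h := archi_boundP (divr_ge0 (ler0n R 2) (ltW e0)).
  by apply: ltW; apply: lt_le_trans h _; rewrite ler_nat.
have [s hs [sE s1]] := dchar_box (iota 0 M) K0.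
pose chi (i : 'I_(size s)) := nth (fun=> 1) s i.
have hchi i : is_character (chi i) by exact: characters_nth.
have BE x : charsum s x = \sum_(i < size s) chi i x.
  by rewrite /charsum (big_nth (fun=> 1)) big_mkord.
have ZE : sqnorm mu (charsum s) = pair_count chi (fun=> 1).
  by rewrite (funext BE); exact: sqnorm_pair_count.
have Z0 : 0 < pair_count chi (fun=> 1) by rewrite -ZE (lt_le_trans ltr01).
have [N0 hN0] := fejer_conv_dpoly hchi fi fs.
exists (fun n => (pair_count chi (fun=> 1))^-1 * pair_count chi (dchar G n)), (maxn M N0); split.
- move=> n; rewrite mulr_ge0 ?invr_ge0 ?pair_count_ge0 ?(ltW Z0)//=.
  by rewrite mulrC ler_pdivrMr// mul1r pair_count_le//; exact: dcharP.
- move=> n nM.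
  (* The box with direction n removed plays the role of V. *)
  have [t ht [tE t1]] := dchar_box (rem n (iota 0 M)) K0.
  have BV x : \sum_(i < size s) chi i x = charsum t x * \sum_(i < K) dchar G n x ^+ i.
    rewrite -BE sE tE (perm_big (n :: rem n (iota 0 M))).
      by rewrite big_cons mulrC.
    by apply: perm_to_rem; rewrite mem_iota.
  have [v hv vE] := sqnorm_charsum ht.
  have := sub_pair_count_le hchi (dcharP G n) _ BV.
  rewrite -vE => /(_ (cintegrable_charsum mu hv)) h.
  (* With |V|^2 for the square norm, K |V|^2 <= Z and Z - [pair_count] <= 2 |V|^2 yield 1 - rho_n <=
     2/K <= e. *)
  have h2 := sqnorm_pow hmu K ht (dcharP G n).
  rewrite (_ : (fun x => _ * _) = charsum s) ?ZE in h2; last first.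
    by apply/funext => x; rewrite BE BV.
  have K0' : (0 : R) < K%:R by rewrite ltr0n.
  rewrite mulrC ler_pdivlMr// mulrBl mul1r lerBlDl -lerBlDr.
  apply: (le_trans h); apply: le_trans (ler_wpM2r (ltW Z0) Ke).
  by rewrite mulrAC ler_pdivlMr// -mulrA ler_wpM2l// mulrC.
- exact: leq_maxl.
- move=> p A p1 A0 hA.
  by rewrite -hN0 ?leq_maxr//; apply: Lball_fejer.
Qed.

End fejer_approximation.

(** * Absolutely convergent series *)

Section complex_series.
Context (R : realType).
Implicit Types (u : nat -> R[i]).

Definition csummable u := cvgn (series (fun n => normc (u n))).

Definition csum u : R[i] :=
  limn (series (fun n => Re (u n))) +i* limn (series (fun n => Im (u n))).

Lemma csummable_le u (v : nat -> R) : (forall n, normc (u n) <= v n) ->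
  cvgn (series v) -> csummable u.
Proof.
move=> uv cv; apply: series_le_cvg cv => // n; first exact: normc_ge0.
by apply: le_trans (uv n); exact: normc_ge0.
Qed.

Lemma csummable_Re u : csummable u -> cvgn (series (fun n => Re (u n))).
Proof.
move=> su; apply: normed_cvg; apply: series_le_cvg su => n /=.
- exact: normr_ge0.
- exact: normc_ge0.
- exact: normc_Re.
Qed.

Lemma csummable_Im u : csummable u -> cvgn (series (fun n => Im (u n))).
Proof.
move=> su; apply: normed_cvg; apply: series_le_cvg su => n /=.
- exact: normr_ge0.
- exact: normc_ge0.
- exact: normc_Im.
Qed.

Lemma series_normc_le u N : csummable u ->
  series (fun n => normc (u n)) N <= limn (series (fun n => normc (u n))).
Proof.
move=> su; apply: nondecreasing_cvgn_le => //.
apply/nondecreasing_series => k _ _; exact: normc_ge0.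
Qed.

Lemma norm_normcB (a b : R[i]) : `|normc a - normc b| <= normc (a - b).
Proof.
have h (x y : R[i]) : normc x - normc y <= normc (x - y).
  by rewrite lerBlDr; apply: le_trans (normcD _ _); rewrite subrK.
rewrite ler_norml h andbT lerNl opprB; apply: (le_trans (h _ _)).
by rewrite -normcN opprB.
Qed.

Lemma sum_nat_series (F : nat -> R) N k : (N <= k)%N ->
  \sum_(N <= n < k) F n = series F k - series F N.
Proof.
by move=> Nk; rewrite /series /= (@big_cat_nat _ _ _ N 0 k)//= addrAC subrr add0r.
Qed.

(** The remainder is the limit of the blocks from N to k, and each block is bounded by its sum of
    moduli. *)
Lemma csum_partial u N : csummable u ->
  normc (csum u - \sum_(n < N) u n) <=
  limn (series (fun n => normc (u n))) - series (fun n => normc (u n)) N.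
Proof.
move=> su; set D := _ - _.
have cR := csummable_Re su; have cI := csummable_Im su.
have hlim : normc (\sum_(N <= n < k) u n) @[k --> \oo] --> normc D.
  have e k : (N <= k)%N -> normc (\sum_(N <= n < k) u n) =
      Num.sqrt ((series (fun n => Re (u n)) k - series (fun n => Re (u n)) N) ^+ 2 +
        (series (fun n => Im (u n)) k - series (fun n => Im (u n)) N) ^+ 2).
    move=> Nk; rewrite normc_sqrt Re_sum Im_sum.
    by rewrite !(sum_nat_series _ Nk).
  rewrite (_ : normc D = Num.sqrt ((limn (series (fun n => Re (u n))) - series (fun n => Re (u n)) N) ^+ 2 +
        (limn (series (fun n => Im (u n))) - series (fun n => Im (u n)) N) ^+ 2)); last first.
    by rewrite normc_sqrt /D !cReD !cImD !cReN !cImN Re_sum Im_sum /series /= !big_mkord.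
  apply: (@cvg_trans _ ((fun k => Num.sqrt ((series (fun n => Re (u n)) k - series (fun n => Re (u n)) N) ^+ 2 +
        (series (fun n => Im (u n)) k - series (fun n => Im (u n)) N) ^+ 2)) @ \oo)).
    by apply: near_eq_cvg; near=> k; rewrite e//; near: k; exists N.
  apply: continuous_cvg; first exact: sqrt_continuous.
  by apply: cvgD; rewrite expr2; under eq_fun do rewrite expr2; apply: cvgM;
    apply: cvgB => //; exact: cvg_cst.
apply: (cvgr_to_le hlim); near=> k.
have Nk : (N <= k)%N by near: k; exists N.
apply: (le_trans (normc_sum _ _ _)); rewrite lerBrDl.
apply: le_trans (series_normc_le k su).
by rewrite (sum_nat_series (fun n => normc (u n)) Nk) subrKC.
Unshelve. all: by end_near. Qed.

Lemma normc_csum u : csummable u ->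
  normc (csum u) <= limn (series (fun n => normc (u n))).
Proof.
move=> su; have := csum_partial 0 su.
by rewrite big_ord0 subr0 /series /= big_nil subr0.
Qed.

Lemma csumZ (c : R) u : csummable u -> csum (fun n => c%:C * u n) = c%:C * csum u.
Proof.
move=> su; apply: complex_eq; rewrite ?Re_realM ?Im_realM /=.
  rewrite -[RHS](lim_seriesZ c (csummable_Re su)); congr (limn (series _)).
  by apply/funext => n; rewrite Re_realM.
rewrite -[RHS](lim_seriesZ c (csummable_Im su)); congr (limn (series _)).
by apply/funext => n; rewrite Im_realM.
Qed.

Lemma cmeas_csum d (T : measurableType d) (u : nat -> T -> R[i]) :
  (forall n, cmeas (u n)) -> (forall x, csummable (u ^~ x)) ->
  cmeas (fun x => csum (u ^~ x)).
Proof.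
move=> mu su; split.
  apply: (@measurable_fun_cvg _ _ _ _ (fun N x => series (fun n => Re (u n x)) N)).
    move=> N; rewrite /series /=.
    by apply: measurable_sum => n; case: (mu n).
  by move=> x _; exact: csummable_Re (su x).
apply: (@measurable_fun_cvg _ _ _ _ (fun N x => series (fun n => Im (u n x)) N)).
  move=> N; rewrite /series /=.
  by apply: measurable_sum => n; case: (mu n).
by move=> x _; exact: csummable_Im (su x).
Qed.

(* Tannery's theorem for truncated multipliers. *)
Lemma cvg_csum_multiplier u (rho : nat -> nat -> R) (N : nat -> nat) :
  csummable u -> (forall j n, 0 <= rho j n <= 1) ->
  (forall j n, (n < j)%N -> 1 - j.+1%:R^-1 <= rho j n) ->
  (forall j, j <= N j)%N ->
  normc (\sum_(n < N j) (rho j n)%:C * u n) @[j --> \oo] --> normc (csum u).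
Proof.
move=> su rho01 rho1 jN; set S := series (fun n => normc (u n)).
have cS : S @ \oo --> limn S by [].
have key j : `|normc (csum u) - normc (\sum_(n < N j) (rho j n)%:C * u n)| <=
    j.+1%:R^-1 * limn S + (limn S - S j).
  apply: (@le_trans _ _ (normc (csum u - \sum_(n < N j) (rho j n)%:C * u n))).
    exact: norm_normcB.
  rewrite (_ : csum u - _ = (csum u - \sum_(n < N j) u n) +
     \sum_(n < N j) (1 - rho j n)%:C * u n); last first.
    have -> : \sum_(n < N j) (1 - rho j n)%:C * u n =
        \sum_(n < N j) u n - \sum_(n < N j) (rho j n)%:C * u n.
      by rewrite -sumrB; apply: eq_bigr => n _; rewrite rmorphB /= mulrBl mul1r.
    by rewrite addrA subrK.
  apply: (le_trans (normcD _ _)).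
  have h1 := csum_partial (N j) su.
  apply: (le_trans (lerD h1 (lexx _))); rewrite -/S.
  have h2 : normc (\sum_(n < N j) (1 - rho j n)%:C * u n) <= j.+1%:R^-1 * S j + (S (N j) - S j).
    apply: (le_trans (normc_sum _ _ _)).
    rewrite -(big_mkord xpredT (fun n => normc ((1 - rho j n)%:C * u n))).
    rewrite (@big_cat_nat _ _ _ j 0 (N j))//=; apply: lerD.
      rewrite /S /series /= mulr_sumr !big_mkord; apply: ler_sum => n _.
      have /andP[r0 r1] := rho01 j n.
      rewrite normc_realM ger0_norm ?subr_ge0// ler_wpM2r ?normc_ge0//.
      by rewrite lerBlDr -lerBlDl rho1.
    rewrite -(sum_nat_series _ (jN j)).
    apply: ler_sum => n _.
    have /andP[r0 r1] := rho01 j n.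
    rewrite normc_realM ger0_norm ?subr_ge0// ler_piMl ?normc_ge0//.
    by rewrite gerBl.
  apply: (le_trans (lerD (lexx _) h2)).
  rewrite addrCA (addrA _ (S (N j))) subrK lerD2r ler_wpM2l ?invr_ge0//.
  exact: series_normc_le.
apply/cvgrPdist_le => e e0; have e2 : 0 < e / 2 by rewrite divr_gt0.
have c1 : (j.+1%:R^-1 * limn S) @[j --> \oo] --> (0 : R).
  by rewrite -[X in _ --> X](mul0r (limn S)); apply: cvgMr_tmp; exact: cvg_harmonic.
have /cvgrPdist_le/(_ _ e2) h1 := c1.
have /cvgrPdist_le/(_ _ e2) h2 := cS.
near=> j; apply: (le_trans (key j)); rewrite [leRHS](splitr e); apply: lerD.
  have : `|0 - j.+1%:R^-1 * limn S| <= e / 2 by near: j.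
  by rewrite sub0r normrN; apply: le_trans; rewrite ler_norm.
have : `|limn S - S j| <= e / 2 by near: j.
by apply: le_trans; rewrite ler_norm.
Unshelve. all: by end_near. Qed.

End complex_series.

(** * Integral mixtures of functions on the group *)

Section fubini_complex.
Context d1 d2 (T1 : measurableType d1) (T2 : measurableType d2) (R : realType).
Variables (m1 : {sigma_finite_measure set T1 -> \bar R})
  (m2 : {sigma_finite_measure set T2 -> \bar R}).

Lemma measurable_Rintegral (f : T1 * T2 -> R) :
  (m1 \x m2)%E.-integrable setT (EFin \o f) ->
  measurable_fun setT (fun x => \int[m2]_y f (x, y)).
Proof.
move=> fi; apply: measurableT_comp; last exact: (measurable_fubini_F fi).
exact: fine_measurable.
Qed.

(** The inner real integrals are [fine] of extended ones that are finite only almost everywhere, so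
    Fubini's theorem is reached through almost everywhere equality on both sides. *)
Lemma Rintegral_fubini (f : T1 * T2 -> R) :
  (m1 \x m2)%E.-integrable setT (EFin \o f) ->
  \int[m1]_x (\int[m2]_y f (x, y)) = \int[m2]_y (\int[m1]_x f (x, y)).
Proof.
move=> fi; rewrite /Rintegral; congr fine.
transitivity (\int[m1]_x \int[m2]_y (f (x, y))%:E)%E.
  apply: ae_eq_integral => //.
  - by apply/measurable_EFinP; exact: measurable_Rintegral.
  - exact: (measurable_fubini_F fi).
  - apply: filterS (ae_integrable1 fi) => x h _.
    by rewrite fineK//; exact: (integrable_fin_num measurableT h).
rewrite (Fubini fi); apply/esym; apply: ae_eq_integral => //.
- apply/measurable_EFinP; apply: measurableT_comp; last exact: (measurable_fubini_G fi).
  exact: fine_measurable.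
- exact: (measurable_fubini_G fi).
- apply: filterS (ae_integrable2 fi) => x h _.
  by rewrite fineK//; exact: (integrable_fin_num measurableT h).
Qed.

Context (F : T1 * T2 -> R[i]).
Context (mF : cmeas F).
Context (iF : (\int[m2]_y \int[m1]_x (normc (F (x, y)))%:E < +oo)%E).

Lemma fubini_integrable_Re : (m1 \x m2)%E.-integrable setT (EFin \o (fun z => Re (F z))).
Proof.
have mn := measurable_normc mF.
have ni : (m1 \x m2)%E.-integrable setT (EFin \o (fun z => normc (F z))).
  apply/integrable21ltyP; first exact/measurable_EFinP.
  apply: le_lt_trans iF; rewrite le_eqVlt; apply/orP; left; apply/eqP.
  apply: eq_integral => y _; apply: eq_integral => x _ /=.
  by rewrite ger0_norm ?normc_ge0.
apply: le_integrable ni => //; first by apply/measurable_EFinP; case: mF.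
by move=> z _ /=; rewrite lee_fin (ger0_norm (normc_ge0 _)) normc_Re.
Qed.

Lemma fubini_integrable_Im : (m1 \x m2)%E.-integrable setT (EFin \o (fun z => Im (F z))).
Proof.
have mn := measurable_normc mF.
have ni : (m1 \x m2)%E.-integrable setT (EFin \o (fun z => normc (F z))).
  apply/integrable21ltyP; first exact/measurable_EFinP.
  apply: le_lt_trans iF; rewrite le_eqVlt; apply/orP; left; apply/eqP.
  apply: eq_integral => y _; apply: eq_integral => x _ /=.
  by rewrite ger0_norm ?normc_ge0.
apply: le_integrable ni => //; first by apply/measurable_EFinP; case: mF.
by move=> z _ /=; rewrite lee_fin (ger0_norm (normc_ge0 _)) normc_Im.
Qed.

Lemma ae_cintegrable_fubini : {ae m1, forall x, cintegrable m2 (fun y => F (x, y))}.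
Proof.
have mn := measurable_normc mF.
have ni : (m1 \x m2)%E.-integrable setT (EFin \o (fun z => normc (F z))).
  apply/integrable21ltyP; first exact/measurable_EFinP.
  apply: le_lt_trans iF; rewrite le_eqVlt; apply/orP; left; apply/eqP.
  apply: eq_integral => y _; apply: eq_integral => x _ /=.
  by rewrite ger0_norm ?normc_ge0.
apply: filterS (ae_integrable1 ni) => x /integrableP[_ h]; split.
  by case: mF => h1 h2; split; [exact: (measurableT_comp h1)|exact: (measurableT_comp h2)].
apply: le_lt_trans h; rewrite le_eqVlt; apply/orP; left; apply/eqP.
by apply: eq_integral => y _ /=; rewrite ger0_norm ?normc_ge0.
Qed.

Lemma cmeas_cint_fubini : cmeas (fun x => cint m2 (fun y => F (x, y))).
Proof.
split; first exact: (measurable_Rintegral fubini_integrable_Re).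
exact: (measurable_Rintegral fubini_integrable_Im).
Qed.

Lemma cint_fubini : cint m1 (fun x => cint m2 (fun y => F (x, y))) =
  cint m2 (fun y => cint m1 (fun x => F (x, y))).
Proof.
apply: complex_eq => /=.
  exact: (Rintegral_fubini fubini_integrable_Re).
exact: (Rintegral_fubini fubini_integrable_Im).
Qed.

(** This holds at every x and not just almost everywhere: where the section is not integrable, the
    right-hand side is +oo. *)
Lemma normc_cint_fubini x :
  ((normc (cint m2 (fun y => F (x, y))))%:E <= \int[m2]_y (normc (F (x, y)))%:E)%E.
Proof.
have [->|ne] := eqVneq (\int[m2]_y (normc (F (x, y)))%:E)%E +oo%E; first by rewrite leey.
apply: normc_cint; split; last by rewrite ltey.
by case: mF => h1 h2; split; [exact: (measurableT_comp h1)|exact: (measurableT_comp h2)].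
Qed.

End fubini_complex.

Lemma ae_eq_cint d (T : measurableType d) (R : realType)
    (mu : {measure set T -> \bar R}) (f g : T -> R[i]) : cmeas f -> cmeas g ->
  {ae mu, forall x, f x = g x} -> cint mu f = cint mu g.
Proof.
move=> [f1 f2] [g1 g2] fg; apply: complex_eq; rewrite /= /Rintegral; congr fine.
  apply: ae_eq_integral => //; try exact/measurable_EFinP.
  by apply: filterS fg => x -> _.
apply: ae_eq_integral => //; try exact/measurable_EFinP.
by apply: filterS fg => x -> _.
Qed.

Section mixture.
Context (R : realType) (G : topologicalZmodType) (mu : probability (borel G) R).
Context (hmu : is_haar mu).
Context d (Y : measurableType d) (nu : {sigma_finite_measure set Y -> \bar R}).
Context (F : borel G * Y -> R[i]) (w : Y -> R) (r W : R).
Hypotheses (r1 : 1 <= r) (mF : cmeas F) (mw : measurable_fun setT w)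
  (w0 : forall y, 0 < w y) (W0 : 0 < W) (wW : (\int[nu]_y (w y)%:E <= W%:E)%E)
  (hF : forall y, Lball mu r%:E (w y) (fun x => F (x, y))).

(** Used with Lebesgue measure to integrate Q_s over s, and with counting measure to superpose
    polynomials in the lower bound for S_2. *)
Definition mixture (x : borel G) : R[i] := cint nu (fun y => F (x, y)).

Lemma mixture_integrable : (\int[nu]_y \int[mu]_x (normc (F (x, y)))%:E < +oo)%E.
Proof.
have mn := measurable_normc mF.
apply: (@le_lt_trans _ _ W%:E); last exact: ltry.
apply: le_trans wW; apply: ge0_le_integral => //.
- by move=> y _; apply: integral_ge0 => x _; rewrite lee_fin normc_ge0.
- apply: (measurable_fun_fubini_tonelli_G (fun z => (normc (F z))%:E)).
    exact/measurable_EFinP.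
  by move=> z; rewrite lee_fin normc_ge0.
- exact/measurable_EFinP.
- move=> y _; have := @Lball_le _ _ _ mu 1 r%:E (w y) (fun x => F (x, y)) (lexx _).
  rewrite lee_fin => /(_ r1 (ltW (w0 y)) (hF y)) [_].
  rewrite Lnorm1; apply: le_trans.
  rewrite le_eqVlt; apply/orP; left; apply/eqP; apply: eq_integral => x _ /=.
  by rewrite ger0_norm ?normc_ge0.
Qed.

Lemma fourier_mixture psi : is_character psi ->
  fourier mu mixture psi = cint nu (fun y => fourier mu (fun x => F (x, y)) psi).
Proof.
move=> hpsi.
pose H (z : borel G * Y) := conjc (psi z.1) * F z.
have mH : cmeas H.
  apply: cmeasM => //; apply: cmeas_conjc.
  have [h1 h2] := cmeas_character hpsi.
  by split; [exact: (measurableT_comp h1)|exact: (measurableT_comp h2)].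
have iH : (\int[nu]_y \int[mu]_x (normc (H (x, y)))%:E < +oo)%E.
  apply: le_lt_trans mixture_integrable; rewrite le_eqVlt; apply/orP; left; apply/eqP.
  apply: eq_integral => y _; apply: eq_integral => x _.
  by rewrite /H Normc.normcM normc_conjc (character_unimodular hpsi) mul1r.
rewrite fourierE; transitivity (cint mu (fun x => cint nu (fun y => H (x, y)))).
  apply: ae_eq_cint.
  - apply: cmeasM; last exact: (cmeas_cint_fubini mF mixture_integrable).
    by apply: cmeas_conjc; exact: cmeas_character.
  - exact: (cmeas_cint_fubini mH iH).
  - apply: filterS (ae_cintegrable_fubini mF mixture_integrable) => x h.
    by rewrite /H /= cintZ.
rewrite (cint_fubini mH iH); apply: eq_cint => y; by rewrite fourierE.
Qed.

(** Minkowski's integral inequality. Jensen's inequality for the weight w/W, of mass at most one,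
    bounds |mixture|^r by W^(r-1) times the integral of w^(1-r) |F|^r. By Tonelli's theorem the
    integral of this over the group is at most W^(r-1) times that of w, hence at most W^r. *)
Lemma Lball_mixture : Lball mu r%:E W mixture.
Proof.
have mn := measurable_normc mF.
split; first exact: (cmeas_cint_fubini mF mixture_integrable).
apply/Lnorm_finP => //; first exact: ltW.
pose U (z : borel G * Y) := W `^ (r - 1) * (w z.2 `^ (1 - r) * normc (F z) `^ r).
have r0 : 0 < r by exact: lt_le_trans r1.
have U0 z : 0 <= U z by rewrite !mulr_ge0 ?powR_ge0.
have mU : measurable_fun setT U.
  apply: measurable_funM => //; apply: measurable_funM; last exact: measurable_powRl.
  by apply: measurable_powRl; exact: measurableT_comp.
have key x : ((normc (mixture x) `^ r)%:E <= \int[nu]_y (U (x, y))%:E)%E.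
  have V0 : (0 <= \int[nu]_y (U (x, y))%:E)%E.
    by apply: integral_ge0 => y _; rewrite lee_fin.
  move: V0; case VE : (\int[nu]_y (U (x, y))%:E)%E => [V| |//]; last by move=> _; rewrite leey.
  rewrite !lee_fin => V0.
  rewrite (_ : V = (V `^ r^-1) `^ r); last by rewrite -powRrM mulVf ?gt_eqF// powRr1.
  rewrite ge0_ler_powR ?nnegrE ?normc_ge0 ?powR_ge0 ?(ltW r0)//.
  rewrite -lee_fin; apply: (le_trans (normc_cint_fubini nu mF x)).
  have -> : (\int[nu]_y (normc (F (x, y)))%:E =
      \int[nu]_y ((W * (w y)^-1 * normc (F (x, y))) * (W^-1 * w y))%:E)%E.
    apply: eq_integral => y _; congr EFin; field.
    by rewrite !gt_eqF.
  apply: (@jensen_powR _ _ _ nu (fun y => W * (w y)^-1 * normc (F (x, y))) (fun y => W^-1 * w y) r) => //.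
  - apply: measurable_funM; last by apply: (measurableT_comp mn).
    apply: measurable_funM => //.
    under eq_fun => y do rewrite -(powR_inv1 (ltW (w0 y))).
    exact: measurable_powRl.
  - exact: measurable_funM.
  - move=> y; apply: mulr_ge0; last exact: normc_ge0.
    by apply: mulr_ge0; rewrite ?invr_ge0; exact: ltW.
  - by move=> y; apply: mulr_ge0; rewrite ?invr_ge0; exact: ltW.
  - exact: powR_ge0.
  - under eq_integral do rewrite EFinM.
    rewrite ge0_integralZl//; first last.
    + by rewrite lee_fin invr_ge0; exact: ltW.
    + by move=> y _; rewrite lee_fin ltW.
    + exact/measurable_EFinP.
    apply: (le_trans (lee_wpmul2l _ wW)); first by rewrite lee_fin invr_ge0; exact: ltW.
    by rewrite -EFinM mulVf ?gt_eqF.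
  - rewrite -powRrM mulVf ?gt_eqF// powRr1// -VE le_eqVlt; apply/orP; left; apply/eqP.
    apply: eq_integral => y _; congr EFin; rewrite /U /=.
    have wy := w0 y.
    rewrite powRM ?mulr_ge0 ?invr_ge0 ?normc_ge0 ?(ltW W0) ?(ltW wy)//.
    rewrite powRM ?invr_ge0 ?(ltW W0) ?(ltW wy)// -(powR_inv1 (ltW wy)) -powRrM mulN1r.
    rewrite !powRB ?(gt_eqF W0) ?(gt_eqF wy) ?implybT// !powRr1 ?(ltW W0) ?(ltW wy)//.
    rewrite powRN; field.
    by rewrite !gt_eqF ?powR_gt0.
apply: (@le_trans _ _ (\int[mu]_x \int[nu]_y (U (x, y))%:E)%E).
  apply: ge0_le_integral => //.
  - by move=> x _; rewrite lee_fin powR_ge0.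
  - apply/measurable_EFinP; apply: measurable_powRl; apply: measurable_normc.
    exact: (cmeas_cint_fubini mF mixture_integrable).
  - apply: (measurable_fun_fubini_tonelli_F (fun z => (U z)%:E)).
      exact/measurable_EFinP.
    by move=> z; rewrite lee_fin.
rewrite (fubini_tonelli (fun z => (U z)%:E)); first last.
- by move=> z; rewrite lee_fin.
- exact/measurable_EFinP.
apply: (@le_trans _ _ (\int[nu]_y ((W `^ (r - 1))%:E * (w y)%:E))%E).
  apply: ge0_le_integral => //.
  - by move=> y _; apply: integral_ge0 => x _; rewrite lee_fin.
  - apply: (measurable_fun_fubini_tonelli_G (fun z => (U z)%:E)).
      exact/measurable_EFinP.
    by move=> z; rewrite lee_fin.
  - by apply/measurable_EFinP; exact: measurable_funM.
  - move=> y _; have wy := w0 y; have [_ /(Lnorm_finP _ _ r1 (ltW wy)) hy] := hF y.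
    have -> : (\int[mu]_x (U (x, y))%:E =
      \int[mu]_x ((W `^ (r - 1) * w y `^ (1 - r))%:E * (normc (F (x, y)) `^ r)%:E))%E.
      by apply: eq_integral => x _; rewrite -EFinM /U mulrA.
    rewrite ge0_integralZl//; first last.
    + by rewrite lee_fin mulr_ge0 ?powR_ge0.
    + by move=> x _; rewrite lee_fin powR_ge0.
    + apply/measurable_EFinP; apply: measurable_powRl.
      by apply: measurable_normc; case: (hF y).
    apply: (le_trans (lee_wpmul2l _ hy)); first by rewrite lee_fin mulr_ge0 ?powR_ge0.
    rewrite -!EFinM lee_fin -mulrA -powRD ?(gt_eqF wy) ?implybT// subrK.
    by rewrite powRr1 ?(ltW wy).
rewrite ge0_integralZl//; first last.
- by rewrite lee_fin powR_ge0.
- by move=> y _; rewrite lee_fin ltW.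
- exact/measurable_EFinP.
apply: (le_trans (lee_wpmul2l _ wW)); first by rewrite lee_fin powR_ge0.
rewrite -EFinM lee_fin powRB ?(gt_eqF W0) ?implybT// powRr1 ?(ltW W0)//.
by rewrite mulfVK ?gt_eqF.
Qed.

End mixture.

(** * Interpolation of abscissas *)

Section gauss_integrals.
Context (R : realType).
Let leb := @lebesgue_measure R.

(** The standard normal density, so that integration over the centre of the Gaussian gives one. *)
Definition ngauss (v : R) : R := normal_peak 1 * gauss v.

Lemma ngauss_pdf m s : ngauss (m - s) = normal_pdf m 1 s.
Proof.
rewrite /ngauss /gauss normal_pdfE ?oner_neq0// /normal_fun; congr (_ * expR _).
by rewrite expr1n -(sqrrN (s - m)) opprB mulNr.
Qed.

Lemma ngauss_ge0 v : 0 <= ngauss v.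
Proof. by rewrite mulr_ge0 ?normal_peak_ge0// expR_ge0. Qed.

Lemma measurable_ngauss m : measurable_fun [set: R] (fun s : R => ngauss (m - s)).
Proof. by under eq_fun do rewrite ngauss_pdf; exact: measurable_normal_pdf. Qed.

Lemma cint_ngauss m (z : R[i]) : cint leb (fun s : R => (ngauss (m - s))%:C * z) = z.
Proof.
have i1 := integral_normal_pdf m (1 : R).
have ci : cintegrable leb (fun s : R => (ngauss (m - s))%:C).
  split; first by apply: cmeas_real; exact: measurable_ngauss.
  under eq_integral do rewrite normc_real (ger0_norm (ngauss_ge0 _)) ngauss_pdf.
  by rewrite i1 ltry.
under eq_cint do rewrite mulrC.
rewrite cintZ// -[RHS]mulr1; congr (_ * _); apply: complex_eq => /=.
  rewrite /Rintegral; under eq_integral do rewrite ngauss_pdf.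
  by rewrite i1.
by rewrite Rintegral_cst// mul0r.
Qed.

(** By symmetry this is twice the integral over the half-line, and d e^{-ds} is the exponential
    density there. *)
Lemma integral_expR_norm (d : R) : 0 < d ->
  (\int[leb]_s (expR (- d * `|s|))%:E = (2 / d)%:E)%E.
Proof.
move=> d0; rewrite (ge0_symfun_integralT (f := fun s => expR (- d * `|s|))).
- rewrite EFinM; congr (_ * _)%E.
  rewrite integral_mkcond; transitivity (\int[leb]_s ((d^-1)%:E * (exponential_pdf d s)%:E))%E.
    apply: eq_integral => s _; rewrite /exponential_pdf !patchE set_itvcy.
    case: ifPn => [|_]; last by rewrite mule0.
    rewrite inE /= => s0; rewrite -EFinM mulrA mulVf ?gt_eqF// mul1r ger0_norm//.
  rewrite ge0_integralZl//; first last.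
  + by rewrite lee_fin invr_ge0 ltW.
  + by move=> s _; rewrite lee_fin exponential_pdf_ge0// ltW.
  + by apply/measurable_EFinP; exact: measurable_exponential_pdf.
  by rewrite integral_exponential_pdf// mule1.
- by move=> s; exact: expR_ge0.
- move=> s; apply: continuous_comp; last exact: continuous_expR.
  by apply: cvgMl_tmp; exact: norm_continuous.
- by move=> s /=; rewrite normrN.
Qed.

End gauss_integrals.

Section Lp_spaces.
Context (R : realType) (G : topologicalZmodType) (mu : probability (borel G) R).
Implicit Types (f : borel G -> R[i]).

Lemma in_Lp_Lball (p : \bar R) f : in_Lp mu p f <-> exists2 M, 0 < M & Lball mu p M f.
Proof.
split=> [[m1 m2 h]|[M M0 [[m1 m2] h]]]; last first.
  by split=> //; apply: le_lt_trans h _; rewrite ltry.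
have L0 := Lnorm_ge0 mu p (fun x => (normc (f x))%:E).
(* The added 1 keeps the radius positive when the norm is 0; interpolation takes negative powers of
   radii. *)
exists (fine (Lnorm mu p (fun x => (normc (f x))%:E)) + 1).
  by rewrite ltr_pwDr// fine_ge0.
split=> //; rewrite EFinD fineK ?ge0_fin_numE//.
by rewrite leeDl// lee_fin.
Qed.

Lemma Lball_integral_le (p : \bar R) M f : (1 <= p)%E -> 0 <= M -> Lball mu p M f ->
  (\int[mu]_x (normc (f x))%:E <= M%:E)%E.
Proof.
move=> p1 M0 hf; have [_] := Lball_le (lexx 1%E) p1 M0 hf.
rewrite Lnorm1; apply: le_trans.
rewrite le_eqVlt; apply/orP; left; apply/eqP; apply: eq_integral => x _ /=.
by rewrite ger0_norm ?normc_ge0.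
Qed.

Lemma Lball_cintegrable (p : \bar R) M f : (1 <= p)%E -> 0 <= M -> Lball mu p M f ->
  cintegrable mu f.
Proof.
move=> p1 M0 hf; split; first by case: hf.
by apply: le_lt_trans (Lball_integral_le p1 M0 hf) _; rewrite ltry.
Qed.

Lemma normc_fourier (p : \bar R) M f psi : (1 <= p)%E -> 0 <= M -> Lball mu p M f ->
  is_character psi -> normc (fourier mu f psi) <= M.
Proof.
move=> p1 M0 hf hpsi; have fi := Lball_cintegrable p1 M0 hf.
rewrite -lee_fin fourierE.
apply: le_trans (normc_cint (cintegrable_fourier hpsi fi)) _.
apply: le_trans (Lball_integral_le p1 M0 hf).
rewrite le_eqVlt; apply/orP; left; apply/eqP; apply: eq_integral => x _.
by rewrite Normc.normcM normc_conjc (character_unimodular hpsi) mul1r.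
Qed.

End Lp_spaces.

Section absolutely_convergent.
Context (R : realType) (lam : nat -> R) (hlam : is_frequency lam)
  (G : dirichlet_group lam).
Let mu := dhaar G.
Let hmu : is_haar mu := dhaarP G.
Implicit Types (b : nat -> R[i]).

Definition qser b (x : G) : R[i] := csum (fun n => b n * dchar G n x).

Lemma normc_dchar n x : normc (dchar G n x) = 1.
Proof. exact/character_unimodular/dcharP. Qed.

Lemma normc_qterm b x : (fun n => normc (b n * dchar G n x)) = (fun n => normc (b n)).
Proof. by apply/funext => n; rewrite Normc.normcM normc_dchar mulr1. Qed.

Lemma csummable_q b x : csummable b -> csummable (fun n => b n * dchar G n x).
Proof. by rewrite /csummable normc_qterm. Qed.

Lemma cmeas_qser b : csummable b -> cmeas (qser b : borel G -> R[i]).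
Proof.
move=> sb; apply: (@cmeas_csum _ _ (borel G) (fun n x => b n * dchar G n x)).
  move=> n; apply: cmeasM; first exact: cmeas_cst.
  exact/cmeas_character/dcharP.
by move=> x; exact: csummable_q.
Qed.

Lemma normc_qser b x : csummable b ->
  normc (qser b x) <= limn (series (fun n => normc (b n))).
Proof.
move=> sb; have := normc_csum (@csummable_q _ x sb).
by rewrite normc_qterm.
Qed.

Lemma fourier_dpoly N b psi : is_character psi ->
  fourier mu (dpoly G N b) psi = \sum_(n < N) b n * (`[< dchar G n = psi >])%:R.
Proof.
move=> hpsi.
have ci n : cintegrable mu (fun x => dchar G n x * conjc (psi x)).
  apply: cintegrable_character; apply: character_mul; first exact: dcharP.
  exact: character_conj.
transitivity (cint mu (fun x : borel G => \sum_(n < N) b n * (dchar G n x * conjc (psi x)))).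
  apply: eq_cint => x; rewrite /dpoly mulr_suml.
  by apply: eq_bigr => n _; rewrite mulrA.
rewrite cint_sum; last by move=> n; exact: cintegrableZ.
apply: eq_bigr => n _; rewrite cintZ//.
by rewrite (cint_character_mul hmu (dcharP G n) hpsi).
Qed.

(** The partial sums converge uniformly with error at most the tail of the moduli, and Fourier
    coefficients inherit this error since the measure has mass one. *)
Lemma fourier_qser_sub N b psi : is_character psi -> csummable b ->
  normc (fourier mu (qser b) psi - \sum_(n < N) b n * (`[< dchar G n = psi >])%:R) <=
  limn (series (fun n => normc (b n))) - series (fun n => normc (b n)) N.
Proof.
move=> hpsi sb; rewrite -fourier_dpoly// !fourierE.
set tail := limn _ - _.
have hq x : normc (qser b x - dpoly G N b x) <= tail.
  have := csum_partial N (@csummable_q _ x sb).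
  by rewrite normc_qterm.
have qi : cintegrable mu (qser b).
  by apply: cintegrable_bounded; [exact: cmeas_qser|move=> x; exact: normc_qser].
have di : cintegrable mu (dpoly G N b).
  apply: cintegrable_sum => n; apply: cintegrableZ.
  exact/cintegrable_character/dcharP.
have cq := cintegrable_fourier hpsi qi; have cd := cintegrable_fourier hpsi di.
rewrite -mulN1r -cintZ// -cintD//; last exact: cintegrableZ.
rewrite -lee_fin; apply: (le_trans (normc_cint _)).
  by apply: cintegrableD => //; exact: cintegrableZ.
apply: ae_integral_bound.
- exact: le_trans (normc_ge0 _) (hq 0).
- apply: measurable_normc; have [] := cintegrableD cq (cintegrableZ (-1) cd).
  by [].
- by move=> x; exact: normc_ge0.
- apply: aeW => x; rewrite mulN1r -mulrBr Normc.normcM normc_conjc.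
  by rewrite (character_unimodular hpsi) mul1r; exact: hq.
Qed.

Lemma series_tail_cvg0 b (c : R) : csummable b ->
  (\forall N \near \oo, c <= limn (series (fun n => normc (b n))) - series (fun n => normc (b n)) N) ->
  c <= 0.
Proof.
move=> sb; apply: (cvgr_to_ge (f := fun N => limn (series (fun n => normc (b n))) - series (fun n => normc (b n)) N)).
rewrite -[X in _ --> X](subrr (limn (series (fun n => normc (b n))))).
by apply: cvgB => //; exact: cvg_cst.
Qed.

Lemma fourier_qser b m : csummable b -> fourier mu (qser b) (dchar G m) = b m.
Proof.
move=> sb; apply/eqP; rewrite -subr_eq0 -normc_eq0 eq_le normc_ge0 andbT.
apply: (series_tail_cvg0 sb); near=> N.
have mN : (m < N)%N by near: N; exists m.+1.
have := fourier_qser_sub N (dcharP G m) sb.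
rewrite (bigD1 (Ordinal mN))//= (_ : `[< _ >] = true); last exact/asboolP.
rewrite mulr1 big1 ?addr0// => n nm.
rewrite (_ : `[< _ >] = false) ?mulr0//; apply/asboolPn => /(dchar_inj hlam) e.
by move/eqP: nm; apply; apply/val_inj.
Unshelve. all: by end_near. Qed.

Lemma fourier_qser0 b psi : csummable b -> is_character psi ->
  (forall n, psi <> dchar G n) -> fourier mu (qser b) psi = 0.
Proof.
move=> sb hpsi hn; apply/eqP; rewrite -normc_eq0 eq_le normc_ge0 andbT.
apply: (series_tail_cvg0 sb); near=> N.
have := fourier_qser_sub N hpsi sb.
rewrite big1 ?subr0// => n _.
by rewrite (_ : `[< _ >] = false) ?mulr0//; apply/asboolPn => e; exact: (hn n).
Unshelve. all: by end_near. Qed.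

(** The Fejer means of [f] are polynomials in the same ball, and the Gaussian multiplier keeps them
    there. Their multipliers tend to 1; as the damped series converges absolutely, Tannery's theorem
    gives the pointwise limit, which the Fejer means alone need not have. *)
Lemma Lball_gauss_series (f : borel G -> R[i]) (p : \bar R) (A s : R) :
  (1 <= p)%E -> 0 <= A -> Lball mu p A f -> spectrum_in f ->
  csummable (fun n => (gauss (lam n - s))%:C * fourier mu f (dchar G n)) ->
  Lball mu p A (qser (fun n => (gauss (lam n - s))%:C * fourier mu f (dchar G n))).
Proof.
move=> p1 A0 hf fs sb; have fi := Lball_cintegrable p1 A0 hf.
have /choice[rN hrN] : forall j : nat, exists rN : (nat -> R) * nat,
    [/\ forall n, 0 <= rN.1 n <= 1, forall n, (n < j)%N -> 1 - j.+1%:R^-1 <= rN.1 n,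
      (j <= rN.2)%N &
      Lball mu p A (dpoly G rN.2 (fun n => (rN.1 n)%:C * fourier mu f (dchar G n)))].
  move=> j; have e0 : (0 : R) < j.+1%:R^-1 by rewrite invr_gt0 ltr0n.
  have [rho [N [h1 h2 h3 h4]]] := fejer_approx hlam j e0 fi fs.
  by exists (rho, N); split=> //; exact: h4.
apply: (@Lball_lim _ (borel G) _ mu p A (fun j => dpoly G (rN j).2 (fun n =>
  (gauss (lam n - s))%:C * (((rN j).1 n)%:C * fourier mu f (dchar G n))))) => //.
- exact: cmeas_qser.
- by move=> j; apply: Lball_gauss => //; have [] := hrN j.
- move=> x; have sx := @csummable_q _ x sb.
  have := @cvg_csum_multiplier _ _ (fun j => (rN j).1) (fun j => (rN j).2) sx.
  have h1 j n : 0 <= (rN j).1 n <= 1 by have [] := hrN j.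
  have h2 j n : (n < j)%N -> 1 - j.+1%:R^-1 <= (rN j).1 n by have [_ + _ _] := hrN j; apply.
  have h3 j : (j <= (rN j).2)%N by have [] := hrN j.
  move=> /(_ h1 h2 h3) h; apply: cvg_trans h; apply: near_eq_cvg; apply: nearW => j.
  congr normc; apply: eq_bigr => n _; rewrite !mulrA; congr (_ * _ * _).
  by rewrite mulrC.
Qed.

End absolutely_convergent.
Arguments qser {R lam} G b x.

Lemma is_cvg_series_mul (R : realType) (u : nat -> R) (c : R) :
  cvgn (series u) -> cvgn (series (fun n => c * u n)).
Proof.
move=> cu; rewrite (_ : (fun n => _) = c *: u); first exact: is_cvg_seriesZ.
by apply/funext.
Qed.

(** * Interpolation between two Hardy spaces *)

Section interpolation.
Context (R : realType) (lam : nat -> R) (hlam : is_frequency lam)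
  (G : dirichlet_group lam).
Let mu := dhaar G.
Let hmu : is_haar mu := dhaarP G.
Local Notation leb := (@lebesgue_measure R).

(** A change of abscissa by [c] moves the centre of the Gaussian by [c], at the cost of a factor
    that does not depend on [l]. *)
Lemma gauss_shift (l s c : R) :
  expR (- (c * s) + c ^+ 2 / 2) * gauss (l - (s - c)) = expR (- (l * c)) * gauss (l - s).
Proof. by rewrite /gauss -!expRD; congr expR; field. Qed.

Lemma translateE (sg sg' : R) (a : nat -> R[i]) n :
  translate lam sg a n = (expR (- (lam n * (sg - sg'))))%:C * translate lam sg' a n.
Proof.
rewrite /translate mulrCA -rmorphM /= -expRD; congr (_ * (expR _)%:C); ring.
Qed.

(** The Gaussian beats every exponential: completing the square leaves e^{-kappa lambda_n} times the
    constant [D]. *)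
Lemma csummable_gauss (kappa A C s : R) (b : nat -> R[i]) :
  cvgn (series (fun n => expR (- (kappa * lam n)))) -> 0 <= A ->
  (forall n, normc (b n) <= A * expR (C * lam n)) ->
  csummable (fun n => (gauss (lam n - s))%:C * b n).
Proof.
move=> ck A0 bA; pose D := A * expR ((s + C + kappa) ^+ 2 / 2).
apply: (@csummable_le _ _ (fun n => D * expR (- (kappa * lam n)))); last first.
  exact: is_cvg_series_mul.
move=> n; rewrite normc_realM ger0_norm ?expR_ge0//.
apply: (le_trans (ler_wpM2l (expR_ge0 _) (bA n))).
rewrite mulrCA /D -mulrA ler_wpM2l// /gauss -!expRD ler_expR -subr_ge0.
rewrite (_ : _ - _ = (lam n - (s + C + kappa)) ^+ 2 / 2 + s ^+ 2 / 2); last by field.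
by rewrite addr_ge0// divr_ge0// sqr_ge0.
Qed.

Lemma in_HpP (p : \bar R) (a : nat -> R[i]) : in_Hp G p a <->
  exists f, [/\ in_Lp mu p f, spectrum_in f & forall n, a n = fourier mu f (dchar G n)].
Proof. by split. Qed.

Lemma in_Hp_interp (kappa : R) (a : nat -> R[i]) (p r : R) (q : \bar R)
    (qi th s1 s2 sg : R) :
  cvgn (series (fun n => expR (- (kappa * lam n)))) ->
  1 <= p -> p < r -> (r%:E < q)%E -> (q^-1 = qi%:E)%E ->
  0 < th < 1 -> r^-1 = th * p^-1 + (1 - th) * qi ->
  th * s1 + (1 - th) * s2 < sg -> sg < s2 ->
  in_Hp G p%:E (translate lam s1 a) -> in_Hp G q (translate lam s2 a) ->
  in_Hp G r%:E (translate lam sg a).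
Proof.
move=> ck p1 pr rq qiE th01 rE sg1 sg2.
move=> [f1 [/in_Lp_Lball[A1 A10 h1] fs1 aE1]] [f2 [/in_Lp_Lball[A2 A20 h2] fs2 aE2]].
have r1 : 1 <= r by exact/ltW/(le_lt_trans p1).
have q1 : (1 <= q)%E by apply: ltW; apply: le_lt_trans rq; rewrite lee_fin.
have p1E : (1 <= p%:E)%E by rewrite lee_fin.
have pk0 : (0 : R) < normal_peak 1 by rewrite normal_peak_gt0.
(* With the factor [normal_peak 1], integration over s returns [translate lam sg a] exactly. *)
pose c n := (normal_peak 1)%:C * translate lam sg a n.
pose b s n := (gauss (lam n - s))%:C * c n.
have cA n : normc (c n) <= normal_peak 1 * A1 * expR (- (sg - s1) * lam n).
  rewrite /c normc_realM ger0_norm ?(ltW pk0)// -mulrA ler_wpM2l ?(ltW pk0)//.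
  rewrite (translateE sg s1) normc_realM ger0_norm ?expR_ge0// mulrC.
  rewrite mulNr (mulrC (lam n)) ler_wpM2r ?expR_ge0// aE1.
  exact: normc_fourier p1E (ltW A10) h1 (dcharP G n).
have sb s : csummable (b s).
  apply: csummable_gauss ck _ cA; exact: ltW (mulr_gt0 pk0 A10).
(* One estimate for both endpoints: ([pp], [ss]) is (p, s1) or (q, s2), while the series [b s] is
   the same. *)
have ball (f : borel G -> R[i]) (pp : \bar R) (A ss s : R) : (1 <= pp)%E -> 0 < A ->
    Lball mu pp A f -> spectrum_in f ->
    (forall n, translate lam ss a n = fourier mu f (dchar G n)) ->
    Lball mu pp (normal_peak 1 * expR (- ((sg - ss) * s) + (sg - ss) ^+ 2 / 2) * A) (qser G (b s)).
  move=> pp1 A0 hf fs fE; set k := normal_peak 1 * _.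
  have k0 : 0 <= k by rewrite mulr_ge0 ?(ltW pk0) ?expR_ge0.
  have bE : b s = fun n => k%:C * ((gauss (lam n - (s - (sg - ss))))%:C * fourier mu f (dchar G n)).
    apply/funext => n; rewrite /b /c (translateE sg ss) -fE !mulrA -!rmorphM /=.
    have -> : gauss (lam n - s) * normal_peak 1 * expR (- (lam n * (sg - ss))) =
        k * gauss (lam n - (s - (sg - ss))).
      by rewrite /k -(mulrA _ (expR _)) gauss_shift; ring.
    by [].
  have sb' : csummable (fun n => (gauss (lam n - (s - (sg - ss))))%:C * fourier mu f (dchar G n)).
    apply: (@csummable_gauss kappa A 0) => //; first exact: ltW.
    move=> n; rewrite mul0r expR0 mulr1.
    exact: normc_fourier pp1 (ltW A0) hf (dcharP G n).
  have := Lball_scale k%:C pp1 (ltW A0) (Lball_gauss_series hlam pp1 (ltW A0) hf fs sb').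
  rewrite normc_real ger0_norm// => h; apply: (eq_ind _ (Lball mu pp (k * A)) h).
  apply/funext => x; rewrite /qser bE -csumZ; last exact: csummable_q.
  by congr csum; apply/funext => n; rewrite !mulrA.
pose K1 := normal_peak 1 * expR ((sg - s1) ^+ 2 / 2) * A1.
pose K2 := normal_peak 1 * expR ((sg - s2) ^+ 2 / 2) * A2.
have K10 : 0 < K1 by rewrite !mulr_gt0 ?expR_gt0.
have K20 : 0 < K2 by rewrite !mulr_gt0 ?expR_gt0.
have ball1 s : Lball mu p%:E (K1 * expR (- ((sg - s1) * s))) (qser G (b s)).
  have := ball f1 p%:E A1 s1 s p1E A10 h1 fs1 aE1.
  by rewrite expRD (mulrC (expR (- _))) mulrA mulrAC.
have ball2 s : Lball mu q (K2 * expR (- ((sg - s2) * s))) (qser G (b s)).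
  have := ball f2 q A2 s2 s q1 A20 h2 fs2 aE2.
  by rewrite expRD (mulrC (expR (- _))) mulrA mulrAC.
clearbody K1 K2.
pose eps := sg - (th * s1 + (1 - th) * s2).
have eps0 : 0 < eps by rewrite subr_gt0.
pose C1 := K1 `^ th * K2 `^ (1 - th).
have C10 : 0 < C1 by rewrite mulr_gt0 ?powR_gt0.
have ballr1 s : Lball mu r%:E (C1 * expR (- (eps * s))) (qser G (b s)).
  have := Lball_interp p1 pr rq qiE th01 rE _ _ (ball1 s) (ball2 s).
  rewrite !mulr_gt0 ?expR_gt0// => /(_ isT isT) h.
  apply: (eq_ind _ (fun M => Lball mu r%:E M (qser G (b s))) h).
  rewrite !powRM ?expR_ge0 ?(ltW K10) ?(ltW K20)// /C1 mulrACA; congr (_ * _).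
  rewrite /powR !expRK !gt_eqF ?expR_gt0// -expRD; congr expR; rewrite /eps; ring.
have ballr2 s : Lball mu r%:E (K2 * expR (- ((sg - s2) * s))) (qser G (b s)).
  apply: Lball_le (ball2 s); [by rewrite lee_fin|exact: ltW|].
  by rewrite mulr_ge0 ?expR_ge0 ?(ltW K20).
(* A decay rate for both half-lines: [ballr1] decays at rate [eps] for s >= 0, [ballr2] at rate s2 -
   sg for s < 0. *)
pose d := Num.min eps (s2 - sg).
have d0 : 0 < d by rewrite lt_min eps0 subr_gt0.
pose w (s : R) : R := (C1 + K2) * expR (- d * `|s|).
have ballw s : Lball mu r%:E (w s) (qser G (b s)).
  have [s0|s0] := leP 0 s.
    apply: LballS (ballr1 s).
    apply: (@le_trans _ _ (C1 * expR (- d * `|s|))).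
      rewrite ler_pM2l// ger0_norm// ler_expR mulNr lerN2 ler_wpM2r//.
      by rewrite ge_min lexx.
    by rewrite /w ler_pM2r ?expR_gt0// lerDl ltW.
  apply: LballS (ballr2 s).
  apply: (@le_trans _ _ (K2 * expR (- d * `|s|))).
    rewrite ler_pM2l// ltr0_norm// ler_expR mulrNN -mulNr opprB.
    by rewrite ler_wnM2r ?(ltW s0)// ge_min lexx orbT.
  by rewrite /w ler_pM2r ?expR_gt0// lerDr ltW.
have w0 s : 0 < w s.
  by apply: mulr_gt0; [exact: addr_gt0|exact: expR_gt0].
have mw : measurable_fun [set: R] w.
  apply: measurable_funM => //; apply: measurableT_comp => //.
  exact: measurable_funM.
pose W := (C1 + K2) * (2 / d).
have W0 : 0 < W by rewrite mulr_gt0 ?addr_gt0 ?divr_gt0.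
have wW : (\int[leb]_s (w s)%:E <= W%:E)%E.
  under eq_integral do rewrite EFinM.
  rewrite ge0_integralZl//; first last.
  - by rewrite lee_fin addr_ge0// ltW.
  - apply/measurable_EFinP; apply: measurableT_comp => //; exact: measurable_funM.
  by rewrite integral_expR_norm.
pose F (z : borel G * R) := qser G (b z.2) z.1.
have mF : cmeas F.
  apply: (@cmeas_csum _ _ _ (fun n (z : borel G * R) => b z.2 n * dchar G n z.1)).
    move=> n; apply: cmeasM.
      apply: cmeasM; last exact: cmeas_cst.
      apply: cmeas_real; apply: (measurableT_comp (f := fun s : R => gauss (lam n - s))) => //.
      rewrite /gauss; apply: measurableT_comp => //; apply: measurableT_comp => //.
      apply: measurable_funM => //; apply: measurable_funX.
      exact: measurable_funB.
    have [m1 m2] := cmeas_character (dcharP G n).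
    by split; [exact: (measurableT_comp m1)|exact: (measurableT_comp m2)].
  by move=> z; exact: csummable_q.
have hM := @Lball_mixture _ _ mu _ (measurableTypeR R) (@lebesgue_measure R) F w r W r1 mF mw w0 W0 wW ballw.
have fM psi := @fourier_mixture _ _ mu _ (measurableTypeR R) (@lebesgue_measure R) F w r W r1 mF mw w0 wW ballw psi.
exists (mixture leb F); split.
- by apply/in_Lp_Lball; exists W.
- move=> psi hpsi; rewrite fM// => ne.
  apply: contrapT => /forallNP hn; move/eqP: ne; apply.
  rewrite -[RHS](cint0 (@lebesgue_measure R)); apply: eq_cint => s.
  exact: (fourier_qser0 (sb s)).
- move=> n; rewrite fM; last exact: dcharP.
  rewrite -[LHS](cint_ngauss (lam n)); apply: eq_cint => s.
  rewrite [RHS](fourier_qser hlam G n (sb s)).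
  rewrite /b /c [RHS]mulrA -rmorphM /= /ngauss.
  by rewrite (mulrC (normal_peak 1)).
Qed.

End interpolation.

(** * The number L and the abscissas *)

Section frequency.
Context (R : realType) (lam : nat -> R) (hlam : is_frequency lam).

Lemma bounded_series_cvg (u : nat -> R) (M : R) : (forall n, 0 <= u n) ->
  (forall n, series u n <= M) -> cvgn (series u).
Proof.
move=> u0 uM; apply: nondecreasing_is_cvgn.
  by apply/nondecreasing_series => k _ _; exact: u0.
by exists M => _ [n _ <-]; exact: uM.
Qed.

Lemma cvg_series_shiftN (u v : nat -> R) N : (forall n, 0 <= u n) ->
  (forall n, 0 <= v n) ->
  (forall n, (N <= n)%N -> u n <= v n) -> cvgn (series v) -> cvgn (series u).
Proof.
move=> u0 v0 uv cv; apply: (@bounded_series_cvg _ (series u N + limn (series v))) => // n.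
have sv k : series v k <= limn (series v).
  by apply: nondecreasing_cvgn_le => //; apply/nondecreasing_series => i _ _; exact: v0.
have [nN|Nn] := leqP n N.
  apply: (@le_trans _ _ (series u N)).
    have h : {homo series u : m n / (m <= n)%N >-> m <= n}.
      by apply/nondecreasing_series => i _ _; exact: u0.
    exact: h.
  rewrite lerDl; apply: le_trans (sv 0%N); by rewrite /series /= big_nil.
rewrite -[leLHS](subrKC (series u N)) lerD2l -sum_nat_series ?(ltnW Nn)//.
apply: (@le_trans _ _ (\sum_(N <= k < n) v k)).
  by apply: ler_sum_nat => k /andP[Nk _]; exact: uv.
rewrite sum_nat_series ?(ltnW Nn)//; apply: le_trans (sv n).
rewrite gerBl /series /=; apply: sumr_ge0 => i _; exact: v0.
Qed.

(* Telescoping: c (n+2)^(-1-c) <= (n+1)^(-c) - (n+2)^(-c). *)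
Lemma cvg_pseries (p : R) : 1 < p -> cvgn (series (fun n => (n.+1%:R : R) `^ (- p))).
Proof.
move=> p1; pose c := p - 1; have c0 : 0 < c by rewrite subr_gt0.
have step (n : nat) : c * (n.+2%:R `^ (- p)) <= n.+1%:R `^ (- c) - n.+2%:R `^ (- c).
  have x0 : (0 : R) < n.+1%:R by rewrite ltr0n.
  have y0 : (0 : R) < n.+2%:R by rewrite ltr0n.
  rewrite lerBrDr.
  have -> : n.+2%:R `^ (- p) = n.+2%:R `^ (- c) / n.+2%:R :> R.
    rewrite -[X in _ / X](powRr1 (ltW y0)) -powRB ?(gt_eqF y0) ?implybT//.
    by congr (_ `^ _); rewrite /c; ring.
  have -> : n.+1%:R `^ (- c) = n.+2%:R `^ (- c) * (n.+1%:R / n.+2%:R) `^ (- c) :> R.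
    by rewrite -powRM ?divr_ge0 ?(ltW y0) ?(ltW x0)// mulrC divfK// gt_eqF.
  rewrite mulrCA -[X in _ + X]mulr1 -mulrDr ler_wpM2l ?powR_ge0//.
  set t := _ / _.
  have t0 : 0 < t by rewrite divr_gt0.
  have tE : n.+2%:R^-1 = 1 - t.
    have yE : n.+2%:R = n.+1%:R + 1 :> R by rewrite natr1.
    have y1 : n.+2%:R != 0 :> R by exact: lt0r_neq0.
    apply: (mulIf y1); rewrite mulVf// mulrBl mul1r divfK//.
    by rewrite yE addrAC subrr add0r.
  rewrite /powR gt_eqF//; apply: le_trans (expR_ge1Dx _).
  rewrite addrC lerD2l tE mulNr -mulrN ler_wpM2l ?(ltW c0)// lerNr opprB.
  have := @le_ln1Dx R (t - 1); rewrite subrKC; apply.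
  by rewrite ltrBrDl subrr.
have bnd N : c * \sum_(0 <= n < N) n.+2%:R `^ (- p) <= 1 :> R.
  apply: (@le_trans _ _ (\sum_(0 <= n < N) (n.+1%:R `^ (- c) - n.+2%:R `^ (- c)))).
    by rewrite mulr_sumr; apply: ler_sum => n _; exact: step.
  under eq_bigr do rewrite -opprB.
  rewrite sumrN telescope_sumr// opprB powR1.
  by rewrite gerBl powR_ge0.
have u0 (n : nat) : 0 <= n.+1%:R `^ (- p) :> R by exact: powR_ge0.
apply: (@bounded_series_cvg _ (1 + c^-1)) => // -[|N].
  by rewrite /series /= big_nil addr_ge0// invr_ge0 ltW.
rewrite /series /= big_nat_recl//= powR1 lerD2l -(ler_pM2l c0) mulfV ?gt_eqF//.
Qed.

Lemma freqL_ge0 : (0 <= freqL lam)%E.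
Proof.
apply: limf_esup_ge0 => [|n]; first by move=> [N _ /(_ N)]/=; apply.
rewrite lee_fin divr_ge0 ?(frequency_ge0 hlam)// ln_ge0// ler1n//.
Qed.

Lemma freqLE : freqL lam =
  ereal_inf (range (esups (fun n : nat => (ln (n.+1%:R : R) / lam n)%:E))).
Proof.
by rewrite /freqL limn_esup_lim; apply/cvg_lim => //; exact: cvg_esups_inf.
Qed.

Lemma lam_gt0 n : (0 < n)%N -> 0 < lam n.
Proof.
move=> n0; apply: le_lt_trans (frequency_ge0 hlam 0%N) _.
exact: (frequency_increasing hlam).
Qed.

Lemma freqL_lt (k : R) : (freqL lam < k%:E)%E ->
  exists N, forall n, (N <= n)%N -> ln n.+1%:R <= k * lam n.
Proof.
(* The index starts at N + 1 because [lam 0] may vanish and the quotient is cleared by a positive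
   [lam n]. *)
rewrite freqLE => /ereal_inf_lt[_ [N _ <-] hN]; exists N.+1 => n Nn.
have n0 : (0 < n)%N by exact: leq_ltn_trans Nn.
rewrite -ler_pdivrMr ?lam_gt0// -lee_fin; apply: ltW; apply: le_lt_trans hN.
by apply: ereal_sup_ubound; exists n => //=; exact: ltnW.
Qed.

Lemma lt_freqL (k : R) N : (k%:E < freqL lam)%E ->
  exists2 n, (N <= n)%N & k * lam n < ln n.+1%:R.
Proof.
move=> kL; apply: contrapT => h; move: kL; apply/negP; rewrite -leNgt freqLE.
apply: (@le_trans _ _ (esups (fun n : nat => (ln (n.+1%:R : R) / lam n)%:E) N.+1)).
  by apply: ereal_inf_lbound; exists N.+1.
apply: ge_ereal_sup => _ [n /= Nn <-]; rewrite lee_fin.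
rewrite ler_pdivrMr ?lam_gt0 ?(leq_ltn_trans _ Nn)// leNgt; apply/negP => hn.
by apply: h; exists n => //; exact: ltnW.
Qed.

(** For k' strictly between L and k, eventually n + 1 <= e^{k' lambda_n}; the terms are then at most
    (n + 1)^{-k/k'}, with k/k' > 1. *)
Lemma cvg_expR_lam (k : R) : (freqL lam < k%:E)%E ->
  cvgn (series (fun n => expR (- (k * lam n)))).
Proof.
move=> Lk; have : freqL lam \is a fin_num.
  by rewrite ge0_fin_numE ?freqL_ge0// (lt_trans Lk)// ltry.
move=> /fineK; set l := fine _ => lE; have l0 : 0 <= l by rewrite -lee_fin lE freqL_ge0.
rewrite -lE lte_fin in Lk.
pose k' := (l + k) / 2.
have lk' : l < k' by rewrite midf_lt.
have k'k : k' < k by rewrite midf_lt.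
have k'0 : 0 < k' by exact: le_lt_trans lk'.
have [|N hN] := @freqL_lt k'; first by rewrite -lE lte_fin.
have p1 : 1 < k / k' by rewrite ltr_pdivlMr// mul1r.
apply: (cvg_series_shiftN (N := N) _ _ _ (cvg_pseries p1)).
- by move=> n; exact: expR_ge0.
- by move=> n; exact: powR_ge0.
- move=> n Nn; rewrite /powR gt_eqF ?ltr0n// ler_expR mulNr lerN2.
  rewrite mulrAC ler_pdivrMr// -mulrA ler_wpM2l ?(ltW (lt_trans k'0 k'k))//.
  by rewrite mulrC hN.
Qed.

End frequency.

(** * Bessel's inequality *)

Section bessel.
Context (R : realType) (lam : nat -> R) (hlam : is_frequency lam)
  (G : dirichlet_group lam).
Let mu := dhaar G.
Let hmu : is_haar mu := dhaarP G.

Lemma cint_mul_dpoly (f : borel G -> R[i]) N c : cintegrable mu f ->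
  cint mu (fun x => f x * conjc (dpoly G N c x)) =
  \sum_(n < N) conjc (c n) * fourier mu f (dchar G n).
Proof.
move=> fi.
have ci n : cintegrable mu (fun x => conjc (dchar G n x) * f x).
  by apply: cintegrable_fourier => //; exact: dcharP.
transitivity (cint mu (fun x : borel G => \sum_(n < N) conjc (c n) * (conjc (dchar G n x) * f x))).
  apply: eq_cint => x; rewrite /dpoly rmorph_sum /= mulr_sumr.
  by apply: eq_bigr => n _; rewrite rmorphM /= mulrC mulrA.
rewrite cint_sum; last by move=> n; exact: cintegrableZ.
by apply: eq_bigr => n _; rewrite cintZ ?fourierE.
Qed.

Lemma cintegrable_dpoly N c : cintegrable mu (dpoly G N c).
Proof.
apply: cintegrable_sum => n; apply: cintegrableZ.
exact/cintegrable_character/dcharP.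
Qed.

Lemma fourier_dpoly_dchar N c m : (m < N)%N ->
  fourier mu (dpoly G N c) (dchar G m) = c m.
Proof.
move=> mN; rewrite fourier_dpoly; last exact: dcharP.
rewrite (bigD1 (Ordinal mN))//= (_ : `[< _ >] = true); last exact/asboolP.
rewrite mulr1 big1 ?addr0// => n nm.
rewrite (_ : `[< _ >] = false) ?mulr0//; apply/asboolPn => /(dchar_inj hlam) e.
by move/eqP: nm; apply; apply/val_inj.
Qed.

Lemma normc_dpoly N c (x : G) : normc (dpoly G N c x) <= \sum_(n < N) normc (c n).
Proof.
apply: (le_trans (normc_sum _ _ _)); apply: ler_sum => n _.
by rewrite Normc.normcM (character_unimodular (dcharP G n)) mulr1.
Qed.

Lemma cintegrable_sqr_dpoly N c :
  cintegrable mu (fun x => dpoly G N c x * conjc (dpoly G N c x)).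
Proof.
apply: (cintegrable_bound (M := \sum_(n < N) normc (c n))).
- by apply: sumr_ge0 => n _; exact: normc_ge0.
- apply: (le_cintegrable _ (cintegrable_dpoly N c)).
    by apply: cmeas_conjc; exact: cmeas_dpoly.
  by move=> x; rewrite normc_conjc.
- exact: cmeas_dpoly.
- exact: normc_dpoly.
Qed.

Lemma sqnorm_dpoly N c : sqnorm mu (dpoly G N c) = \sum_(n < N) normc (c n) ^+ 2.
Proof.
rewrite /sqnorm cint_mul_dpoly; last exact: cintegrable_dpoly.
rewrite Re_sum; apply: eq_bigr => n _.
by rewrite fourier_dpoly_dchar// mulrC mulc_conj.
Qed.

(** With P the partial sum of the Fourier series, S is the integral of Re (f conj P) and also of
    |P|^2. Pointwise Re (f conj P) <= (|f|^2 + |P|^2) / 2, hence S <= (A^2 + S) / 2. *)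
Lemma bessel (f : borel G -> R[i]) A N : 0 <= A -> Lball mu 2%:E A f ->
  \sum_(n < N) normc (fourier mu f (dchar G n)) ^+ 2 <= A ^+ 2.
Proof.
move=> A0 hf; pose c n := fourier mu f (dchar G n); set S := \sum_(n < N) _.
have l12 : (1 <= 2%:E :> \bar R)%E by rewrite lee_fin ler1n.
have fi := Lball_cintegrable l12 A0 hf.
have [mf /(Lnorm_finP _ _ (ler1n R 2) A0)] := hf; rewrite powR_mulrn// => hA.
have sqE : (\int[mu]_x (normc (f x) ^+ 2)%:E <= (A ^+ 2)%:E)%E.
  apply: le_trans hA; rewrite le_eqVlt; apply/orP; left; apply/eqP.
  by apply: eq_integral => x _; rewrite powR_mulrn ?normc_ge0.
pose g (x : borel G) := (normc (f x) ^+ 2)%:C.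
have gi : cintegrable mu g.
  split; first by apply: cmeas_real; apply: measurable_funX; exact: measurable_normc.
  under eq_integral do rewrite normc_real ger0_norm ?sqr_ge0//.
  by apply: le_lt_trans sqE _; rewrite ltry.
have SE : S = Re (cint mu (fun x => f x * conjc (dpoly G N c x))).
  rewrite cint_mul_dpoly// Re_sum; apply: eq_bigr => n _.
  by rewrite mulrC mulc_conj.
have fPi : cintegrable mu (fun x => f x * conjc (dpoly G N c x)).
  under eq_fun do rewrite mulrC.
  apply: (cintegrable_bound (M := \sum_(n < N) normc (c n))) => //.
  - by apply: sumr_ge0 => n _; exact: normc_ge0.
  - by apply: cmeas_conjc; exact: cmeas_dpoly.
  - by move=> x; rewrite normc_conjc; exact: normc_dpoly.
have PPi := cintegrable_sqr_dpoly N c.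
have : S <= Re (cint mu (fun x => (2^-1)%:C * g x + (2^-1)%:C * (dpoly G N c x * conjc (dpoly G N c x)))).
  rewrite {1}SE; apply: Re_cint_le => //.
    by apply: cintegrableD; exact: cintegrableZ.
  move=> x; rewrite mulc_conj -!rmorphM -rmorphD /= -mulrDr.
  apply: (@le_trans _ _ (normc (f x) * normc (dpoly G N c x))).
    apply: le_trans (ler_norm _) _; apply: le_trans (normc_Re _) _.
    by rewrite Normc.normcM normc_conjc.
  rewrite ler_pdivlMl// -subr_ge0 (_ : _ - _ = (normc (f x) - normc (dpoly G N c x)) ^+ 2); last by ring.
  exact: sqr_ge0.
rewrite cintD; [|exact: cintegrableZ..].
rewrite !cintZ// cReD !Re_realM -/(sqnorm mu (dpoly G N c)) sqnorm_dpoly -/S.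
have gA : Re (cint mu g) <= A ^+ 2.
  rewrite -lee_fin /cint /= /Rintegral fineK//.
  exact: (integrable_fin_num measurableT (cintegrable_Re gi)).
move=> h; have := ler_wpM2l (_ : 0 <= 2^-1) gA; lra.
Qed.

End bessel.

(** * Comparison of the abscissas sigma_a and sigma_p *)

Section abscissas.
Context (R : realType) (lam : nat -> R) (hlam : is_frequency lam)
  (G : dirichlet_group lam).
Let mu := dhaar G.
Let hmu : is_haar mu := dhaarP G.
Implicit Types (a : nat -> R[i]) (s t k : R) (p q : \bar R).

Lemma abs_cvg_atE a (z : R[i]) : abs_cvg_at lam a z = csummable (translate lam (Re z) a).
Proof.
suff e : (fun n => normc (a n * cexp (- (lam n)%:C * z))) =
    (fun n => normc (translate lam (Re z) a n)) by rewrite /abs_cvg_at e.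
apply/funext => n; rewrite /translate Normc.normcM [RHS]Normc.normcM; congr (_ * _).
rewrite /cexp Normc.normcM -/(cis _) normc_cis mulr1.
rewrite !normc_real; congr (`|expR _|); case: z => x y /=.
by rewrite oppr0 mul0r subr0 mulNr.
Qed.

Lemma normc_translate a s n : normc (translate lam s a n) = normc (a n) * expR (- (lam n * s)).
Proof. by rewrite /translate Normc.normcM normc_real ger0_norm ?expR_ge0. Qed.

Lemma csummable_translate_le a s t : s <= t -> csummable (translate lam s a) ->
  csummable (translate lam t a).
Proof.
move=> st; apply: csummable_le => n; rewrite !normc_translate.
rewrite ler_wpM2l ?normc_ge0// ler_expR lerN2 ler_wpM2l//.
exact: (frequency_ge0 hlam).
Qed.

Lemma sigma_a_le a t : csummable (translate lam t a) -> (sigma_a lam a <= t%:E)%E.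
Proof.
move=> h; apply: ereal_inf_lbound; exists t => //= z tz.
by rewrite abs_cvg_atE; apply: csummable_translate_le h; exact: ltW.
Qed.

Lemma sigma_a_lt a t : (sigma_a lam a < t%:E)%E -> csummable (translate lam t a).
Proof.
move=> /ereal_inf_lt[_ [s /= hs <-]]; rewrite lte_fin => st.
by have := hs (t%:C) st; rewrite abs_cvg_atE.
Qed.

Lemma sigma_H_le p a t : in_Hp G p (translate lam t a) -> (sigma_H G p a <= t%:E)%E.
Proof. by move=> h; apply: ereal_inf_lbound; exists t. Qed.

Lemma sigma_H_lt p a t : (sigma_H G p a < t%:E)%E ->
  exists2 s, s < t & in_Hp G p (translate lam s a).
Proof. by move=> /ereal_inf_lt[_ [s /= hs <-]]; rewrite lte_fin => st; exists s. Qed.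

Lemma lee_of_lt (x y : \bar R) : (forall t : R, (y < t%:E)%E -> (x <= t%:E)%E) -> (x <= y)%E.
Proof.
move=> h; case: y h => [y| |] h.
- apply/lee_addgt0Pr => e e0; rewrite -EFinD; apply: h.
  by rewrite lte_fin ltrDl.
- exact: leey.
- case: x h => [x| |//] h; last by have := h 0 (ltNyr _).
  by have := h (x - 1) (ltNyr _); rewrite lee_fin lerBrDr gerDl ler10.
Qed.

Lemma in_Hp_le p q a : (1 <= p)%E -> (p <= q)%E -> in_Hp G q a -> in_Hp G p a.
Proof.
move=> p1 pq [f [/in_Lp_Lball[M M0 h] fs aE]]; exists f; split=> //.
by apply/in_Lp_Lball; exists M => //; apply: Lball_le h => //; exact: ltW.
Qed.

Lemma sigma_H_mono p q a : (1 <= p)%E -> (p <= q)%E ->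
  (sigma_H G p a <= sigma_H G q a)%E.
Proof.
move=> p1 pq; apply: le_ereal_inf => _ [s /= hs <-]; exists s => //=.
exact: in_Hp_le hs.
Qed.

Lemma csummable_in_Hp p a : (1 <= p)%E -> csummable a -> in_Hp G p a.
Proof.
move=> p1 sa; exists (qser G a); split.
- apply/in_Lp_Lball; exists (limn (series (fun n => normc (a n))) + 1).
    rewrite ltr_wpDl//; apply: le_trans (series_normc_le 0 sa).
    by rewrite /series /= big_nil.
  apply: Lball_bounded => //.
  + rewrite addr_ge0//; apply: le_trans (series_normc_le 0 sa).
    by rewrite /series /= big_nil.
  + exact: cmeas_qser.
  + by move=> x; apply: (le_trans (normc_qser x sa)); rewrite lerDl.
- move=> chi hchi ne; apply: contrapT => /forallNP hn; move/eqP: ne; apply.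
  exact: fourier_qser0.
- by move=> n; rewrite fourier_qser.
Qed.

Lemma sigma_H_le_a p a : (1 <= p)%E -> (sigma_H G p a <= sigma_a lam a)%E.
Proof.
move=> p1; apply: lee_of_lt => t /sigma_a_lt h.
by apply: sigma_H_le; exact: csummable_in_Hp.
Qed.

(** Coefficients are bounded by the norm, and a shift by k > L makes a bounded sequence summable.
    This yields S_p <= L. *)
Lemma sigma_a_le_H p a t k : (1 <= p)%E -> (freqL lam < k%:E)%E ->
  (sigma_H G p a < t%:E)%E -> (sigma_a lam a <= (t + k)%:E)%E.
Proof.
move=> p1 Lk /sigma_H_lt[s st [f [/in_Lp_Lball[M M0 h] fs aE]]].
apply: (@le_trans _ _ (s + k)%:E); last by rewrite lee_fin lerD2r ltW.
apply: sigma_a_le.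
apply: (csummable_le (v := fun n => M * expR (- (k * lam n)))).
  move=> n; rewrite (translateE lam (s + k) s) normc_realM ger0_norm ?expR_ge0//.
  rewrite mulrC addrAC subrr add0r (mulrC k) ler_wpM2r ?expR_ge0// aE.
  exact: normc_fourier p1 (ltW M0) h (dcharP G n).
exact/is_cvg_series_mul/cvg_expR_lam.
Qed.

(** By xy <= x^2 + y^2 and Bessel's inequality, a shift by k is enough once the e^{-2k lambda_n} are
    summable. This yields S_2 <= L/2. *)
Lemma sigma_a_le_H2 a t k : (freqL lam < (2 * k)%:E)%E ->
  (sigma_H G 2%:E a < t%:E)%E -> (sigma_a lam a <= (t + k)%:E)%E.
Proof.
move=> Lk /sigma_H_lt[s st [f [/in_Lp_Lball[M M0 h] fs aE]]].
apply: (@le_trans _ _ (s + k)%:E); last by rewrite lee_fin lerD2r ltW.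
apply: sigma_a_le.
have c1 : cvgn (series (fun n => normc (fourier mu f (dchar G n)) ^+ 2)).
  apply: (bounded_series_cvg (M := M ^+ 2)) => n; first exact: sqr_ge0.
  by rewrite /series /= big_mkord; apply: bessel => //; exact: ltW.
have c2 := cvg_expR_lam hlam Lk.
apply: (csummable_le (v := fun n => normc (fourier mu f (dchar G n)) ^+ 2 + expR (- (2 * k * lam n)))).
  move=> n; rewrite (translateE lam (s + k) s) normc_realM ger0_norm ?expR_ge0//.
  rewrite addrAC subrr add0r aE.
  have -> : expR (- (2 * k * lam n)) = expR (- (lam n * k)) ^+ 2.
    by rewrite -expRM_natl; congr expR; ring.
  set x := expR _; set y := normc _.
  rewrite -subr_ge0 (_ : _ - _ = (x - y) ^+ 2 / 2 + (x ^+ 2 + y ^+ 2) / 2); last by field.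
  by rewrite addr_ge0// divr_ge0 ?addr_ge0 ?sqr_ge0.
exact: is_cvg_seriesD c1 c2.
Qed.

End abscissas.

(** A preimage is the countable union of its slices. This and the sigma-finiteness of counting
    measure make [nat] available as parameter space of a mixture. *)
Lemma measurable_prod_nat d (T : measurableType d) (R : realType)
    (f : T * nat -> R) : (forall k, measurable_fun setT (fun x => f (x, k))) ->
  measurable_fun setT f.
Proof.
move=> mf _ B mB; rewrite setTI.
rewrite (_ : f @^-1` B = \bigcup_k (((fun x => f (x, k)) @^-1` B) `*` [set k])).
  apply: bigcup_measurable => k _; apply: measurableX => //.
  by have := mf k measurableT B mB; rewrite setTI.
apply/seteqP; split=> [[x k] /= fB|[x k] [j _ [/= fB ->]]//].
by exists k.
Qed.

Lemma sigma_finite_counting (R : realType) : sigma_finite [set: nat] (@counting nat R).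
Proof.
exists (fun n => [set n]); first by apply/seteqP; split=> // n _; exists n.
by move=> n; split=> //; rewrite /counting /= asboolT ?ltry//; exact: finite_set1.
Qed.

HB.instance Definition _ (R : realType) :=
  @Measure_isSigmaFinite.Build _ nat R (@counting nat R) (sigma_finite_counting R).

(** * The lower bound S_2 >= L/2 *)

Section width2_lower_bound.
Context (R : realType) (lam : nat -> R) (hlam : is_frequency lam)
  (G : dirichlet_group lam).
Let mu := dhaar G.
Let hmu : is_haar mu := dhaarP G.

Lemma Lball2_dpoly N (c : nat -> R[i]) A : 0 <= A -> \sum_(n < N) normc (c n) ^+ 2 <= A ^+ 2 ->
  Lball mu 2%:E A (dpoly G N c).
Proof.
move=> A0 cA; split; first exact: cmeas_dpoly.
apply/Lnorm_finP => //; first exact: ler1n.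
rewrite powR_mulrn//; apply: (@le_trans _ _ (sqnorm mu (dpoly G N c))%:E); last first.
  by rewrite sqnorm_dpoly// lee_fin.
rewrite /sqnorm /cint /= /Rintegral fineK; last first.
  exact: (integrable_fin_num measurableT (cintegrable_Re (cintegrable_sqr_dpoly G N c))).
rewrite le_eqVlt; apply/orP; left; apply/eqP; apply: eq_integral => x _.
by rewrite powR_mulrn ?normc_ge0// mulc_conj.
Qed.

Lemma half_pow_series : (\int[@counting nat R]_k ((2 ^+ k)^-1)%:E <= 2%:E)%E.
Proof.
rewrite ge0_integral_count; last by move=> k; rewrite lee_fin invr_ge0 exprn_ge0.
apply: lime_le; first by apply: is_cvg_nneseries => k _ _; rewrite lee_fin invr_ge0 exprn_ge0.
apply: nearW => n; rewrite sumEFin lee_fin.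
have -> : \sum_(0 <= k < n) (2 ^+ k)^-1 = 2 - 2 * (2 ^+ n)^-1 :> R.
  elim: n => [|n ih]; first by rewrite big_nil expr0 invr1 mulr1 subrr.
  by rewrite big_nat_recr//= ih exprS invfM; field; rewrite expf_neq0.
by rewrite gerBl mulr_ge0// invr_ge0 exprn_ge0.
Qed.

(* If L > 2c, there are indices n with n > e^{2 c lambda_n}.  Superposing the
   polynomials 2^{-k} n_k^{-1/2} sum_{n <= n_k} h_n, which have L_2 norm 2^{-k}, over
   a sparse sequence of such indices n_k gives sigma_2 <= 0 and sigma_a >= c'. *)
Lemma H2_example (c c' : R) : 0 <= c' -> c' < c -> ((2 * c)%:E < freqL lam)%E ->
  exists a : nat -> R[i],
    (sigma_H G 2%:E a <= 0)%E /\ (c'%:E <= sigma_a lam a)%E.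
Proof.
move=> c'0 c'c cL.
(* The second condition can be met because lambda_n tends to infinity and e^x >= 1 + x; it lets
   e^{(c - c') lambda_n} outweigh k 2^k in [bnd]. *)
have /choice[nk hnk] : forall k : nat, exists n : nat,
    2 * c * lam n < ln n.+1%:R /\ k%:R * 2 ^+ k <= expR ((c - c') * lam n).
  move=> k; have cc : 0 < c - c' by rewrite subr_gt0.
  have /cvgryPge/(_ (k%:R * 2 ^+ k / (c - c'))) [N _ hN] := frequency_cvgy hlam.
  have [n Nn hn] := lt_freqL hlam N cL; exists n; split=> //.
  have := hN n Nn; rewrite /= ler_pdivrMr// => h.
  apply: (le_trans h); rewrite [leLHS]mulrC.
  by apply: le_trans (expR_ge1Dx _); rewrite lerDr ler01.
pose v k : R := (2 ^+ k)^-1 * (Num.sqrt (nk k).+1%:R)^-1.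
have v0 k : 0 <= v k by rewrite mulr_ge0 ?invr_ge0 ?exprn_ge0 ?sqrtr_ge0.
pose F (z : borel G * nat) : R[i] := dpoly G (nk z.2).+1 (fun=> (v z.2)%:C) z.1.
pose w (k : nat) : R := (2 ^+ k)^-1.
have w0 k : 0 < w k by rewrite invr_gt0 exprn_gt0.
have mF : cmeas F.
  by split; apply: measurable_prod_nat => k; have [] := cmeas_dpoly G (nk k).+1 (fun=> (v k)%:C).
have hF k : Lball mu 2%:E (w k) (fun x => F (x, k)).
  apply: (@Lball2_dpoly (nk k).+1 (fun=> (v k)%:C)); first exact: ltW.
  rewrite (eq_bigr (fun=> v k ^+ 2)); last by move=> n _; rewrite normc_real ger0_norm.
  have -> : v k = w k * (Num.sqrt (nk k).+1%:R)^-1 by [].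
  rewrite sumr_const card_ord exprMn -[_ *+ _]mulr_natr [(Num.sqrt _)^-1 ^+ 2]exprVn.
  by rewrite sqr_sqrtr ?ler0n// -mulrA mulVf ?mulr1// pnatr_eq0.
have mw : measurable_fun [set: nat] w by [].
have r1 : 1 <= 2 :> R by exact: ler1n.
have hM := @Lball_mixture _ _ mu _ nat (@counting nat R) F w 2 2 r1 mF mw w0 (ltr0Sn R 1) half_pow_series hF.
have fM := @fourier_mixture _ _ mu _ nat (@counting nat R) F w 2 2 r1 mF mw w0 half_pow_series hF.
(* [u n k] is the n-th coefficient of the k-th polynomial. All are non-negative, so no cancellation
   occurs in [a n]. *)
pose u (n k : nat) : R := if (n < (nk k).+1)%N then v k else 0.
have u0 n k : 0 <= u n k by rewrite /u; case: ifP.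
have uw n k : u n k <= w k.
  have vw : v k <= w k.
    rewrite /v ler_piMr ?(ltW (w0 k))// invf_le1 ?sqrtr_gt0 ?ltr0n//.
    by rewrite -[leLHS]sqrtr1 ler_sqrt ?ler1n// ltr0n.
  by rewrite /u; case: ifP => // _; exact: ltW.
pose a n : R[i] := fourier mu (mixture (@counting nat R) F) (dchar G n).
have aE n : a n = cint (@counting nat R) (fun k => (u n k)%:C).
  rewrite /a fM; last exact: dcharP.
  congr (cint _ _); apply/funext => k; rewrite /F /= /u; case: ifPn => nN.
    by rewrite fourier_dpoly_dchar.
  rewrite fourier_dpoly; last exact: dcharP.
  apply: big1 => -[i iN] _ /=; case: asboolP; last by rewrite mulr0.
  by move=> /(dchar_inj hlam) ein; rewrite -ein iN in nN.
have aspec : spectrum_in (mixture (@counting nat R) F : G -> R[i]).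
  move=> psi hpsi; apply: contraPP => hno.
  rewrite fM//; apply/negP; rewrite negbK; apply/eqP.
  rewrite -[RHS](cint0 (@counting nat R)); congr (cint _ _); apply/funext => k.
  rewrite /F /= fourier_dpoly//; apply: big1 => i _.
  by case: asboolP; rewrite ?mulr0// => e; case: hno; exists i.
have aH : in_Hp G 2%:E (translate lam 0 a).
  apply/in_HpP; exists (mixture (@counting nat R) F : G -> R[i]); split=> //.
    by apply/in_Lp_Lball; exists 2.
  by move=> n; rewrite /translate mulr0 oppr0 expR0 mulr1.
exists a; split; first exact: sigma_H_le aH.
have mu_u n : (\int[@counting nat R]_k (u n k)%:E \is a fin_num)%E.
  rewrite ge0_fin_numE; last by apply: integral_ge0 => k _; rewrite lee_fin.
  apply: (@le_lt_trans _ _ 2%:E); last exact: ltry.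
  apply: le_trans half_pow_series; apply: ge0_le_integral => //.
  - by move=> k _; rewrite lee_fin.
  - by move=> k _; rewrite lee_fin uw.
have a_ge n k : (n < (nk k).+1)%N -> v k <= normc (a n).
  move=> nk1; apply: le_trans (normc_Re _); apply: le_trans (ler_norm _).
  rewrite aE /cint /= /Rintegral -lee_fin fineK//.
  rewrite ge0_integral_count; last by move=> j; rewrite lee_fin.
  apply: le_trans (nneseries_lim_ge k.+1 _); last by move=> j _; rewrite lee_fin.
  rewrite sumEFin lee_fin big_nat_recr//= {2}/u nk1 lerDr.
  by apply: sumr_ge0.
rewrite leNgt; apply/negP => /sigma_a_lt sa.
pose M := limn (series (fun n => normc (translate lam c' a n))).
(* The first n_k + 1 terms are at least v_k e^{-c' lam (n_k)} each. Their sum is at least 2^{-k}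
   sqrt(n_k + 1) e^{-c' lam (n_k)} >= 2^{-k} e^{(c - c') lam (n_k)} >= k. *)
have bnd k : k%:R <= M.
  have [h1 h2] := hnk k.
  apply: le_trans (series_normc_le (nk k).+1 sa).
  have sq0 : 0 < Num.sqrt (nk k).+1%:R :> R by rewrite sqrtr_gt0 ltr0n.
  apply: (@le_trans _ _ ((nk k).+1%:R * (v k * expR (- (c' * lam (nk k)))))).
    rewrite /v -{1}(@sqr_sqrtr _ (nk k).+1%:R) ?ler0n//.
    have -> : Num.sqrt (nk k).+1%:R ^+ 2 * ((2 ^+ k)^-1 * (Num.sqrt (nk k).+1%:R)^-1 *
      expR (- (c' * lam (nk k)))) =
      (2 ^+ k)^-1 * (Num.sqrt (nk k).+1%:R * expR (- (c' * lam (nk k)))) :> R.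
      by field; rewrite gt_eqF//= expf_neq0.
    rewrite mulrC ler_pdivlMr ?exprn_gt0//; apply: (le_trans h2).
    rewrite mulrBl expRD ler_pM2r ?expR_gt0//.
    have : expR (2 * (c * lam (nk k))) <= (nk k).+1%:R.
      rewrite -[leRHS]lnK ?posrE ?ltr0n// ler_expR mulrA; exact: ltW.
    rewrite mulr2n mulrDl mul1r expRD -expr2 => h.
    by rewrite -(@ler_pXn2r _ 2)// ?nnegrE ?expR_ge0 ?(ltW sq0)// sqr_sqrtr.
  rewrite (_ : (fun n => _) = (fun n => normc (a n) * expR (- (lam n * c')))); last first.
    by apply/funext => n; exact: normc_translate.
  rewrite /series /= big_mkord mulrC mulr_natr -[X in _ *+ X]card_ord -sumr_const.
  apply: ler_sum => i _; apply: ler_pM => //.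
  - exact: a_ge.
  - rewrite ler_expR lerN2 mulrC; apply: ler_wpM2l => //.
    have := ltn_ord i; rewrite ltnS leq_eqVlt => /orP[/eqP -> //|h].
    exact/ltW/(frequency_increasing hlam).
have := bnd (Num.bound `|M|).
by rewrite leNgt (le_lt_trans (ler_norm _) (archi_boundP (normr_ge0 M))).
Qed.
End width2_lower_bound.

(** * Widths of the strips *)

Section widths.
Context (R : realType) (lam : nat -> R) (hlam : is_frequency lam)
  (G : dirichlet_group lam).

Lemma esub0_ge0 (x y : \bar R) : (y <= x)%E -> (0 <= esub0 x y)%E.
Proof.
rewrite /esub0 le_eqVlt eq_sym; case: ifPn => //= xy yx.
by rewrite ltW// sube_gt0.
Qed.

Lemma widthT_diag p : widthT G p p = 0%E.
Proof.
rewrite /widthT (_ : [set _ | _ in _] = [set 0%E]) ?ereal_sup1//.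
apply/seteqP; split=> [_ [a _ <-]|_ ->]; first by rewrite /= /esub0 eqxx.
by exists (fun=> 0) => //; rewrite /esub0 eqxx.
Qed.

(** For every A, [H2_example] provides a series with sigma_a >= A, and p <= 2 gives sigma_p <=
    sigma_2 <= 0. *)
Lemma widthS_infty (p : R) : 1 <= p <= 2 -> freqL lam = +oo%E ->
  widthS G p%:E = +oo%E.
Proof.
move=> /andP[p1 p2] Loo; apply/eqyP => A A0.
have [||a [aH aa]] := @H2_example R lam hlam G (A + 1) A (ltW A0).
- by rewrite ltrDl.
- by rewrite Loo ltry.
have aHp : (sigma_H G p%:E a <= 0)%E.
  by apply: le_trans aH; apply: sigma_H_mono; rewrite lee_fin.
apply: ereal_sup_ge; exists (esub0 (sigma_a lam a) (sigma_H G p%:E a)); first by exists a.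
have lt0 : (0 < sigma_a lam a)%E by apply: lt_le_trans aa; rewrite lte_fin.
rewrite /esub0 gt_eqF; last exact: le_lt_trans lt0.
apply: (le_trans aa); rewrite -[leLHS]adde0; apply: leeD => //.
by rewrite oppe_ge0.
Qed.

Context (l : R) (Ll : freqL lam = l%:E).

Let l0 : 0 <= l. Proof. by rewrite -lee_fin -Ll freqL_ge0. Qed.

(* All abscissas of a are finite: s is sigma_a, and h p is sigma_p. *)
Definition abscissae (a : nat -> R[i]) (s : R) (h : \bar R -> R) :=
  sigma_a lam a = s%:E /\ forall p, (1 <= p)%E -> sigma_H G p a = (h p)%:E.

(* When L is finite, either all abscissas are equal (to +oo or -oo), and the series
   contributes 0 to every width, or all of them are finite. *)
Lemma abscissa_cases a : (forall p, (1 <= p)%E -> sigma_H G p a = sigma_a lam a) \/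
  exists s h, abscissae a s h.
Proof.
have ub p t : (1 <= p)%E -> (sigma_H G p a < t%:E)%E -> (sigma_a lam a <= (t + (l + 1))%:E)%E.
  by move=> p1; apply: sigma_a_le_H => //; rewrite Ll lte_fin ltrDl.
have ha p (p1 : (1 <= p)%E) := sigma_H_le_a hlam G a p1.
case E : (sigma_a lam a) ub ha => [s| |] ub ha.
- right; exists s, (fun p => fine (sigma_H G p a)); split=> // p p1.
  rewrite fineK//; case F : (sigma_H G p a) => [t| |] //.
    by have := ha p p1; rewrite F leye_eq.
  have := ub p (s - (l + 1) - 1) p1; rewrite F ltNyr lee_fin => /(_ isT).
  by lra.
- left=> p p1; case F : (sigma_H G p a) => [t| |] //.
    by have := ub p (t + 1) p1; rewrite F lte_fin ltrDl ltr01 => /(_ isT).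
  by have := ub p 0 p1; rewrite F ltNyr => /(_ isT).
- by left=> p p1; apply/eqP; rewrite -leeNy_eq; exact: ha.
Qed.

Section one_series.
Context (a : nat -> R[i]) (s : R) (h : \bar R -> R) (ah : abscissae a s h).

Lemma abscissa_mono p q : (1 <= p)%E -> (p <= q)%E -> h p <= h q.
Proof.
move=> p1 pq; have q1 := le_trans p1 pq; have [_ hE] := ah.
by rewrite -lee_fin -!hE//; exact: sigma_H_mono.
Qed.

Lemma abscissa_le_abs p : (1 <= p)%E -> h p <= s.
Proof.
by move=> p1; have [sE hE] := ah; rewrite -lee_fin -sE -hE//; exact: sigma_H_le_a.
Qed.

Lemma abs_le_abscissa p : (1 <= p)%E -> s - h p <= l.
Proof.
move=> p1; have [sE hE] := ah; apply/ler_addgt0Pr => e e0.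
have := @sigma_a_le_H R lam hlam G p a (h p + e / 2) (l + e / 2) p1.
by rewrite Ll hE// sE !lte_fin lee_fin; lra.
Qed.

Lemma abs_le_abscissa2 : s - h 2%:E <= l / 2.
Proof.
have [sE hE] := ah; apply/ler_addgt0Pr => e e0.
have := @sigma_a_le_H2 R lam hlam G a (h 2%:E + e / 2) (l / 2 + e / 2).
rewrite Ll hE; last by rewrite lee_fin ler1n.
by rewrite sE !lte_fin lee_fin; lra.
Qed.

Lemma abscissa_interp (p r : R) (q : \bar R) (qi th : R) :
  1 <= p -> p < r -> (r%:E < q)%E -> (q^-1 = qi%:E)%E ->
  0 < th < 1 -> r^-1 = th * p^-1 + (1 - th) * qi ->
  h r%:E <= th * h p%:E + (1 - th) * h q.
Proof.
move=> p1 pr rq qE /andP[t0 t1] rE; have [_ hE] := ah.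
have r1 : (1 <= r%:E)%E by rewrite lee_fin (le_trans p1)// ltW.
have q1 : (1 <= q)%E by rewrite (le_trans r1)// ltW.
have pE : (1 <= p%:E)%E by rewrite lee_fin.
have hpr : h p%:E <= h r%:E by apply: abscissa_mono => //; rewrite lee_fin ltW.
have hrq : h r%:E <= h q by apply: abscissa_mono => //; exact: ltW.
(* If h q <= h p, monotonicity makes the three abscissas equal. *)
have [hpq|hqp] := ltP (h p%:E) (h q); last by nra.
apply/ler_addgt0Pr => e e0.
pose m := Num.min (h p%:E + e) (h q).
have /sigma_H_lt[s1 s1m H1] : (sigma_H G p%:E a < m%:E)%E.
  by rewrite hE// lte_fin lt_min ltrDl e0.
have /sigma_H_lt[s2 s2m H2] : (sigma_H G q a < (h q + e)%:E)%E.
  by rewrite hE// lte_fin ltrDl.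
have hs2 : h q <= s2 by rewrite -lee_fin -hE//; exact: sigma_H_le.
move: s1m; rewrite lt_min => /andP[s1p s1q].
suff : h r%:E <= th * s1 + (1 - th) * s2 by nra.
rewrite leNgt; apply/negP => hr.
have /(cvg_expR_lam hlam) su : (freqL lam < (l + 1)%:E)%E by rewrite Ll lte_fin ltrDl.
(* The midpoint exceeds the interpolated value, so [in_Hp_interp] applies, but is less than [h r],
   which is an infimum. *)
pose sg := (th * s1 + (1 - th) * s2 + h r%:E) / 2.
have Hr : in_Hp G r%:E (translate lam sg a).
  apply: (@in_Hp_interp _ _ hlam G (l + 1) a p r q qi th s1 s2 sg) => //.
  - by rewrite t0.
  - by rewrite /sg; lra.
  - by rewrite /sg; lra.
have : h r%:E <= sg by rewrite -lee_fin -hE//; exact: sigma_H_le.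
by rewrite /sg; lra.
Qed.

End one_series.
End widths.

(** * Inequalities between the widths for finite L *)

Section real_widths.
Context (R : realType) (lam : nat -> R) (hlam : is_frequency lam)
  (G : dirichlet_group lam) (l : R) (Ll : freqL lam = l%:E).

Let l0 : 0 <= l. Proof. by rewrite -lee_fin -Ll freqL_ge0. Qed.

(** Real versions for linear arithmetic; no value is lost for finite L, by [rwidthSE] and
    [rwidthTE]. *)
Definition rwidthS (p : \bar R) : R := fine (widthS G p).
Definition rwidthT (q p : \bar R) : R := fine (widthT G q p).

(** The condition 0 <= x accounts for the series whose abscissas all coincide; they contribute 0. *)
Lemma widthS_le p x : (1 <= p)%E -> 0 <= x ->
  (forall a s h, abscissae G a s h -> s - h p <= x) -> (widthS G p <= x%:E)%E.
Proof.
move=> p1 x0 H; apply: ub_ereal_sup => _ [a _ <-].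
case: (abscissa_cases hlam G Ll a) => [e|[s [h ah]]].
  by rewrite /esub0 e// eqxx lee_fin.
have [sE hE] := ah; rewrite /esub0 sE hE//; case: ifP => _; first by rewrite lee_fin.
by rewrite -EFinB lee_fin; exact: H ah.
Qed.

Lemma widthT_le q p x : (1 <= p)%E -> (1 <= q)%E -> 0 <= x ->
  (forall a s h, abscissae G a s h -> h q - h p <= x) -> (widthT G q p <= x%:E)%E.
Proof.
move=> p1 q1 x0 H; apply: ub_ereal_sup => _ [a _ <-].
case: (abscissa_cases hlam G Ll a) => [e|[s [h ah]]].
  by rewrite /esub0 !e// eqxx lee_fin.
have [_ hE] := ah; rewrite /esub0 !hE//; case: ifP => _; first by rewrite lee_fin.
by rewrite -EFinB lee_fin; exact: H ah.
Qed.

Lemma esub0_EFin (x y : R) : esub0 x%:E y%:E = (x - y)%:E.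
Proof. by rewrite /esub0; case: eqP => // -[->]; rewrite subrr. Qed.

Lemma widthS_ge0 p : (1 <= p)%E -> (0 <= widthS G p)%E.
Proof.
move=> p1; apply: ereal_sup_ge.
exists (esub0 (sigma_a lam (fun=> 0)) (sigma_H G p (fun=> 0))); first by exists (fun=> 0).
by apply: esub0_ge0; exact: sigma_H_le_a.
Qed.

Lemma widthT_ge0 q p : (1 <= p)%E -> (p <= q)%E -> (0 <= widthT G q p)%E.
Proof.
move=> p1 pq; apply: ereal_sup_ge.
exists (esub0 (sigma_H G q (fun=> 0)) (sigma_H G p (fun=> 0))); first by exists (fun=> 0).
by apply: esub0_ge0; exact: sigma_H_mono.
Qed.

Lemma rwidthSE p : (1 <= p)%E -> widthS G p = (rwidthS p)%:E.
Proof.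
move=> p1; rewrite fineK// ge0_fin_numE ?widthS_ge0//.
apply: (@le_lt_trans _ _ l%:E); last exact: ltry.
by apply: widthS_le => // a s h ah; exact: (abs_le_abscissa hlam Ll ah p1).
Qed.

Lemma rwidthTE q p : (1 <= p)%E -> (p <= q)%E -> widthT G q p = (rwidthT q p)%:E.
Proof.
move=> p1 pq; have q1 := le_trans p1 pq; rewrite fineK// ge0_fin_numE ?widthT_ge0//.
apply: (@le_lt_trans _ _ l%:E); last exact: ltry.
apply: widthT_le => // a s h ah.
apply: le_trans (abs_le_abscissa hlam Ll ah p1).
by rewrite lerD2r (abscissa_le_abs hlam ah).
Qed.

Lemma rwidthS_ge a s h p : (1 <= p)%E -> abscissae G a s h -> s - h p <= rwidthS p.
Proof.
move=> p1 ah; rewrite -lee_fin -rwidthSE//; apply: ereal_sup_ubound; exists a => //.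
by have [sE hE] := ah; rewrite sE hE// esub0_EFin.
Qed.

Lemma rwidthT_ge a s h q p : (1 <= p)%E -> (p <= q)%E -> abscissae G a s h ->
  h q - h p <= rwidthT q p.
Proof.
move=> p1 pq ah; rewrite -lee_fin -rwidthTE//; apply: ereal_sup_ubound; exists a => //.
by have [sE hE] := ah; rewrite !hE// ?esub0_EFin//; exact: le_trans pq.
Qed.

Lemma rwidthS_le p x : (1 <= p)%E -> 0 <= x ->
  (forall a s h, abscissae G a s h -> s - h p <= x) -> rwidthS p <= x.
Proof. by move=> p1 x0 H; rewrite -lee_fin -rwidthSE//; exact: widthS_le. Qed.

Lemma rwidthT_le q p x : (1 <= p)%E -> (p <= q)%E -> 0 <= x ->
  (forall a s h, abscissae G a s h -> h q - h p <= x) -> rwidthT q p <= x.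
Proof.
by move=> p1 pq x0 H; rewrite -lee_fin -rwidthTE//; apply: widthT_le => //; exact: le_trans pq.
Qed.

Lemma rwidthS_ge0 p : (1 <= p)%E -> 0 <= rwidthS p.
Proof.
move=> p1; rewrite -lee_fin -rwidthSE//.
exact: widthS_ge0.
Qed.

Lemma rwidthT_ge0 q p : (1 <= p)%E -> (p <= q)%E -> 0 <= rwidthT q p.
Proof.
move=> p1 pq; rewrite -lee_fin -rwidthTE//.
exact: widthT_ge0.
Qed.

Lemma rwidthS_le_freqL p : (1 <= p)%E -> rwidthS p <= l.
Proof. by move=> p1; apply: rwidthS_le => // a s h ah; exact: abs_le_abscissa ah _ p1. Qed.

Lemma rwidthS_anti p r : (1 <= p)%E -> (p <= r)%E -> rwidthS r <= rwidthS p.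
Proof.
move=> p1 pr; have r1 := le_trans p1 pr.
apply: rwidthS_le => //; first exact: rwidthS_ge0.
move=> a s h ah; apply: le_trans (rwidthS_ge p1 ah).
by rewrite lerB// (abscissa_mono ah).
Qed.

Lemma rwidthS2 : rwidthS 2%:E = l / 2.
Proof.
have two : (1 <= 2%:E :> \bar R)%E by rewrite lee_fin ler1n.
apply/eqP; rewrite eq_le; apply/andP; split.
  apply: rwidthS_le => //; first by rewrite divr_ge0.
  by move=> a s h ah; exact: abs_le_abscissa2 ah.
rewrite leNgt; apply/negP => lt.
(* If S_2 < L/2, then S_2 < c' < c < L/2, and the example has sigma_a - sigma_2 >= c' > S_2. *)
pose c' := (rwidthS 2%:E + l / 2) / 2; pose c := (c' + l / 2) / 2.
have S0 := rwidthS_ge0 two.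
have [|||a [aH aa]] := @H2_example R lam hlam G c c'.
- by rewrite /c'; lra.
- by rewrite /c /c'; lra.
- by rewrite Ll lte_fin /c /c'; lra.
case: (abscissa_cases hlam G Ll a) => [e|[s [h ah]]].
  have := le_trans aa _; rewrite -(e _ two) => /(_ _ aH).
  by rewrite lee_fin /c'; lra.
have := rwidthS_ge two ah; have [sE hE] := ah.
by move: aH aa; rewrite sE hE// !lee_fin /c'; lra.
Qed.

(* Interpolate r between p and oo, and use sigma_oo <= sigma_a. *)
Lemma rwidthS_scale (p r : R) : 1 <= p -> p <= r -> p * rwidthS p%:E <= r * rwidthS r%:E.
Proof.
move=> p1; rewrite le_eqVlt => /orP[/eqP -> //|pr].
have r1 : 1 <= r by rewrite (le_trans p1)// ltW.
have p0 : 0 < p by rewrite (lt_le_trans _ p1).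
have r0 : 0 < r by rewrite (lt_le_trans _ r1).
rewrite mulrC -ler_pdivlMr//; apply: rwidthS_le => //.
  by rewrite divr_ge0 ?(ltW p0)// mulr_ge0 ?(ltW r0)// rwidthS_ge0.
move=> a s h ah; rewrite ler_pdivlMr//.
have y1 : (1 <= +oo :> \bar R)%E by rewrite leey.
have th1 : 0 < p / r < 1 by rewrite divr_gt0//= ltr_pdivrMr ?mul1r.
have rE : r^-1 = p / r * p^-1 + (1 - p / r) * 0.
  by field; rewrite !gt_eqF.
have := abscissa_interp hlam Ll ah p1 pr (ltry r) invey th1 rE.
have := abscissa_le_abs hlam ah y1.
have := rwidthS_ge (_ : (1 <= r%:E)%E) ah; rewrite lee_fin => /(_ r1) A B C.
have [_ th'] := andP th1.
have -> : (s - h p%:E) * p = r * (p / r * (s - h p%:E)) by field; rewrite gt_eqF.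
rewrite ler_pM2l//; apply: le_trans A; nra.
Qed.

(** Interpolate q between p and oo with weight p/q on p; since sigma_oo <= sigma_a, this bounds
    sigma_q - sigma_p by (1 - p/q) (sigma_a - sigma_p). *)
Lemma rwidthT_le_S (p : R) (q : \bar R) (qi : R) : 1 <= p -> (p%:E <= q)%E ->
  (q^-1 = qi%:E)%E -> rwidthT q p%:E <= (1 - p * qi) * rwidthS p%:E.
Proof.
move=> p1 pq qE.
have pe : (1 <= p%:E)%E by rewrite lee_fin.
have p0 : 0 < p by rewrite (lt_le_trans _ p1).
have S0 := rwidthS_ge0 pe.
case: q pq qE => [q| |]; last by rewrite leeNy_eq.
  rewrite lee_fin le_eqVlt => /orP[/eqP<- |pq].
    rewrite inver gt_eqF// => -[<-]; rewrite divff ?gt_eqF// subrr mul0r.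
    by rewrite /rwidthT widthT_diag.
  have q0 : 0 < q by exact: lt_trans pq.
  have q1 : 1 <= q by rewrite (le_trans p1)// ltW.
  rewrite inver gt_eqF// => -[<-].
  have th1 : 0 < p / q < 1 by rewrite divr_gt0//= ltr_pdivrMr ?mul1r.
  have [_ th'] := andP th1.
  apply: rwidthT_le => //; first by rewrite lee_fin ltW.
    by rewrite mulr_ge0// subr_ge0 ltW.
  move=> a s h ah; have y1 : (1 <= +oo :> \bar R)%E by rewrite leey.
  have rE : q^-1 = p / q * p^-1 + (1 - p / q) * 0.
    by field; rewrite !gt_eqF.
  have := abscissa_interp hlam Ll ah p1 pq (ltry q) invey th1 rE.
  have := abscissa_le_abs hlam ah y1.
  by have := rwidthS_ge pe ah; nra.
rewrite invey => _ -[<-]; rewrite mulr0 subr0 mul1r.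
apply: rwidthT_le => //; first by rewrite leey.
move=> a s h ah; apply: le_trans (rwidthS_ge pe ah).
by rewrite lerD2r (abscissa_le_abs hlam ah)// leey.
Qed.

Lemma rwidthS_triangle r m : (1 <= r)%E -> (r <= m)%E ->
  rwidthS r <= rwidthT m r + rwidthS m.
Proof.
move=> r1 rm; have m1 := le_trans r1 rm.
apply: rwidthS_le => //; first by rewrite addr_ge0 ?rwidthS_ge0 ?rwidthT_ge0.
move=> a s h ah.
by have := rwidthS_ge m1 ah; have := rwidthT_ge r1 rm ah; lra.
Qed.

Lemma rwidthT_triangle r m q : (1 <= r)%E -> (r <= m)%E -> (m <= q)%E ->
  rwidthT q r <= rwidthT q m + rwidthT m r.
Proof.
move=> r1 rm mq; have m1 := le_trans r1 rm.
apply: rwidthT_le => //; first exact: le_trans mq.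
  by rewrite addr_ge0 ?rwidthT_ge0.
move=> a s h ah.
by have := rwidthT_ge m1 mq ah; have := rwidthT_ge r1 rm ah; lra.
Qed.

(** Comparison of chord slopes from 1/r for the convex function 1/p |-> sigma_p, with denominators
    cleared. It carries equality from m = p_0 to q > p_0. *)
Lemma rwidthT_interp (r m : R) (q : \bar R) (qi : R) : 1 <= r -> r < m ->
  (m%:E < q)%E -> (q^-1 = qi%:E)%E -> qi < m^-1 ->
  rwidthT m%:E r%:E * (r^-1 - qi) <= (r^-1 - m^-1) * rwidthT q r%:E.
Proof.
move=> r1 rm mq qE qm.
have r0 : 0 < r by rewrite (lt_le_trans _ r1).
have m0 : 0 < m by exact: lt_trans rm.
have mr : m^-1 < r^-1 by rewrite ltf_pV2.
have rE : (1 <= r%:E)%E by rewrite lee_fin.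
have rq : (r%:E <= q)%E by rewrite (le_trans _ (ltW mq))// lee_fin ltW.
have d0 : 0 < r^-1 - qi by rewrite subr_gt0 (lt_trans qm).
have T0 := rwidthT_ge0 rE rq.
rewrite -ler_pdivlMr//; apply: rwidthT_le => //; first by rewrite lee_fin ltW.
  by rewrite divr_ge0 ?(ltW d0)// mulr_ge0// subr_ge0 ltW.
move=> a s h ah; pose th := (m^-1 - qi) / (r^-1 - qi).
have th1 : 0 < th < 1.
  have n0 : 0 < m^-1 - qi by rewrite subr_gt0.
  by rewrite /th divr_gt0//= ltr_pdivrMr// mul1r ltrD2r.
have E : m^-1 = th * r^-1 + (1 - th) * qi.
  by rewrite /th; move: d0; move: (r^-1) (m^-1) => x y d0; field; rewrite gt_eqF.
have := abscissa_interp hlam Ll ah r1 rm mq qE th1 E.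
have := rwidthT_ge rE rq ah.
have -> : (r^-1 - m^-1) * rwidthT q r%:E / (r^-1 - qi) = (1 - th) * rwidthT q r%:E.
  rewrite /th; move: d0; move: (r^-1) (m^-1) (rwidthT _ _) => x y T d0.
  by field; rewrite gt_eqF.
have [_ th'] := andP th1; nra.
Qed.

End real_widths.

(** * The exponent p_0 and the extremal cases *)

Section p0_theory.
Context (R : realType) (lam : nat -> R) (hlam : is_frequency lam)
  (G : dirichlet_group lam).

(** 1 is the least exponent allowed in the infimum. This precedes the assumption that L is finite
    because it also settles L = oo. *)
Lemma p0_eq1 : widthS G 1%:E = (freqL lam / 2%:E)%E -> p0 G = 1.
Proof.
move=> S1; apply/eqP; rewrite eq_le; apply/andP; split.
  apply: ge_inf; first by exists 1 => x [/andP[]].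
  by rewrite /= lexx ler1n.
apply: lb_le_inf; last by move=> x [/andP[]].
by exists 1; rewrite /= lexx ler1n.
Qed.

Context (l : R) (Ll : freqL lam = l%:E).
Let l0 : 0 <= l. Proof. by rewrite -lee_fin -Ll freqL_ge0. Qed.
Local Notation S p := (rwidthS G p%:E).
Local Notation T q p := (rwidthT G q p%:E).

Lemma half_freqL : (freqL lam / 2%:E = (l / 2)%:E)%E.
Proof. by rewrite Ll inver pnatr_eq0. Qed.

Lemma p0_set2 : [set p : R | 1 <= p <= 2 /\ widthS G p%:E = (freqL lam / 2%:E)%E] 2.
Proof.
split; first by rewrite lexx ler1n.
rewrite half_freqL (rwidthSE hlam G Ll) ?(rwidthS2 hlam G Ll)//.
by rewrite lee_fin ler1n.
Qed.

Lemma p0_bounds : 1 <= p0 G <= 2.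
Proof.
apply/andP; split; last first.
  by apply: ge_inf; [exists 1 => x [/andP[]]|exact: p0_set2].
by apply: lb_le_inf; [exists 2; exact: p0_set2|move=> x [/andP[]]].
Qed.

(** The infimum is attained: since p S_p is non-decreasing, every p in the set has p L/2 = p S_p >=
    p_0 S_{p_0}. If S_{p_0} > L/2, this would bound the set below by a number larger than p_0. *)
Lemma rwidthS_p0 : S (p0 G) = l / 2.
Proof.
have [P1 P2] := andP p0_bounds.
apply/eqP; rewrite eq_le; apply/andP; split; last first.
  by rewrite -(rwidthS2 hlam G Ll); apply: (rwidthS_anti hlam G Ll); rewrite lee_fin.
have P0 : 0 < p0 G by apply: lt_le_trans P1.
rewrite leNgt; apply/negP => lt.
have Sl := @rwidthS_le_freqL R lam hlam G l Ll (p0 G)%:E P1.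
have l2 : 0 < l / 2 by lra.
have : p0 G * S (p0 G) / (l / 2) <= p0 G.
  apply: lb_le_inf; first by exists 2; exact: p0_set2.
  move=> p [/andP[p1 p2]]; rewrite half_freqL (rwidthSE hlam G Ll) ?lee_fin// => -[Sp].
  rewrite ler_pdivrMr// -Sp; apply: (rwidthS_scale hlam G Ll) => //.
  apply: ge_inf; first by exists 1 => x [/andP[]].
  by split; rewrite ?p1// half_freqL (rwidthSE hlam G Ll) ?lee_fin// Sp.
by rewrite ler_pdivrMr// ler_pM2l// leNgt lt.
Qed.

Lemma invee_real (p : R) (q : \bar R) : 0 < p -> (p%:E <= q)%E ->
  exists qi, [/\ (q^-1 = qi%:E)%E, 0 <= qi, qi <= p^-1 & (p%:E < q)%E -> qi < p^-1].
Proof.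
move=> p0; case: q => [q| |]; last by rewrite leeNy_eq.
  rewrite !lee_fin !lte_fin => pq; have q0 := lt_le_trans p0 pq.
  exists q^-1; rewrite inver gt_eqF// invr_ge0 (ltW q0); split=> //.
    by rewrite lef_pV2.
  by move=> pq'; rewrite ltf_pV2.
by exists 0; rewrite invey invr_ge0 invr_gt0 (ltW p0) p0.
Qed.

Section bounds.
Let P := p0 G.
Let K := P * l / 2.
Let P1 : 1 <= P. Proof. by case/andP: p0_bounds. Qed.

Lemma rwidthS_bound p : 1 <= p <= P -> S p <= K / p.
Proof.
move=> /andP[p1 pP]; rewrite ler_pdivlMr ?(lt_le_trans _ p1)// mulrC.
by apply: (le_trans (rwidthS_scale hlam G Ll p1 pP)); rewrite rwidthS_p0 /K mulrA.
Qed.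

Lemma rwidthT_bound p q qi : 1 <= p <= P -> (p%:E <= q)%E -> (q^-1 = qi%:E)%E ->
  T q p <= K * (p^-1 - qi).
Proof.
move=> /andP[p1 pP] pq qE; have p0 : 0 < p by exact: lt_le_trans p1.
have [qi' [+ _ + _]] := invee_real p0 pq; rewrite qE => -[<-] qip.
apply: (le_trans (rwidthT_le_S hlam G Ll p1 pq qE)).
have := @rwidthS_bound p; rewrite p1 pP => /(_ isT) Sp.
have -> : K * (p^-1 - qi) = (1 - p * qi) * (K / p) by field; rewrite gt_eqF.
rewrite ler_wpM2l// subr_ge0 mulrC -ler_pdivlMr//; by rewrite mul1r.
Qed.

(** The function r S_r is non-decreasing and at most [K] up to [P], so once it reaches [K] it stays
    there. *)
Lemma extremal_S_up p r : 1 <= p -> p <= r <= P -> S p = K / p -> S r = K / r.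
Proof.
move=> p1 /andP[pr rP] Sp; have p0 : 0 < p by exact: lt_le_trans p1.
have r0 : 0 < r by exact: lt_le_trans pr.
apply/eqP; rewrite eq_le rwidthS_bound ?rP ?(le_trans p1)//=.
rewrite ler_pdivrMr// mulrC.
have := rwidthS_scale hlam G Ll p1 pr; rewrite Sp => h; apply: le_trans h.
by rewrite mulrC divfK// gt_eqF.
Qed.

(** The lower bound is the triangle inequality S_p <= T_{P,p} + S_P, with S_P = L/2 = K/P. *)
Lemma extremal_T_p0 p : 1 <= p <= P -> S p = K / p -> T P%:E p = K * (p^-1 - P^-1).
Proof.
move=> /andP[p1 pP] Sp; have P0 : 0 < P by exact: lt_le_trans P1.
apply/eqP; rewrite eq_le rwidthT_bound ?lee_fin ?p1// ?inver ?gt_eqF//=.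
have := @rwidthS_triangle R lam hlam G l Ll p%:E P%:E p1 pP.
rewrite Sp rwidthS_p0 mulrBr.
have -> : K / P = l / 2 by rewrite /K; field; rewrite gt_eqF.
by lra.
Qed.

(** Equality forces S_p >= K/p in T_{q,p} <= p (1/p - 1/q) S_p; p < q allows the division. *)
Lemma extremal_T_S p q qi : 1 <= p -> (p%:E < q)%E -> p <= P -> (q^-1 = qi%:E)%E ->
  T q p = K * (p^-1 - qi) -> S p = K / p.
Proof.
move=> p1 pq pP qE TE; have p0 : 0 < p by exact: lt_le_trans p1.
have [qi' [+ _ _]] := invee_real p0 (ltW pq); rewrite qE => -[<-] /(_ pq) qip.
apply/eqP; rewrite eq_le rwidthS_bound ?p1//=.
have := rwidthT_le_S hlam G Ll p1 (ltW pq) qE; rewrite TE.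
have -> : 1 - p * qi = p * (p^-1 - qi) by field; rewrite gt_eqF.
rewrite [leRHS]mulrAC ler_pM2r ?subr_gt0// => h.
by rewrite ler_pdivrMr// mulrC.
Qed.

(** For q <= P, use S_r <= T_{q,r} + S_q with both S extremal. Extremality of S is given only up to
    [P]; for q > P, the lower bound comes from [extremal_T_p0] and convexity at [P] between r and
    q. *)
Lemma extremal_S_T r q qi : 1 <= r < P -> (r%:E < q)%E -> (q^-1 = qi%:E)%E ->
  (forall m, r <= m <= P -> S m = K / m) -> T q r = K * (r^-1 - qi).
Proof.
move=> /andP[r1 rP] rq qE SE; have r0 : 0 < r by exact: lt_le_trans r1.
have P0 : 0 < P by exact: lt_le_trans P1.
apply/eqP; rewrite eq_le (rwidthT_bound _ (ltW rq) qE) ?r1 ?(ltW rP)//=.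
have [qP|Pq] := leP q P%:E.
  case: q rq qE qP => [q| |] //.
  rewrite lte_fin lee_fin => rq + qP.
  have q0 : 0 < q by exact: lt_trans rq.
  rewrite inver gt_eqF// => -[<-].
  have := @rwidthS_triangle R lam hlam G l Ll r%:E q%:E r1 (ltW rq).
  rewrite (SE q) ?(ltW rq)//= (SE r) ?lexx ?(ltW rP)// mulrBr => h.
  by rewrite lerBlDr.
have [qi' [+ _ _]] := invee_real P0 (ltW Pq); rewrite qE => -[<-] /(_ Pq) qiP.
have := rwidthT_interp hlam G Ll r1 rP Pq qE qiP.
rewrite (@extremal_T_p0 r) ?r1 ?(ltW rP)//; last by rewrite SE ?lexx ?ltW.
have rP' : 0 < r^-1 - P^-1 by rewrite subr_gt0 ltf_pV2.
by rewrite mulrAC [leRHS]mulrC ler_pM2r.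
Qed.

End bounds.
End p0_theory.

Section ereal_forms.
Context (R : realType).

Lemma ereal_widthS (P l p : R) : 0 < p ->
  (P%:E * l%:E / (2 * p)%:E = (P * l / 2 / p)%:E)%E.
Proof.
move=> p0; rewrite inver gt_eqF ?mulr_gt0// -!EFinM; congr _%:E.
by field; rewrite gt_eqF.
Qed.

Lemma ereal_widthT (P l p qi : R) (q : \bar R) : 0 < p -> (q^-1 = qi%:E)%E ->
  (P%:E * l%:E / 2%:E * (p%:E^-1 - q^-1) = (P * l / 2 * (p^-1 - qi))%:E)%E.
Proof.
by move=> p0 ->; rewrite !inver !gt_eqF// -!EFinM -EFinB -!EFinM.
Qed.

Lemma inve_sub_gt0 (p : R) (q : \bar R) : 0 < p -> (p%:E < q)%E ->
  (0 < p%:E^-1 - q^-1)%E.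
Proof.
move=> p0 pq; have [qi [-> _ _ /(_ pq) h]] := invee_real p0 (ltW pq).
by rewrite inver gt_eqF// -EFinB lte_fin subr_gt0.
Qed.

End ereal_forms.

(** In the last claim the disjunction excludes L = 0 and L = oo, where S_1 = L holds although p_0 =
    1. *)
Theorem proposition1p9 (R : realType) (lam : nat -> R)
    (hlam : is_frequency lam) (G : dirichlet_group lam) :
  [/\
    forall (p : R) (q : \bar R), 1 <= p <= p0 G -> (p%:E <= q)%E ->
      (widthS G p%:E <= (p0 G)%:E * freqL lam / (2 * p)%:E)%E /\
      (widthT G q p%:E <=
         (p0 G)%:E * freqL lam / 2%:E * (p%:E^-1 - q^-1))%E,

    1 < p0 G -> forall p : R, 1 <= p < p0 G ->
      [<-> widthS G p%:E = ((p0 G)%:E * freqL lam / (2 * p)%:E)%E;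

           forall r : R, p <= r <= p0 G ->
             widthS G r%:E = ((p0 G)%:E * freqL lam / (2 * r)%:E)%E;

           exists q : \bar R, (p%:E < q)%E /\
             widthT G q p%:E =
               ((p0 G)%:E * freqL lam / 2%:E * (p%:E^-1 - q^-1))%E;

           forall (r : R) (q : \bar R), p <= r < p0 G -> (r%:E < q)%E ->
             widthT G q r%:E =
               ((p0 G)%:E * freqL lam / 2%:E * (r%:E^-1 - q^-1))%E] &

    1 < p0 G \/ (0 < freqL lam < +oo)%E ->
    widthS G 1%:E = freqL lam ->
      [/\ p0 G = 2,
          forall r : R, 1 <= r <= 2 ->
            widthS G r%:E = (freqL lam / r%:E)%E &
          forall (r : R) (q : \bar R), 1 <= r <= 2 -> (r%:E <= q)%E ->
            widthT G q r%:E = (freqL lam * (r%:E^-1 - q^-1))%E]].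
Proof.
have [[l Ll]|Loo] : (exists l, freqL lam = l%:E) \/ freqL lam = +oo%E.
  by have := freqL_ge0 hlam; case: (freqL lam) => [l| |] //; [left; exists l|right].
2: {
  (* For L = oo, S_1 = oo = L/2. Then only p = 1 remains in the bounds, and the hypotheses of the
     other two claims fail. *)
  have PE : p0 G = 1.
    apply: p0_eq1; rewrite (widthS_infty hlam G _ Loo) ?lexx ?ler1n//.
    by rewrite Loo inver pnatr_eq0/= gt0_mulye// lte_fin invr_gt0.
  split.
  - rewrite PE => p q p1 pq; have {p1} E : p = 1 by apply/eqP; rewrite eq_le andbC.
    rewrite {}E in pq *; rewrite Loo mul1e mulr1 inver pnatr_eq0/=.
    have L2 : (+oo * (2^-1)%:E = +oo :> \bar R)%E by rewrite gt0_mulye// lte_fin invr_gt0.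
    (* For q = 1 the bound is the product of +oo and 0, which is 0, and T_{1,1} = 0. *)
    rewrite L2 leey; split=> //; move: pq; rewrite le_eqVlt => /orP[/eqP<-|pq].
      by rewrite widthT_diag mule_ge0// inver oner_eq0 invr1 subee.
    by rewrite gt0_mulye ?leey//; exact: inve_sub_gt0.
  - by rewrite PE ltxx.
  - by rewrite PE Loo !ltxx andbF => -[].
}
have /andP[P1 P2] := p0_bounds hlam G Ll.
have P0 : 0 < p0 G by exact: lt_le_trans P1.
pose K := p0 G * l / 2.
have SE p : 1 <= p -> widthS G p%:E = (rwidthS G p%:E)%:E.
  by move=> p1; rewrite (rwidthSE hlam G Ll).
have TE (p : R) q : 1 <= p -> (p%:E <= q)%E -> widthT G q p%:E = (rwidthT G q p%:E)%:E.
  by move=> p1 pq; rewrite (rwidthTE hlam G Ll).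
have SK p : 1 <= p -> widthS G p%:E = (K / p)%:E <-> rwidthS G p%:E = K / p.
  by move=> p1; rewrite SE//; split=> [[]|->].
have gt0 p : 1 <= p -> 0 < p :> R by exact: lt_le_trans.
have up p : 1 <= p -> rwidthS G p%:E = K / p -> forall r, p <= r <= p0 G ->
    rwidthS G r%:E = K / r.
  by move=> p1 Sp r pr; exact: (extremal_S_up hlam Ll p1 pr Sp).
have upT p : 1 <= p -> rwidthS G p%:E = K / p -> forall (r : R) q qi,
    p <= r < p0 G -> (r%:E < q)%E -> (q^-1 = qi%:E)%E ->
    rwidthT G q r%:E = K * (r^-1 - qi).
  move=> p1 Sp r q qi /andP[pr rP] rq qE.
  apply: (extremal_S_T hlam Ll _ rq qE); first by rewrite (le_trans p1)//=.
  by move=> m /andP[rm mP]; apply: up Sp _ _ => //; rewrite (le_trans pr).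
split; rewrite ?Ll.
- move=> p q pP pq; have [p1 _] := andP pP; have p0 := gt0 p p1.
  have [qi [qE _ _ _]] := invee_real p0 pq.
  rewrite ereal_widthS// (ereal_widthT _ _ p0 qE) SE// TE// !lee_fin.
  by split; [exact: rwidthS_bound|exact: rwidthT_bound].
- move=> Pgt1 p /andP[p1 pP]; have p0 := gt0 p p1.
  have -> : ((Defs.p0 G)%:E * l%:E / (2 * p)%:E = (K / p)%:E)%E by rewrite ereal_widthS.
  tfae.
  + move=> /(SK p p1) Sp r pr; have [pr' _] := andP pr; have r1 := le_trans p1 pr'.
    by rewrite ereal_widthS ?gt0// SE// (up p p1 Sp).
  + move=> /(_ p); rewrite lexx (ltW pP) => /(_ isT).
    rewrite ereal_widthS// -/K => /(SK p p1) Sp.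
    (* At q = p_0 the value S_q = L/2 is always known. *)
    exists (Defs.p0 G)%:E; split; first by rewrite lte_fin.
    have PE : ((Defs.p0 G)%:E^-1 = (Defs.p0 G)^-1%:E)%E by rewrite inver gt_eqF.
    rewrite (ereal_widthT _ _ p0 PE) TE ?lee_fin ?(ltW pP)//; congr _%:E.
    by apply: (extremal_T_p0 hlam Ll) Sp; rewrite p1 ltW.
  + move=> [q [pq Tq]] r q' /andP[pr rP] rq'; have r1 := le_trans p1 pr.
    have [qi [qE _ _ _]] := invee_real p0 (ltW pq).
    have [qi' [qE' _ _ _]] := invee_real (gt0 r r1) (ltW rq').
    rewrite (ereal_widthT _ _ (gt0 r r1) qE') TE ?(ltW rq')//; congr _%:E.
    have Sp : rwidthS G p%:E = K / p.
      apply: (extremal_T_S hlam Ll p1 pq (ltW pP) qE).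
      by move: Tq; rewrite (ereal_widthT _ _ p0 qE) TE ?(ltW pq)// => -[].
    by apply: (upT p p1 Sp) => //; rewrite pr.
  + move=> /(_ p +oo%E); rewrite lexx pP ltry => /(_ isT isT).
    rewrite (ereal_widthT _ _ p0 invey) TE ?leey// => -[T].
    by apply/(SK p p1)/(extremal_T_S hlam Ll p1 (ltry p) (ltW pP) invey).
- move=> h S1.
  have l0 : 0 <= l by rewrite -lee_fin -Ll (freqL_ge0 hlam).
  have {}S1 : rwidthS G 1%:E = l by move: S1; rewrite SE// => -[].
  (* If L = 0, then S_1 = 0 = L/2 and p_0 = 1, contrary to either alternative of the hypothesis. *)
  have lgt0 : 0 < l.
    case: h => [Pgt1|/andP[]//]; rewrite lt_neqAle l0 andbT; apply/eqP => l00.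
    by move: Pgt1; rewrite p0_eq1 ?ltxx// SE// S1 (half_freqL Ll) -l00 mul0r.
  have PE : p0 G = 2.
    apply/eqP; rewrite eq_le P2 /=.
    (* L = S_1 <= p_0 L/2 with L > 0 forces p_0 >= 2. *)
    have := @rwidthS_bound R lam hlam G l Ll 1; rewrite lexx P1 => /(_ isT).
    by rewrite S1 divr1 mulrAC ler_pMl// ler_pdivlMr// mul1r.
  have Kl : K = l by rewrite /K PE; field.
  have SK1 : rwidthS G 1%:E = K / 1 by rewrite Kl divr1.
  have upr r : 1 <= r <= 2 -> rwidthS G r%:E = l / r.
    by move=> r12; rewrite (up 1 (lexx _) SK1) ?PE// Kl.
  split=> //.
  + move=> r r12; have [r1 _] := andP r12.
    by rewrite SE// upr// inver gt_eqF// gt0.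
  move=> r q /andP[r1 r2] rq; have r0 := gt0 r r1.
  have [qi [qE _ _ _]] := invee_real r0 rq.
  rewrite qE inver gt_eqF// -EFinB -EFinM TE//; congr _%:E.
  move: rq; rewrite le_eqVlt => /orP[/eqP rq|rq].
    rewrite -rq inver gt_eqF// in qE; case: qE => <-.
    by rewrite -rq subrr mulr0 /rwidthT widthT_diag.
  have [r2'|r2'] := ltP r 2.
    by rewrite -Kl; apply: (upT 1 (lexx _) SK1) => //; rewrite PE r1.
  (* The endpoint r = 2 = p_0 lies outside the range of (iv). The lower bound there comes from
     T_{q,1} <= T_{q,2} + T_{2,1}, where T_{q,1} and T_{2,1} are known. *)
  have {r2 r2'} r2E : r = 2 by apply/eqP; rewrite eq_le r2.
  rewrite {}r2E in r1 r0 rq *.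
  have one2 : (1%:E <= 2%:E :> \bar R)%E by rewrite lee_fin ler1n.
  apply/eqP; rewrite eq_le; apply/andP; split.
    rewrite -Kl; apply: (rwidthT_bound hlam Ll _ (ltW rq) qE).
    by rewrite PE lexx ler1n.
  have := rwidthT_triangle hlam G Ll (lexx 1%:E) one2 (ltW rq).
  rewrite (upT 1 (lexx _) SK1 1 q qi) ?lexx//; last 2 first.
  - by rewrite PE ltr1n.
  - by apply: lt_trans rq; rewrite lte_fin ltr1n.
  have := @extremal_T_p0 R lam hlam G l Ll 1; rewrite lexx P1 => /(_ isT SK1).
  by rewrite PE -/K => -> ; rewrite Kl; lra.
Qed.
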